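(* Let $0<q<1$ and let $N$ be a positive integer. Let $L^2(\mathcal L_N),L^2(\mathcal L_{-N})$ be the spaces of $L^2$-sections of the canonical quantum line bundles on $\mathbb CP^2_q$, and let $H^0(L^2(\mathcal L_M),\nabla_M^{\bar\partial})$ be the kernel of $\nabla_M^{\bar\partial}$ on $L^2(\mathcal L_M)$. Then (1) $H^0(L^2(\mathcal L_N),\nabla_N^{\bar\partial})\simeq\mathbb C^{\frac{(N+1)(N+2)}{2}}$; (2) $H^0(L^2(\mathcal L_{-N}),\nabla_{-N}^{\bar\partial})=0$.
   Context: Fix $0<q<1$; $[z]=\frac{q^z-q^{-z}}{q-q^{-1}}$, $[n]!=[1][2]\cdots[n]$, $[j,k,l]!=q^{-(jk+kl+lj)}\frac{[j+k+l]!}{[j]!\,[k]!\,[l]!}$. $U_q(\mathfrak{su}(3))$ is the Hopf $*$-algebra generated by $K_i^{\pm1},E_i,F_i$ ($i=1,2$), $K_i^*=K_i$, $E_i^*=F_i$, with $[K_1,K_2]=0$, $K_iE_i=qE_iK_i$, $[E_i,F_i]=\frac{K_i^2-K_i^{-2}}{q-q^{-1}}$, and for $i\ne j$: $K_iE_j=q^{-1/2}E_jK_i$, $[E_i,F_j]=0$, $E_i^2E_j+E_jE_i^2=(q+q^{-1})E_iE_jE_i$; $\Delta(K_i)=K_i\otimes K_i$, $\Delta(E_i)=E_i\otimes K_i+K_i^{-1}\otimes E_i$, $\Delta(F_i)=F_i\otimes K_i+K_i^{-1}\otimes F_i$; $\epsilon(K_i)=1$, $\epsilon(E_i)=\epsilon(F_i)=0$;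 $S(K_i)=K_i^{-1}$, $S(E_i)=-qE_i$, $S(F_i)=-q^{-1}F_i$. $\mathcal A(SU_q(3))$ is the Hopf $*$-algebra generated by $u^i_j$ ($i,j=1,2,3$) with $u^i_ku^j_k=qu^j_ku^i_k$ and $u^k_iu^k_j=qu^k_ju^k_i$ for $i<j$; $[u^i_l,u^j_k]=0$ and $[u^i_k,u^j_l]=(q-q^{-1})u^i_lu^j_k$ for $i<j$, $k<l$; $\sum_{\pi\in S_3}(-q)^{\ell(\pi)}u^1_{\pi(1)}u^2_{\pi(2)}u^3_{\pi(3)}=1$; $(u^i_j)^*=(-q)^{j-i}(u^{k_1}_{l_1}u^{k_2}_{l_2}-qu^{k_1}_{l_2}u^{k_2}_{l_1})$, where $\{k_1<k_2\}=\{1,2,3\}\setminus\{i\}$, $\{l_1<l_2\}=\{1,2,3\}\setminus\{j\}$; $\Delta(u^i_j)=\sum_ku^i_k\otimes u^k_j$. It carries a right action of $U_q(\mathfrak{su}(3))$ with $(ab)\triangleleft h=(a\triangleleft h_{(1)})(b\triangleleft h_{(2)})$, $1\triangleleft h=\epsilon(h)1$, $(a\triangleleft h)^*=a^*\triangleleft S(h)^*$, and $u^j_k\triangleleft K_i=q^{\frac12(\delta_{i+1,j}-\delta_{i,j})}u^j_k$, $u^j_k\triangleleft E_i=\delta_{i+1,j}u^i_k$, $u^j_k\triangleleft F_i=\delta_{i,j}u^{i+1}_k$. $\mathcal A(S^5_q)=\{a\in\mathcal A(SU_q(3)): a\triangleleft h=\epsilon(h)a$ for $h$ in the subalgebra generated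 by $K_1^{\pm1},E_1,F_1\}$, generated as a $*$-algebra by $z_j=u^3_j$; for $N\in\mathbb Z$, $\mathcal L_N=\{a\in\mathcal A(S^5_q): a\triangleleft K_1K_2^2=q^Na\}$; $\mathcal A(\mathbb CP^2_q)=\mathcal L_0$. $L^2(SU_q(3))$ is the completion of $\mathcal A(SU_q(3))$ for $\langle a,b\rangle=h(a^*b)$, $h$ the (faithful) Haar state. By Peter–Weyl it is the Hilbert space direct sum, over the irreducible representations $V(n_1,n_2)$, $(n_1,n_2)\in\mathbb N^2$, of the finite-dimensional spaces of matrix coefficients $V(n_1,n_2)\otimes V(n_1,n_2)$, each invariant under the right action; the action $\triangleleft$ is extended to (formal sums representing) elements of $L^2(SU_q(3))$ block by block. $L^2(\mathcal L_N)$ is the closure of $\mathcal L_N$ in $L^2(SU_q(3))$, and $L^2(\mathbb CP^2_q)=L^2(\mathcal L_0)$. The unbounded operator $Z$ on $L^2(SU_q(3))$ is $Z(a)=(a\triangleleft F_2F_1,\ a\triangleleft F_2)$ with domain $\mathrm{Dom}(Z)=\{a\in L^2(SU_q(3)):(a\triangleleft F_2F_1,a\triangleleft F_2)\in L^2(SU_q(3))^2\}$; it extends $\bar\partial a=(a\triangleleft F_2F_1,a\triangleleft F_2)^t$ on $\mathcal A(\mathbb CP^2_q)$. $\Psi_N$ is the column vector with components $\psi^N_{j,k,l}$ ($j,k,l\ge0$, $j+k+l=|N|$), where $(\psi^N_{j,k,l})^*=\sqrt{[j,k,l]!}\,z_1^jz_2^kz_3^l$ if $N\ge0$ and $(\psi^N_{j,k,l})^*=q^{-N+j-l}\sqrt{[j,k,l]!}\,(z_1^jz_2^kz_3^l)^*$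 if $N\le 0$; then $\Psi_N^\dagger\Psi_N=1$. Elements of $\mathcal A(SU_q(3))$ act on $L^2(SU_q(3))$ by (bounded) left multiplication. On $L^2$-sections, $\nabla_N^{\bar\partial}\xi=q^{-N}\Psi_N^\dagger\,Z(\Psi_N\xi)=q^{-N}\Psi_N^\dagger\big((\Psi_N\xi)\triangleleft F_2F_1,\ (\Psi_N\xi)\triangleleft F_2\big)^t$, with domain the $\xi\in L^2(\mathcal L_N)$ such that all entries of $\Psi_N\xi$ lie in $\mathrm{Dom}(Z)$. *)

(* Defs.v *)
(* The scalars are R[i] for an arbitrary realType R.  Indices are 0-based: 'I_2
   stands for {1,2} and 'I_3 for {1,2,3}. *)
From HB Require Import structures.
Set Warnings "-notation-overridden,-ambiguous-paths,-redundant-canonical-projection".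
From mathcomp Require Import all_boot all_order all_algebra all_fingroup.
From mathcomp Require Import generic_quotient complex.
From mathcomp Require Import boolp classical_sets reals topology normedtype.

Set Implicit Arguments.
Unset Strict Implicit.
Unset Printing Implicit Defensive.

Import Order.TTheory GRing.Theory Num.Theory.
Local Open Scope ring_scope.
Local Open Scope quotient_scope.

HB.mixin Record isStarAlgebra (C : numClosedFieldType) A of GRing.Algebra C A := {
  star : A -> A;
  starK : involutive star;
  starD : {morph star : x y / x + y};
  starM : forall x y, star (x * y) = star y * star x;
  starZ : forall (c : C) x, star (c *: x) = c^* *: star x
}.

#[short(type="starAlgType")]
HB.structure Definition StarAlgebra (C : numClosedFieldType) :=
  {A of GRing.Algebra C A & isStarAlgebra C A}.

Section ScalarStar.
Variable C : numClosedFieldType.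
Definition scalar_star (z : C^o) : C^o := (z : C)^*.
Fact scalar_starK : involutive scalar_star. Proof. exact: conjCK. Qed.
Fact scalar_starD : {morph scalar_star : x y / x + y}.
Proof. by move=> x y; rewrite /scalar_star rmorphD. Qed.
Fact scalar_starM x y : scalar_star (x * y) = scalar_star y * scalar_star x.
Proof. by rewrite /scalar_star rmorphM mulrC. Qed.
Fact scalar_starZ (c : C) x : scalar_star (c *: x) = c^* *: scalar_star x.
Proof. by rewrite /scalar_star rmorphM. Qed.
HB.instance Definition _ := isStarAlgebra.Build C C^o
  scalar_starK scalar_starD scalar_starM scalar_starZ.
End ScalarStar.

Section StarAlgTheory.
Context {C : numClosedFieldType} {A : starAlgType C}.
Lemma star1 : star (1 : A) = 1.
Proof. by rewrite -[LHS]mulr1 -{2}[1]starK -starM mulr1 starK. Qed.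
Lemma star0 : star (0 : A) = 0.
Proof. by apply: (addrI (star 0)); rewrite -starD !addr0. Qed.
Lemma starN (x : A) : star (- x) = - star x.
Proof. by apply: (addrI (star x)); rewrite -starD !subrr star0. Qed.
End StarAlgTheory.

(* [rels A g] says that the family [g] of elements of [A] satisfies the relations.
   A scalar solution of the relations (a character) is part of the data, because
   algType excludes the zero ring; for a Hopf algebra it is the counit. *)
Record presentation (C : numClosedFieldType) := Presentation {
  gens : Type;
  rels : forall A : starAlgType C, (gens -> A) -> Prop;
  pchar : gens -> C;
  pcharP : rels (pchar : gens -> C^o)
}.

Section Presented.
Variables (C : numClosedFieldType) (P : presentation C).

Inductive spoly : Type :=
| Gen of gens P
| Cst of C
| Add of spoly & spoly
| Mul of spoly & spoly
| Star of spoly.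

Fixpoint seval (A : starAlgType C) (g : gens P -> A) (x : spoly) : A :=
  match x with
  | Gen i => g i
  | Cst c => c%:A
  | Add x y => seval g x + seval g y
  | Mul x y => seval g x * seval g y
  | Star x => star (seval g x)
  end.

(* The congruence generated by the relations: two star-polynomials are identified
   iff they agree in every star-algebra in which the relations hold. *)
Definition seqv (x y : spoly) : Prop :=
  forall (A : starAlgType C) (g : gens P -> A), rels g -> seval g x = seval g y.

HB.instance Definition _ := gen_eqMixin spoly.
HB.instance Definition _ := gen_choiceMixin spoly.

Definition seqvb (x y : spoly) : bool := `[< seqv x y >].
Fact seqvb_refl : reflexive seqvb. Proof. by move=> x; apply/asboolP. Qed.
Fact seqvb_sym : symmetric seqvb.
Proof. by move=> x y; apply/asboolP/asboolP => h A g /h. Qed.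
Fact seqvb_trans : transitive seqvb.
Proof.
move=> y x z /asboolP xy /asboolP yz; apply/asboolP => A g hg.
by rewrite xy // yz.
Qed.
Canonical seqv_equiv := EquivRel seqvb seqvb_refl seqvb_sym seqvb_trans.

Definition presAlg : Type := {eq_quot seqv_equiv}.
HB.instance Definition _ := Choice.on presAlg.

Definition pclass (x : spoly) : presAlg := \pi_({eq_quot seqv_equiv}) x.
Definition prepr (x : presAlg) : spoly := repr (x : {eq_quot seqv_equiv}).

Definition plift (A : starAlgType C) (g : gens P -> A) (x : presAlg) : A :=
  seval g (prepr x).

Lemma plift_class (A : starAlgType C) (g : gens P -> A) x :
  rels g -> plift g (pclass x) = seval g x.
Proof.
move=> hg; rewrite /plift /prepr /pclass.
have /eqmodP/asboolP h : repr (\pi_({eq_quot seqv_equiv}) x) = x %[mod {eq_quot seqv_equiv}].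
  by rewrite reprK.
exact: h.
Qed.

Lemma presP (x y : presAlg) :
  (forall (A : starAlgType C) (g : gens P -> A), rels g -> plift g x = plift g y) ->
  x = y.
Proof.
move=> h; rewrite -[x](@reprK _ {eq_quot seqv_equiv}) -[y](@reprK _ {eq_quot seqv_equiv}).
by apply/eqmodP/asboolP.
Qed.

Definition padd (x y : presAlg) := pclass (Add (prepr x) (prepr y)).
Definition pmul (x y : presAlg) := pclass (Mul (prepr x) (prepr y)).
Definition pcst (c : C) := pclass (Cst c).
Definition pscale (c : C) (x : presAlg) := pclass (Mul (Cst c) (prepr x)).
Definition popp (x : presAlg) := pclass (Mul (Cst (-1)) (prepr x)).
Definition pstar (x : presAlg) := pclass (Star (prepr x)).

Section Eval.
Variables (A : starAlgType C) (g : gens P -> A) (hg : rels g).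
Lemma paddE x y : plift g (padd x y) = plift g x + plift g y.
Proof. by rewrite plift_class. Qed.
Lemma pmulE x y : plift g (pmul x y) = plift g x * plift g y.
Proof. by rewrite plift_class. Qed.
Lemma pcstE c : plift g (pcst c) = c%:A.
Proof. by rewrite plift_class. Qed.
Lemma pscaleE c x : plift g (pscale c x) = c *: plift g x.
Proof. by rewrite plift_class //= -scalerAl mul1r. Qed.
Lemma poppE x : plift g (popp x) = - plift g x.
Proof. by rewrite plift_class //= -scalerAl mul1r scaleN1r. Qed.
Lemma pstarE x : plift g (pstar x) = star (plift g x).
Proof. by rewrite plift_class. Qed.
End Eval.

Fact paddA : associative padd.
Proof. by move=> x y z; apply: presP => A g hg; rewrite !(paddE hg) addrA. Qed.
Fact paddC : commutative padd.
Proof. by move=> x y; apply: presP => A g hg; rewrite !(paddE hg) addrC. Qed.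
Fact padd0 : left_id (pcst 0) padd.
Proof.
by move=> x; apply: presP => A g hg; rewrite (paddE hg) (pcstE hg) scale0r add0r.
Qed.
Fact paddN : left_inverse (pcst 0) popp padd.
Proof.
move=> x; apply: presP => A g hg.
by rewrite (paddE hg) (poppE hg) (pcstE hg) addNr scale0r.
Qed.
HB.instance Definition _ := GRing.isZmodule.Build presAlg paddA paddC padd0 paddN.

Fact pmulA : associative pmul.
Proof. by move=> x y z; apply: presP => A g hg; rewrite !(pmulE hg) mulrA. Qed.
Fact pmul1l : left_id (pcst 1) pmul.
Proof.
by move=> x; apply: presP => A g hg; rewrite (pmulE hg) (pcstE hg) scale1r mul1r.
Qed.
Fact pmul1r : right_id (pcst 1) pmul.
Proof.
by move=> x; apply: presP => A g hg; rewrite (pmulE hg) (pcstE hg) scale1r mulr1.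
Qed.
Fact pmulDl : left_distributive pmul padd.
Proof.
by move=> x y z; apply: presP => A g hg; rewrite !(paddE hg, pmulE hg) mulrDl.
Qed.
Fact pmulDr : right_distributive pmul padd.
Proof.
by move=> x y z; apply: presP => A g hg; rewrite !(paddE hg, pmulE hg) mulrDr.
Qed.
Fact pone_neq0 : pcst 1 != pcst 0.
Proof.
apply/eqP => /(congr1 (plift (pchar (p := P) : gens P -> C^o))).
rewrite !(pcstE (pcharP P)) scale1r scale0r => /eqP.
by rewrite (oner_eq0 C).
Qed.
HB.instance Definition _ := GRing.Zmodule_isNzRing.Build presAlg
  pmulA pmul1l pmul1r pmulDl pmulDr pone_neq0.

Fact pscaleA a b x : pscale a (pscale b x) = pscale (a * b) x.
Proof. by apply: presP => A g hg; rewrite !(pscaleE hg) scalerA. Qed.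
Fact pscale1 : left_id 1 pscale.
Proof. by move=> x; apply: presP => A g hg; rewrite !(pscaleE hg) scale1r. Qed.
Fact pscaleDr : right_distributive pscale +%R.
Proof.
move=> c x y; apply: presP => A g hg.
by rewrite (pscaleE hg) !(paddE hg) !(pscaleE hg) scalerDr.
Qed.
Fact pscaleDl x : {morph pscale^~ x : a b / a + b}.
Proof.
move=> a b; apply: presP => A g hg.
by rewrite /= (paddE hg) !(pscaleE hg) scalerDl.
Qed.
HB.instance Definition _ := GRing.Zmodule_isLmodule.Build C presAlg
  pscaleA pscale1 pscaleDr pscaleDl.

Lemma pliftM (A : starAlgType C) (g : gens P -> A) (hg : rels g) (x y : presAlg) :
  plift g (x * y) = plift g x * plift g y.
Proof. exact: pmulE. Qed.
Lemma pliftZ (A : starAlgType C) (g : gens P -> A) (hg : rels g) c (x : presAlg) :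
  plift g (c *: x) = c *: plift g x.
Proof. exact: pscaleE. Qed.
Lemma pliftD (A : starAlgType C) (g : gens P -> A) (hg : rels g) (x y : presAlg) :
  plift g (x + y) = plift g x + plift g y.
Proof. exact: paddE. Qed.

Fact pscaleAl (c : C) (x y : presAlg) : c *: (x * y) = (c *: x) * y.
Proof.
by apply: presP => A g hg; rewrite (pliftZ hg) !(pliftM hg) (pliftZ hg) scalerAl.
Qed.
HB.instance Definition _ := GRing.Lmodule_isLalgebra.Build C presAlg pscaleAl.

Fact pscaleAr (c : C) (x y : presAlg) : c *: (x * y) = x * (c *: y).
Proof.
by apply: presP => A g hg; rewrite (pliftZ hg) !(pliftM hg) (pliftZ hg) scalerAr.
Qed.
HB.instance Definition _ := GRing.Lalgebra_isAlgebra.Build C presAlg pscaleAr.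

Fact pstarK : involutive pstar.
Proof. by move=> x; apply: presP => A g hg; rewrite !(pstarE hg) starK. Qed.
Fact pstarD : {morph pstar : x y / x + y}.
Proof.
move=> x y; apply: presP => A g hg.
by rewrite (pstarE hg) !(pliftD hg) !(pstarE hg) starD.
Qed.
Fact pstarM (x y : presAlg) : pstar (x * y) = pstar y * pstar x.
Proof.
by apply: presP => A g hg; rewrite (pstarE hg) !(pliftM hg) !(pstarE hg) starM.
Qed.
Fact pstarZ (c : C) (x : presAlg) : pstar (c *: x) = c^* *: pstar x.
Proof.
by apply: presP => A g hg; rewrite (pstarE hg) !(pliftZ hg) !(pstarE hg) starZ.
Qed.
HB.instance Definition _ := isStarAlgebra.Build C presAlg pstarK pstarD pstarM pstarZ.

Definition pgen (i : gens P) : presAlg := pclass (Gen i).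

Definition pchar_ext (x : presAlg) : C := plift (pchar (p := P) : gens P -> C^o) x.

Section Lift.
Variables (A : starAlgType C) (g : gens P -> A) (hg : rels g).
Lemma plift_gen i : plift g (pgen i) = g i.
Proof. by rewrite plift_class. Qed.
Lemma plift0 : plift g 0 = 0.
Proof. by rewrite (pcstE hg) scale0r. Qed.
Lemma pliftN x : plift g (- x) = - plift g x.
Proof. exact: poppE. Qed.
Lemma plift1 : plift g 1 = 1.
Proof. by rewrite (pcstE hg) scale1r. Qed.
Lemma plift_star x : plift g (star x) = star (plift g x).
Proof. exact: pstarE. Qed.
Lemma plift_sum I r (Q : pred I) F :
  plift g (\sum_(i <- r | Q i) F i) = \sum_(i <- r | Q i) plift g (F i).
Proof. exact: (big_morph _ (pliftD hg) plift0). Qed.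
End Lift.

End Presented.

Section Tensor.
Variables (C : numClosedFieldType) (A : algType C).

(* A list [:: (a_1, b_1); ...; (a_n, b_n)] stands for the element
   a_1 (x) b_1 + ... + a_n (x) b_n of the algebraic tensor product A (x) A. *)
Definition bilin (V : lmodType C) (b : A -> A -> V) : Prop :=
  (forall x, linear (b x)) /\ (forall y, linear (b^~ y)).

Definition teq (s t : seq (A * A)) : Prop :=
  forall (V : lmodType C) (b : A -> A -> V), bilin b ->
    \sum_(p <- s) b p.1 p.2 = \sum_(p <- t) b p.1 p.2.

(* [D a] is a Sweedler representative of the value at a of a unital algebra
   morphism A -> A (x) A. *)
Record tensor_morphism (D : A -> seq (A * A)) : Prop := {
  tmor_lin : forall (c : C) a b,
    teq (D (c *: a + b)) ([seq (c *: p.1, p.2) | p <- D a] ++ D b);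
  tmor1 : teq (D 1) [:: (1, 1)];
  tmorM : forall a b,
    teq (D (a * b)) [seq (p.1 * r.1, p.2 * r.2) | p <- D a, r <- D b]
}.
End Tensor.

Local Open Scope complex_scope.

Section QNumbers.
Variables (R : realType) (q : R).

Definition qnum (n : nat) : R := (q ^+ n - q ^- n) / (q - q^-1).
Definition qfact (n : nat) : R := \prod_(1 <= i < n.+1) qnum i.
Definition qtrinom (j k l : nat) : R :=
  q ^- (j * k + k * l + l * j) * qfact (j + k + l)
    / (qfact j * qfact k * qfact l).

Definition qhalf (m : int) : R := Num.sqrt q ^ m.
End QNumbers.

Section Uq.
Variables (R : realType) (q : R).
Local Notation C := R[i].

Inductive Uq_gen : Type :=
| UK of 'I_2 | UKV of 'I_2 | UE of 'I_2 | UF of 'I_2.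

Record Uq_rels (A : starAlgType C) (g : Uq_gen -> A) : Prop := {
  Uq_KV : forall i, g (UK i) * g (UKV i) = 1;
  Uq_VK : forall i, g (UKV i) * g (UK i) = 1;
  Uq_starK : forall i, star (g (UK i)) = g (UK i);
  Uq_starE : forall i, star (g (UE i)) = g (UF i);
  Uq_KK : forall i j, g (UK i) * g (UK j) = g (UK j) * g (UK i);
  Uq_KE : forall i, g (UK i) * g (UE i) = q%:C *: (g (UE i) * g (UK i));
  Uq_EF : forall i, g (UE i) * g (UF i) - g (UF i) * g (UE i)
    = ((q - q^-1)^-1)%:C *: (g (UK i) ^+ 2 - g (UKV i) ^+ 2);
  Uq_KE' : forall i j, i != j ->
    g (UK i) * g (UE j) = (qhalf q (-1))%:C *: (g (UE j) * g (UK i));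
  Uq_EF' : forall i j, i != j -> g (UE i) * g (UF j) = g (UF j) * g (UE i);
  Uq_Serre : forall i j, i != j ->
    g (UE i) ^+ 2 * g (UE j) + g (UE j) * g (UE i) ^+ 2
    = (q + q^-1)%:C *: (g (UE i) * g (UE j) * g (UE i))
}.

Definition Uq_counit (x : Uq_gen) : C :=
  match x with UK _ | UKV _ => 1 | UE _ | UF _ => 0 end.

Fact Uq_counitP : Uq_rels (Uq_counit : Uq_gen -> C^o).
Proof.
split=> * /=; rewrite ?mulr1 ?mulr0 ?mul0r ?scaler0 ?addr0 ?subrr ?scaler0 //.
all: try exact: conjC1; exact: conjC0.
Qed.

Definition Uq_pres : presentation C := Presentation Uq_counitP.
Definition Uq : starAlgType C := presAlg Uq_pres.

Fact Uq_genP : Uq_rels (@pgen C Uq_pres : Uq_gen -> Uq).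
Proof.
split=> [i|i|i|i|i j|i|i|i j ij|i j ij|i j ij];
  apply: (@presP C Uq_pres) => A g hg; have [] := (hg : Uq_rels g);
  by rewrite ?expr2 !(pliftD hg, pliftN hg, pliftM hg, pliftZ hg, plift1 hg,
    plift_star hg, plift_gen hg) -?expr2 => *; auto.
Qed.

Definition gK i : Uq := @pgen C Uq_pres (UK i).
Definition gKV i : Uq := @pgen C Uq_pres (UKV i).
Definition gE i : Uq := @pgen C Uq_pres (UE i).
Definition gF i : Uq := @pgen C Uq_pres (UF i).

Definition epsU : Uq -> C := @pchar_ext C Uq_pres.

(* The coproduct (up to the choice of Sweedler representatives) and the antipode are
   determined by their values on the generators; so are, below, the coproduct of
   A(SU_q(3)) and the right action.  The Haar state is unique too. *)
Record Uq_hopf : Type := {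
  copU : Uq -> seq (Uq * Uq);
  copU_mor : tensor_morphism copU;
  copU_K : forall i, teq (copU (gK i)) [:: (gK i, gK i)];
  copU_E : forall i, teq (copU (gE i)) [:: (gE i, gK i); (gKV i, gE i)];
  copU_F : forall i, teq (copU (gF i)) [:: (gF i, gK i); (gKV i, gF i)];
  antipode : Uq -> Uq;
  antipode_lin : linear antipode;
  antipode1 : antipode 1 = 1;
  antipodeM : forall g h, antipode (g * h) = antipode h * antipode g;
  antipode_K : forall i, antipode (gK i) = gKV i;
  antipode_E : forall i, antipode (gE i) = - q%:C *: gE i;
  antipode_F : forall i, antipode (gF i) = - (q^-1)%:C *: gF i
}.

Inductive subalg_KEF1 : Uq -> Prop :=
| subalg_KEF1_K : subalg_KEF1 (gK ord0)
| subalg_KEF1_KV : subalg_KEF1 (gKV ord0)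
| subalg_KEF1_E : subalg_KEF1 (gE ord0)
| subalg_KEF1_F : subalg_KEF1 (gF ord0)
| subalg_KEF1_1 : subalg_KEF1 1
| subalg_KEF1_lin (c : C) x y : subalg_KEF1 x -> subalg_KEF1 y -> subalg_KEF1 (c *: x + y)
| subalg_KEF1_mul x y : subalg_KEF1 x -> subalg_KEF1 y -> subalg_KEF1 (x * y).

End Uq.

Section SUq3.
Variables (R : realType) (q : R).
Local Notation C := R[i].

Definition perm_length (s : 'S_3) : nat :=
  #|[set p : 'I_3 * 'I_3 | (p.1 < p.2)%N && (s p.2 < s p.1)%N]|.

Definition qminor (A : starAlgType C) (u : 'I_3 -> 'I_3 -> A) k1 k2 l1 l2 : A :=
  u k1 l1 * u k2 l2 - q%:C *: (u k1 l2 * u k2 l1).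

(* u i j is u^i_j.  The increasing enumeration of the complement of {i} in 'I_3
   is (lift i ord0, lift i ord_max), with lift i : 'I_2 -> 'I_3. *)
Record SUq3_rels (A : starAlgType C) (g : 'I_3 * 'I_3 -> A)
    (u := fun i j => g (i, j)) : Prop := {
  SUq3_col : forall i j k : 'I_3, (i < j)%N -> u i k * u j k = q%:C *: (u j k * u i k);
  SUq3_row : forall i j k : 'I_3, (i < j)%N -> u k i * u k j = q%:C *: (u k j * u k i);
  SUq3_comm : forall i j k l : 'I_3, (i < j)%N -> (k < l)%N ->
    u i l * u j k = u j k * u i l;
  SUq3_cross : forall i j k l : 'I_3, (i < j)%N -> (k < l)%N ->
    u i k * u j l - u j l * u i k = (q - q^-1)%:C *: (u i l * u j k);
  SUq3_det : \sum_(s : 'S_3) ((- q) ^+ perm_length s)%:C *: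
      (u (inord 0) (s (inord 0)) * u (inord 1) (s (inord 1))
        * u (inord 2) (s (inord 2))) = 1;
  SUq3_star : forall i j : 'I_3, star (u i j) = ((- q) ^ (j%:Z - i%:Z))%:C *:
      qminor u (lift i ord0) (lift i ord_max) (lift j ord0) (lift j ord_max)
}.

Definition SUq3_counit (p : 'I_3 * 'I_3) : C := (p.1 == p.2)%:R.

Fact SUq3_counitP : SUq3_rels (SUq3_counit : 'I_3 * 'I_3 -> C^o).
Proof.
have natl (a b c d : bool) : ~~ (a && b) -> ~~ (c && d) ->
    a%:R * b%:R = 0 :> C /\ c%:R * d%:R = 0 :> C.
  by case: a b c d => [] [] [] [] //= _ _; rewrite !(mul0r, mulr0, mul1r).
have dn (a b c d : 'I_3) (ab : (a < b)%N) (cd : (c < d)%N) : ~~ ((a == d) && (b == c)).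
  apply/negP => /andP[/eqP ad /eqP bc]; move: ab; rewrite ad bc ltnNge.
  by rewrite (ltnW cd).
rewrite /SUq3_counit; split => /=.
- move=> i j k ij; have ne a : ~~ ((i == a) && (j == a)).
    by apply/negP => /andP[/eqP ia /eqP ja]; move: ij; rewrite ia ja ltnn.
  have [-> _] := natl _ _ _ _ (ne k) (ne k); rewrite [X in _ *: X]mulrC.
  by have [-> _] := natl _ _ _ _ (ne k) (ne k); rewrite scaler0.
- move=> i j k ij; have ne a : ~~ ((a == i) && (a == j)).
    by apply/negP => /andP[/eqP ia /eqP ja]; move: ij; rewrite -ia -ja ltnn.
  have [-> _] := natl _ _ _ _ (ne k) (ne k); rewrite [X in _ *: X]mulrC.
  by have [-> _] := natl _ _ _ _ (ne k) (ne k); rewrite scaler0.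
- by move=> i j k l ij kl; rewrite mulrC.
- move=> i j k l ij kl; rewrite mulrC subrr.
  have [-> _] := natl _ _ _ _ (dn _ _ _ _ ij kl) (dn _ _ _ _ ij kl).
  by rewrite scaler0.
- rewrite (bigD1 1%g) //= big1 => [|s s1].
    rewrite !perm1 !eqxx !mulr1 addr0.
    have -> : perm_length 1%g = 0%N.
      apply/eqP; rewrite cards_eq0; apply/eqP/setP => p; rewrite !inE !perm1.
      by apply/negP => /andP[ab]; rewrite ltnNge (ltnW ab).
    by rewrite expr0 [_ *: _]mulr1.
  have [e0|] := eqVneq (inord 0) (s (inord 0)); last by rewrite !mul0r scaler0.
  have [e1|] := eqVneq (inord 1) (s (inord 1)); last by rewrite mulr0 mul0r scaler0.
  have [e2|] := eqVneq (inord 2) (s (inord 2)); last by rewrite mulr0 scaler0.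
  case/eqP: s1; apply/permP => i; rewrite perm1.
  have : i = inord i by rewrite inord_val.
  by case: i => [[|[|[|]]]] //= ? ->.
- move=> i j; rewrite /star /= /scalar_star conjC_nat /qminor.
  have [<-|ij] := eqVneq i j.
    have -> : (lift i ord0 == lift i ord_max) = false.
      by apply/negbTE; rewrite -val_eqE /= /bump; case: i => [[|[|[|]]]].
    by rewrite !eqxx subrr expr0z mul0r scaler0 subr0 mulr1 scale1r.
  have -> : (lift i ord0 == lift j ord0)%:R * (lift i ord_max == lift j ord_max)%:R = 0 :> C.
    rewrite -!val_eqE; move: i j ij => [[|[|[|]]] // ?] [[|[|[|]]] // ?] //= _;
      by rewrite ?mulr0 ?mul0r.
  have -> : (lift i ord0 == lift j ord_max)%:R * (lift i ord_max == lift j ord0)%:R = 0 :> C.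
    rewrite -!val_eqE; move: i j ij => [[|[|[|]]] // ?] [[|[|[|]]] // ?] //= _;
      by rewrite ?mulr0 ?mul0r.
  by rewrite scaler0 subr0 scaler0.
Qed.

Definition SUq3_pres : presentation C := Presentation SUq3_counitP.
Definition SUq3 : starAlgType C := presAlg SUq3_pres.

Fact SUq3_genP : SUq3_rels (@pgen C SUq3_pres : 'I_3 * 'I_3 -> SUq3).
Proof.
split=> [i j k ij|i j k ij|i j k l ij kl|i j k l ij kl||i j];
  apply: (@presP C SUq3_pres) => A g hg;
  have [h1 h2 h3 h4 h5 h6] := (hg : SUq3_rels g).
- by rewrite (pliftZ hg) !(pliftM hg) !(plift_gen hg) h1.
- by rewrite (pliftZ hg) !(pliftM hg) !(plift_gen hg) h2.
- by rewrite !(pliftM hg) !(plift_gen hg) h3.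
- by rewrite (pliftZ hg) (pliftD hg) (pliftN hg) !(pliftM hg) !(plift_gen hg) h4.
- rewrite (plift_sum hg) (plift1 hg) -[RHS]h5; apply: eq_bigr => s _.
  by rewrite (pliftZ hg) !(pliftM hg) !(plift_gen hg).
- rewrite (plift_star hg) (pliftZ hg) /qminor (pliftD hg) (pliftN hg) (pliftZ hg).
  by rewrite !(pliftM hg) !(plift_gen hg) h6.
Qed.

Definition u (i j : 'I_3) : SUq3 := @pgen C SUq3_pres (i, j).

Definition epsA : SUq3 -> C := @pchar_ext C SUq3_pres.

Record SUq3_coproduct : Type := {
  copA :> SUq3 -> seq (SUq3 * SUq3);
  copA_mor : tensor_morphism copA;
  copA_u : forall i j, teq (copA (u i j)) [seq (u i k, u k j) | k <- enum 'I_3]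
}.

Definition ilo (i : 'I_2) : 'I_3 := widen_ord (leqnSn 2) i.
Definition ihi (i : 'I_2) : 'I_3 := lift ord0 i.

(* The right action of U_q(su(3)); [act a h] is a <| h.  The index i of K_i, E_i,
   F_i, as an element of 'I_3, is [ilo i], and i + 1 is [ihi i]. *)
Record right_action (U : Uq_hopf q) : Type := {
  act :> SUq3 -> Uq q -> SUq3;
  act_linl : forall h, linear (act^~ h);
  act_linr : forall a, linear (act a);
  act_id : forall a, act a 1 = a;
  act_comp : forall a g h, act a (g * h) = act (act a g) h;
  act_mul : forall a b h,
    act (a * b) h = \sum_(p <- copU U h) act a p.1 * act b p.2;
  act_one : forall h, act 1 h = epsU h *: 1;
  act_star : forall a h, star (act a h) = act (star a) (star (antipode U h));
  act_K : forall i j k, act (u j k) (gK q i)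
    = (qhalf q ((ihi i == j)%:Z - (ilo i == j)%:Z))%:C *: u j k;
  act_E : forall i j k, act (u j k) (gE q i) = (ihi i == j)%:R *: u (ilo i) k;
  act_F : forall i j k, act (u j k) (gF q i) = (ilo i == j)%:R *: u (ihi i) k
}.

Record haar_state (D : SUq3_coproduct) : Type := {
  haar :> SUq3 -> C;
  haar_lin : scalar haar;
  haar1 : haar 1 = 1;
  haar_ge0 : forall a, 0 <= haar (star a * a);
  haar_faithful : forall a, haar (star a * a) = 0 -> a = 0;
  haar_left : forall a, \sum_(p <- D a) haar p.2 *: p.1 = haar a *: 1;
  haar_right : forall a, \sum_(p <- D a) haar p.1 *: p.2 = haar a *: 1
}.

(* L^2(SU_q(3)): a Hilbert space in which A(SU_q(3)), with <a,b> = h(a^* b), embeds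
   isometrically onto a dense subspace, together with the bounded operators
   extending left multiplication. *)
Record L2_space (D : SUq3_coproduct) (h : haar_state D) : Type := {
  L2 :> completeNormedModType C;
  dot : L2 -> L2 -> C;
  dot_lin : forall x, scalar (dot x);
  dot_conj : forall x y, dot y x = Num.conj (dot x y);
  dot_norm : forall x, dot x x = `|x| ^+ 2;
  emb : SUq3 -> L2;
  emb_lin : linear emb;
  emb_dot : forall a b, dot (emb a) (emb b) = h (star a * b);
  emb_dense : closure (range emb) = setT;
  lmul : SUq3 -> L2 -> L2;
  lmul_lin : forall a, linear (lmul a);
  lmul_cont : forall a, continuous (lmul a);
  lmul_emb : forall a b, lmul a (emb b) = emb (a * b)
}.

End SUq3.

Arguments copU {R q} _ _.
Arguments antipode {R q} _ _.
Arguments emb {R q D h} _ _.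
Arguments lmul {R q D h} _ _ _.
Arguments dot {R q D h} _ _ _.

Section Blocks.
Variables (R : realType) (q : R).
Local Notation C := R[i].

Record is_rep d (rho : Uq q -> 'M[C]_d) : Prop := {
  rep_lin : linear rho;
  rep1 : rho 1 = 1%:M;
  repM : forall g h, rho (g * h) = rho g *m rho h
}.

Definition irreducible_rep d (rho : Uq q -> 'M[C]_d) : Prop :=
  (0 < d)%N /\
  forall W : {vspace 'cV[C]_d},
    (forall h v, v \in W -> rho h *m v \in W) -> W = 0%VS \/ W = fullv.

Definition nth_weight (n1 n2 : nat) (i : 'I_2) : nat := if i == ord0 then n1 else n2.

(* rho is (a matrix form of) V(n1,n2): irreducible with a highest weight vector v,
   E_i v = 0 and K_i v = q^(n_i / 2) v. *)
Definition is_V (n1 n2 : nat) d (rho : Uq q -> 'M[C]_d) : Prop :=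
  [/\ is_rep rho, irreducible_rep rho &
      exists v : 'cV[C]_d, [/\ v != 0,
        forall i, rho (gE q i) *m v = 0 &
        forall i, rho (gK q i) *m v = (qhalf q (nth_weight n1 n2 i)%:Z)%:C *: v]].

Variables (U : Uq_hopf q) (act : right_action U).

(* The Hopf pairing of U_q(su(3)) and A(SU_q(3)), for which
   a <| h = <h, a_(1)> a_(2). *)
Definition pairing (h : Uq q) (a : SUq3 q) : C := epsA (act a h).

(* Matrix coefficients of V(n1,n2): the a in A(SU_q(3)) for which <-, a> is a linear
   combination of the matrix entries of rho. *)
Definition block (n1 n2 : nat) (a : SUq3 q) : Prop :=
  exists (d : nat) (rho : Uq q -> 'M[C]_d), is_V n1 n2 rho /\
    exists T : 'M[C]_d, forall h, pairing h a = \tr (T *m rho h).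

End Blocks.

Section LineBundles.
Variables (R : realType) (q : R).
Local Notation C := R[i].
Variables (U : Uq_hopf q) (act : right_action U).

Definition S5q (a : SUq3 q) : Prop :=
  forall h, subalg_KEF1 h -> act a h = epsU h *: a.

Definition line_bundle (N : int) : set (SUq3 q) :=
  [set a | S5q a /\ act a (gK q ord0 * gK q ord_max ^+ 2) = (q ^ N)%:C *: a].

Variables (D : SUq3_coproduct q) (h : haar_state D) (L : L2_space h).

Definition L2_line_bundle (N : int) : set L :=
  closure (emb L @` line_bundle N).

Definition block_proj (n1 n2 : nat) (x : L) (a : SUq3 q) : Prop :=
  block act n1 n2 a /\
  forall b, block act n1 n2 b -> dot L (emb L b) (x - emb L a) = 0.

(* The formal sum x <| k, computed block by block, represents the element y of L^2. *)
Definition L2_act (x : L) (k : Uq q) (y : L) : Prop :=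
  forall n1 n2, exists2 a, block_proj n1 n2 x a & block_proj n1 n2 y (act a k).

(* Graph of the unbounded operator Z. *)
Definition Zop (x : L) (y : L * L) : Prop :=
  L2_act x (gF q ord_max * gF q ord0) y.1 /\ L2_act x (gF q ord_max) y.2.

Definition z (j : 'I_3) : SUq3 q := u q ord_max j.

Definition zmon (j k l : nat) : SUq3 q :=
  z (inord 0) ^+ j * z (inord 1) ^+ k * z (inord 2) ^+ l.

(* (psi^N_{j,k,l})^*; the two defining formulas agree for N = 0. *)
Definition psi_star (N : int) (j k l : nat) : SUq3 q :=
  if 0 <= N then (Num.sqrt (qtrinom q j k l))%:C *: zmon j k l
  else (q ^ (- N + j%:Z - l%:Z) * Num.sqrt (qtrinom q j k l))%:C
         *: star (zmon j k l).

Definition psi (N : int) (j k l : nat) : SUq3 q := star (psi_star N j k l).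

(* Indices (j,k,l); the entries of Psi_N are those with j + k + l = |N|. *)
Definition idx (N : int) : Type := ('I_(absz N).+1 * 'I_(absz N).+1 * 'I_(absz N).+1)%type.
Definition idx_ok (N : int) (t : idx N) : bool := (t.1.1 + t.1.2 + t.2 == absz N)%N.

(* Graph of nabla_N^dbar: x is in its domain and is sent to y. *)
Definition nabla (N : int) (x : L) (y : L * L) : Prop :=
  L2_line_bundle N x /\
  exists w : idx N -> L * L,
    (forall t, idx_ok t -> Zop (lmul L (psi N t.1.1 t.1.2 t.2) x) (w t)) /\
    y = ((q ^ (- N))%:C *: \sum_(t | idx_ok t) lmul L (psi_star N t.1.1 t.1.2 t.2) (w t).1,
         (q ^ (- N))%:C *: \sum_(t | idx_ok t) lmul L (psi_star N t.1.1 t.1.2 t.2) (w t).2).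

Definition H0 (N : int) : set L := [set x | nabla N x (0, 0)].

End LineBundles.

Arguments L2_line_bundle {R q U} act {D h} L N.
Arguments nabla {R q U} act {D h} L N x y.
Arguments H0 {R q U} act {D h} L N.

(* Main.v *)
(* For the form <a, b> = h(a^* b) the right action is a star-representation up to a twist:
   the adjoint of F_i is a multiple of E_i.  Conjugation by Psi turns the connection into a
   multiple of the action of F_2, because the entries of Psi (N < 0) or of Psi^dagger (N > 0)
   are highest weight vectors.  An element xi of the kernel is thus orthogonal to everything
   of the form b <| E_1 or b <| E_2; and A(SU_q(3)) is spanned by the words
   (w_{l_1} ... w_{l_p} z_{k_1} ... z_{k_n}) <| k, w_l = (u^1_l)^*, which are translates of
   highest weight vectors of weight (p, n).  Hence xi is determined by its inner products with
   the highest weight vectors, and the torus weight of a section of degree N leaves only p = 0,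
   n = N: nothing for N < 0, and for N > 0 the span of the (N+1)(N+2)/2 monomials of degree N
   in the z_j, which are independent. *)
Require Import Defs.
From HB Require Import structures.
Set Warnings "-notation-overridden,-ambiguous-paths,-redundant-canonical-projection".
From mathcomp Require Import all_boot all_order all_algebra perm complex.
From mathcomp Require Import boolp classical_sets reals topology normedtype.
From mathcomp Require Import zify ring.

Set Implicit Arguments.
Unset Strict Implicit.
Unset Printing Implicit Defensive.

Import Order.TTheory GRing.Theory Num.Theory.
Local Open Scope classical_set_scope.
Local Open Scope ring_scope.

(** * Presented star-algebras *)

(** The action on L^2 is a formal sum over blocks, so the blocks must first be shown to exist, to be
    stable and to span A(SU_q(3)): an algebraic Peter-Weyl theorem, with no representation theory of
    U_q(su(3)) given beforehand. Two kinds of positivity replace it. Positivity and faithfulness of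
    the Haar state give orthogonality, the irreducibility of the cyclic submodules of A(SU_q(3))
    that realize the V(n_1,n_2), and the nondegeneracy of the pairing. Positivity of q turns the
    coefficients met when a word is raised into sums of positive terms, so that none vanishes: hence
    the spanning by translates, and the independence of the z-monomials, tested by x -> epsilon(x <|
    E_2^a E_1^b). The action is a right one, so a highest weight vector is killed by the F_i and
    lowered by the E_i. One argument recurs: if g is such a vector, every g <| k is a multiple of g
    plus elements b <| E_i, so a subspace containing g and all b <| E_i contains the module of g.
    Polynomial identities in the u^i_j are verified by computing normal forms with Laurent
    coefficients, for all q > 0 at once. *)

Section PresentedInduction.
Local Open Scope quotient_scope.
Variables (C : numClosedFieldType) (P : presentation C).

(** Star is applied to generators only; stability under star is proved once afterwards, so an
    induction over the algebra has no case for the star of a general element. *)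
Inductive pgenerated : presAlg P -> Prop :=
| pgenerated_gen i : pgenerated (pgen i)
| pgenerated_star i : pgenerated (star (pgen i))
| pgenerated1 : pgenerated 1
| pgenerated_lin (c : C) x y : pgenerated x -> pgenerated y -> pgenerated (c *: x + y)
| pgeneratedM x y : pgenerated x -> pgenerated y -> pgenerated (x * y).

Lemma pclass_repr (x : presAlg P) : pclass (prepr x) = x.
Proof. exact: (@reprK _ {eq_quot (seqv_equiv P)}). Qed.

Lemma pclass_add (x y : spoly P) : pclass (Add x y) = pclass x + pclass y.
Proof.
by apply: presP => A g hg; rewrite (pliftD hg) !(plift_class _ hg).
Qed.

Lemma pclass_mul (x y : spoly P) : pclass (Mul x y) = pclass x * pclass y.
Proof.
by apply: presP => A g hg; rewrite (pliftM hg) !(plift_class _ hg).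
Qed.

Lemma pclass_cst (c : C) : pclass (Cst P c) = c *: 1.
Proof.
by apply: presP => A g hg; rewrite (pliftZ hg) (plift1 hg) !(plift_class _ hg).
Qed.

Lemma pclass_star (x : spoly P) : pclass (Star x) = star (pclass x).
Proof.
by apply: presP => A g hg; rewrite (plift_star hg) !(plift_class _ hg).
Qed.

Lemma pgenerated0 : pgenerated 0.
Proof.
rewrite -(addNr 1) -scaleN1r.
exact: pgenerated_lin pgenerated1 pgenerated1.
Qed.

Lemma pgeneratedZ c x : pgenerated x -> pgenerated (c *: x).
Proof. by move=> hx; rewrite -[_ *: _]addr0; apply: pgenerated_lin hx pgenerated0. Qed.

Lemma pgenerated_starP x : pgenerated x -> pgenerated (star x).
Proof.
elim=> [i|i||c {}x y _ hx _ hy|{}x y _ hx _ hy].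
- exact: pgenerated_star.
- by rewrite starK; apply: pgenerated_gen.
- by rewrite star1; apply: pgenerated1.
- by rewrite starD starZ; apply: pgenerated_lin.
- by rewrite starM; apply: pgeneratedM.
Qed.

Lemma pgeneratedP x : pgenerated x.
Proof.
rewrite -(pclass_repr x); elim: (prepr x) => {x} [i|c|x hx y hy|x hx y hy|x hx].
- exact: pgenerated_gen.
- by rewrite pclass_cst; apply/pgeneratedZ/pgenerated1.
- by rewrite pclass_add -[pclass x]scale1r; apply: pgenerated_lin.
- by rewrite pclass_mul; apply: pgeneratedM.
- by rewrite pclass_star; apply: pgenerated_starP.
Qed.

End PresentedInduction.

(** Unpacks unbundled linearity, the form in which the Hopf, action and Hilbert space records
    provide it. *)
Lemma linear_of_morph (K : pzRingType) (V W : lmodType K) (f : V -> W) :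
  linear f ->
  [/\ f 0 = 0, {morph f : x y / x + y}, forall c x, f (c *: x) = c *: f x,
      forall x, f (- x) = - f x & forall I (r : seq I) (p : pred I) F,
      f (\sum_(i <- r | p i) F i) = \sum_(i <- r | p i) f (F i)].
Proof.
move=> hf.
have f0 : f 0 = 0.
  by have := hf (-1) 0 0; rewrite scaler0 addr0 scaleN1r addNr.
have fD : {morph f : x y / x + y}.
  by move=> x y; rewrite -[x]scale1r hf !scale1r.
have fZ c x : f (c *: x) = c *: f x by rewrite -[_ *: x]addr0 hf f0 addr0.
split=> // [x|I r p F]; first by rewrite -scaleN1r fZ scaleN1r.
exact: big_morph.
Qed.

Section Basics.
Variables (R : realType) (q : R).
Hypotheses (hq0 : 0 < q).
Local Notation C := R[i].
Local Notation A := (SUq3 q).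
Local Notation UU := (Uq q).

Lemma star_gK i : star (gK q i) = gK q i.
Proof. by have [_ _ h _ _ _ _ _ _ _] := Uq_genP q; apply: h. Qed.

Lemma star_gE i : star (gE q i) = gF q i.
Proof. by have [_ _ _ h _ _ _ _ _ _] := Uq_genP q; apply: h. Qed.

Lemma star_gF i : star (gF q i) = gE q i.
Proof. by rewrite -star_gE starK. Qed.

Lemma gK_gKV i : gK q i * gKV q i = 1.
Proof. by have [h _ _ _ _ _ _ _ _ _] := Uq_genP q; apply: h. Qed.

Lemma gKV_gK i : gKV q i * gK q i = 1.
Proof. by have [_ h _ _ _ _ _ _ _ _] := Uq_genP q; apply: h. Qed.

Lemma star_gKV i : star (gKV q i) = gKV q i.
Proof.
by rewrite -[LHS]mulr1 -(gK_gKV i) mulrA -{1}(star_gK i) -starM gK_gKV star1 mul1r.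
Qed.

Lemma Uq_ind (P : UU -> Prop) :
  (forall i, P (gK q i)) -> (forall i, P (gKV q i)) ->
  (forall i, P (gE q i)) -> (forall i, P (gF q i)) -> P 1 ->
  (forall (c : C) x y, P x -> P y -> P (c *: x + y)) ->
  (forall x y, P x -> P y -> P (x * y)) -> forall x, P x.
Proof.
move=> hK hKV hE hF h1 hl hm x.
elim: (pgeneratedP x) => // {x}.
- by case.
- case=> i.
  + by change (P (star (gK q i))); rewrite star_gK.
  + by change (P (star (gKV q i))); rewrite star_gKV.
  + by change (P (star (gE q i))); rewrite star_gE.
  + by change (P (star (gF q i))); rewrite star_gF.
- by move=> c x y _ hx _ hy; apply: hl.
- by move=> x y _ hx _ hy; apply: hm.
Qed.

Lemma SUq3_ind (P : A -> Prop) :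
  (forall i j, P (u q i j)) -> P 1 ->
  (forall (c : C) x y, P x -> P y -> P (c *: x + y)) ->
  (forall x y, P x -> P y -> P (x * y)) -> forall x, P x.
Proof.
move=> hu h1 hl hm x.
have P0 : P 0 by rewrite -(addNr 1) -scaleN1r; apply: hl.
have PZ c y : P y -> P (c *: y) by move=> hy; rewrite -[_ *: _]addr0; apply: hl.
have [_ _ _ _ _ hs] := SUq3_genP q.
elim: (pgeneratedP x) => // {x}.
- by case=> i j; apply: hu.
- case=> i j; rewrite hs; apply: PZ; rewrite /qminor addrC -scaleNr.
  by apply: hl; apply: hm; apply: hu.
- by move=> c x y _ hx _ hy; apply: hl.
- by move=> x y _ hx _ hy; apply: hm.
Qed.

End Basics.

(** * The right action and the Haar state *)

Section RightAction.
Local Open Scope complex_scope.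
Variables (R : realType) (q : R).
Hypotheses (hq0 : 0 < q).
Local Notation C := R[i].
Local Notation A := (SUq3 q).
Local Notation UU := (Uq q).
Variables (U : Uq_hopf q) (act : right_action U).
Local Notation "a <<| k" := (act a k) (at level 39, left associativity).

(** Weights are counted in halves: this is q^(n/2), the shape of all eigenvalues of the K_i met
    below. *)
Definition qw (n : int) : C := (qhalf q n)%:C.

Lemma sqrt_q_neq0 : Num.sqrt q != 0.
Proof. by rewrite sqrtr_eq0 -ltNge. Qed.

Lemma qhalf_gt0 n : 0 < qhalf q n.
Proof. by rewrite /qhalf exprz_gt0 // sqrtr_gt0. Qed.

Lemma qw0 : qw 0 = 1. Proof. by rewrite /qw /qhalf expr0z. Qed.

Lemma qwD m n : qw (m + n) = qw m * qw n.
Proof. by rewrite /qw /qhalf expfzDr ?sqrt_q_neq0 // rmorphM. Qed.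

Lemma qw_neq0 n : qw n != 0.
Proof. by rewrite /qw fmorph_eq0 gt_eqF // qhalf_gt0. Qed.

Lemma qwN n : qw (- n) = (qw n)^-1.
Proof.
apply: (mulfI (qw_neq0 n)); rewrite -qwD subrr qw0 divff //; exact: qw_neq0.
Qed.

Lemma qw2 : qw 2 = q%:C.
Proof. by rewrite /qw /qhalf -exprnP sqr_sqrtr // ltW. Qed.

Lemma conj_real (x : R) : Num.conj (x%:C : C) = x%:C.
Proof. exact: conjc_real. Qed.

Lemma qC_neq0 : (q%:C : C) != 0.
Proof. by rewrite fmorph_eq0 gt_eqF. Qed.

Lemma actDl a b k : (a + b) <<| k = a <<| k + b <<| k.
Proof. by have [_ h _ _ _] := linear_of_morph (act_linl act k); rewrite h. Qed.
Lemma actZl c a k : (c *: a) <<| k = c *: (a <<| k).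
Proof. by have [_ _ h _ _] := linear_of_morph (act_linl act k); rewrite h. Qed.
Lemma actNl a k : (- a) <<| k = - (a <<| k).
Proof. by have [_ _ _ h _] := linear_of_morph (act_linl act k); rewrite h. Qed.
Lemma act0l k : 0 <<| k = 0.
Proof. by have [h _ _ _ _] := linear_of_morph (act_linl act k); rewrite h. Qed.
Lemma act_suml k I (r : seq I) (p : pred I) F :
  (\sum_(i <- r | p i) F i) <<| k = \sum_(i <- r | p i) F i <<| k.
Proof. by have [_ _ _ _ h] := linear_of_morph (act_linl act k); rewrite h. Qed.
Lemma actDr a k l : a <<| (k + l) = a <<| k + a <<| l.
Proof. by have [_ h _ _ _] := linear_of_morph (act_linr act a); rewrite h. Qed.
Lemma actZr c a k : a <<| (c *: k) = c *: (a <<| k).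
Proof. by have [_ _ h _ _] := linear_of_morph (act_linr act a); rewrite h. Qed.
Lemma actNr a k : a <<| (- k) = - (a <<| k).
Proof. by have [_ _ _ h _] := linear_of_morph (act_linr act a); rewrite h. Qed.
Lemma act0r a : a <<| 0 = 0.
Proof. by have [h _ _ _ _] := linear_of_morph (act_linr act a); rewrite h. Qed.

(** Sweedler representatives agree only up to [teq], that is after a bilinear map; this is the map
    through which the coproduct of a generator enters [act_mul]. *)
Lemma bilin_act_mul a b : bilin (fun k l => (a <<| k) * (b <<| l)).
Proof.
split=> [k c x y|k c x y] /=.
  by rewrite actDr actZr mulrDr scalerAr.
by rewrite actDr actZr mulrDl scalerAl.
Qed.

Lemma act_mulK a b i : (a * b) <<| gK q i = (a <<| gK q i) * (b <<| gK q i).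
Proof.
rewrite act_mul (copU_K U i (bilin_act_mul a b)).
by rewrite big_cons big_nil addr0.
Qed.

Lemma act_mulE a b i : (a * b) <<| gE q i =
  (a <<| gE q i) * (b <<| gK q i) + (a <<| gKV q i) * (b <<| gE q i).
Proof.
rewrite act_mul (copU_E U i (bilin_act_mul a b)).
by rewrite !big_cons big_nil addr0.
Qed.

Lemma act_mulF a b i : (a * b) <<| gF q i =
  (a <<| gF q i) * (b <<| gK q i) + (a <<| gKV q i) * (b <<| gF q i).
Proof.
rewrite act_mul (copU_F U i (bilin_act_mul a b)).
by rewrite !big_cons big_nil addr0.
Qed.

Lemma act_KVK a i : a <<| gKV q i <<| gK q i = a.
Proof. by rewrite -act_comp gKV_gK act_id. Qed.

Lemma act_KKV a i : a <<| gK q i <<| gKV q i = a.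
Proof. by rewrite -act_comp gK_gKV act_id. Qed.

Lemma act_mulKV a b i : (a * b) <<| gKV q i = (a <<| gKV q i) * (b <<| gKV q i).
Proof. by rewrite -[RHS](act_KKV _ i) act_mulK !act_KVK. Qed.

Lemma epsU_lin : scalar (@epsU R q : UU -> C).
Proof.
move=> c x y; rewrite /epsU /pchar_ext.
by rewrite (pliftD (pcharP (Uq_pres q))) (pliftZ (pcharP (Uq_pres q))).
Qed.

Lemma epsUM (x y : UU) : epsU (x * y) = epsU x * epsU y.
Proof. by rewrite /epsU /pchar_ext (pliftM (pcharP (Uq_pres q))). Qed.

Lemma epsU1 : epsU (1 : UU) = 1.
Proof. by rewrite /epsU /pchar_ext (plift1 (pcharP (Uq_pres q))). Qed.

Lemma epsUK i : epsU (gK q i) = 1.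
Proof. exact: (plift_gen (pcharP (Uq_pres q))). Qed.
Lemma epsUKV i : epsU (gKV q i) = 1.
Proof. exact: (plift_gen (pcharP (Uq_pres q))). Qed.
Lemma epsUE i : epsU (gE q i) = 0.
Proof. exact: (plift_gen (pcharP (Uq_pres q))). Qed.
Lemma epsUF i : epsU (gF q i) = 0.
Proof. exact: (plift_gen (pcharP (Uq_pres q))). Qed.

Lemma epsA_lin : scalar (@epsA R q : A -> C).
Proof.
move=> c x y; rewrite /epsA /pchar_ext.
by rewrite (pliftD (pcharP (SUq3_pres q))) (pliftZ (pcharP (SUq3_pres q))).
Qed.

Lemma epsA_M (x y : A) : epsA (x * y) = epsA x * epsA y.
Proof. by rewrite /epsA /pchar_ext (pliftM (pcharP (SUq3_pres q))). Qed.

Lemma epsA1 : epsA (1 : A) = 1.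
Proof. by rewrite /epsA /pchar_ext (plift1 (pcharP (SUq3_pres q))). Qed.

Lemma epsA_u i j : epsA (u q i j) = (i == j)%:R.
Proof. exact: (plift_gen (pcharP (SUq3_pres q))). Qed.

Lemma epsA_star x : epsA (star x : A) = Num.conj (epsA x).
Proof. exact: (plift_star (pcharP (SUq3_pres q))). Qed.

Lemma epsAZ c (x : A) : epsA (c *: x) = c * epsA x.
Proof. by have [_ _ h _ _] := linear_of_morph epsA_lin; rewrite h. Qed.
Lemma epsA0 : epsA (0 : A) = 0.
Proof. by have [h _ _ _ _] := linear_of_morph epsA_lin; rewrite h. Qed.

Lemma act1 k : 1 <<| k = epsU k *: 1.
Proof. exact: act_one. Qed.

Lemma antipode_KV i : antipode U (gKV q i) = gK q i.
Proof.
have h : antipode U (gKV q i) * gKV q i = 1.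
  by rewrite -[X in _ * X](antipode_K U) -antipodeM gK_gKV antipode1.
by rewrite -[LHS]mulr1 -(gKV_gK q i) mulrA h mul1r.
Qed.

Lemma act_star_K a i : star a <<| gK q i = star (a <<| gKV q i).
Proof. by rewrite act_star antipode_KV star_gK. Qed.

Lemma act_star_KV a i : star a <<| gKV q i = star (a <<| gK q i).
Proof. by rewrite act_star antipode_K star_gKV. Qed.

Lemma act_star_E a i : star a <<| gE q i = (- q%:C) *: star (a <<| gF q i).
Proof.
rewrite act_star antipode_F starZ star_gF rmorphN /= conj_real actZr scalerA.
by rewrite mulrNN -rmorphM divff ?gt_eqF // scale1r.
Qed.

Lemma act_star_F a i : star a <<| gF q i = (- (q^-1)%:C) *: star (a <<| gE q i).
Proof.
rewrite act_star antipode_E starZ star_gE rmorphN /= conj_real actZr scalerA.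
by rewrite mulrNN -rmorphM mulVf ?gt_eqF // scale1r.
Qed.

End RightAction.

Section Haar.
Local Open Scope complex_scope.
Variables (R : realType) (q : R).
Hypotheses (hq0 : 0 < q).
Local Notation C := R[i].
Local Notation A := (SUq3 q).
Local Notation UU := (Uq q).
Variables (U : Uq_hopf q) (act : right_action U).
Local Notation "a <<| k" := (act a k) (at level 39, left associativity).
Variables (D : SUq3_coproduct q) (h : haar_state D).

Lemma pairing_lin k : scalar (pairing act k).
Proof. by move=> c x y; rewrite /pairing actDl actZl epsA_lin. Qed.

Lemma pairingM k a b :
  pairing act k (a * b) = \sum_(p <- copU U k) pairing act p.1 a * pairing act p.2 b.
Proof.
have [_ _ _ _ hs] := linear_of_morph (@epsA_lin R q).
by rewrite /pairing act_mul hs; apply: eq_bigr => p _; rewrite epsA_M.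
Qed.

Lemma pairing1 k : pairing act k 1 = epsU k.
Proof. by rewrite /pairing act1 epsAZ epsA1 mulr1. Qed.

(** The action touches the upper index only, so one matrix, that of [k] in the three-dimensional
    representation, serves all columns. *)
Lemma act_u_matrix k : exists rho : 'I_3 -> 'I_3 -> C,
  forall i j, u q i j <<| k = \sum_l rho i l *: u q l j.
Proof.
elim/Uq_ind: k => [i|i|i|i||c x y [r1 h1] [r2 h2]|x y [r1 h1] [r2 h2]].
- exists (fun j l => if j == l then (qhalf q ((ihi i == j)%:Z - (ilo i == j)%:Z))%:C else 0).
  move=> j k; rewrite act_K (bigD1 j) //= eqxx big1 ?addr0 // => l.
  by rewrite eq_sym => /negbTE ->; rewrite scale0r.
- exists (fun j l => if j == l then (qhalf q ((ihi i == j)%:Z - (ilo i == j)%:Z))%:C^-1 else 0).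
  move=> j k; rewrite (bigD1 j) //= eqxx big1 ?addr0 => [|l]; last first.
    by rewrite eq_sym => /negbTE ->; rewrite scale0r.
  rewrite -[RHS](act_KKV act _ i) actZl act_K !actZl scalerA mulVf ?scale1r //.
  exact: (qw_neq0 hq0).
- exists (fun j l => if l == ilo i then (ihi i == j)%:R else 0).
  move=> j k; rewrite act_E (bigD1 (ilo i)) //= eqxx big1 ?addr0 => [|l].
    by rewrite scaler_nat -mulr_natl.
  by move/negbTE => ->; rewrite scale0r.
- exists (fun j l => if l == ihi i then (ilo i == j)%:R else 0).
  move=> j k; rewrite act_F (bigD1 (ihi i)) //= eqxx big1 ?addr0 => [|l].
    by rewrite scaler_nat -mulr_natl.
  by move/negbTE => ->; rewrite scale0r.
- exists (fun j l => (j == l)%:R) => j k.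
  rewrite act_id (bigD1 j) //= eqxx scale1r big1 ?addr0 // => l.
  by rewrite eq_sym => /negbTE ->; rewrite scale0r.
- exists (fun j l => c * r1 j l + r2 j l) => j k.
  rewrite actDr actZr h1 h2 scaler_sumr -big_split /=; apply: eq_bigr => l _.
  by rewrite scalerA scalerDl.
- exists (fun j l => \sum_m r1 j m * r2 m l) => j k.
  rewrite act_comp h1 act_suml.
  under eq_bigr => l _ do rewrite actZl h2 scaler_sumr.
  rewrite exchange_big /=; apply: eq_bigr => l _.
  by rewrite scaler_suml; apply: eq_bigr => m _; rewrite scalerA.
Qed.

(** The action is prescribed on generators. Both sides are compatible with products in [a], so the
    formula propagates from the [u i j]; it is the link between the action and the invariance of the
    Haar state. *)
Lemma act_coproduct a k : a <<| k = \sum_(p <- D a) pairing act k p.1 *: p.2.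
Proof.
have bil (k' : UU) : bilin (fun x y : A => pairing act k' x *: y).
  split=> [x c y z|y c x z] /=; first by rewrite scalerDr !scalerA mulrC.
  by rewrite pairing_lin scalerDl -scalerA.
have [Dl D1 DM] := copA_mor D.
elim/SUq3_ind: a k => [i j|| c x y hx hy|x y hx hy] k.
- rewrite (copA_u D i j (bil k)) big_map big_enum /=.
  have [rho hr] := act_u_matrix k.
  rewrite hr; apply: eq_bigr => l _; congr (_ *: _).
  have [_ _ _ _ hs] := linear_of_morph (@epsA_lin R q).
  rewrite /pairing hr hs (bigD1 l) //= epsAZ epsA_u eqxx mulr1 big1 ?addr0 // => m.
  by move=> /negbTE ml; rewrite epsAZ epsA_u ml mulr0.
- by rewrite (D1 _ _ (bil k)) big_cons big_nil addr0 /= pairing1 act1.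
- rewrite actDl actZl hx hy (Dl c x y _ _ (bil k)) big_cat big_map /=; congr (_ + _).
  rewrite scaler_sumr; apply: eq_bigr => p _.
  have [_ _ hZ _ _] := linear_of_morph (@pairing_lin k).
  by rewrite hZ scalerA.
- rewrite (DM x y _ _ (bil k)) big_allpairs_dep /= act_mul.
  rewrite (eq_bigr (fun p => (\sum_(s <- D x) pairing act p.1 s.1 *: s.2)
    * (\sum_(t <- D y) pairing act p.2 t.1 *: t.2))) => [|p _]; last by rewrite -hx -hy.
  under eq_bigr => p _ do rewrite big_distrlr /=.
  rewrite exchange_big; apply: eq_bigr => s _.
  rewrite exchange_big; apply: eq_bigr => t _.
  rewrite pairingM scaler_suml; apply: eq_bigr => p _.
  by rewrite -scalerAl -scalerAr scalerA.
Qed.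

Lemma haar_act a k : h (a <<| k) = epsU k * h a.
Proof.
have [_ _ _ _ hs] := linear_of_morph (haar_lin h).
have [_ _ hZ _ _] := linear_of_morph (haar_lin h).
have [_ _ pZ _ ps] := linear_of_morph (pairing_lin k).
rewrite act_coproduct hs.
transitivity (pairing act k (\sum_(p <- D a) h p.2 *: p.1)).
  by rewrite ps; apply: eq_bigr => p _; rewrite hZ pZ; apply: mulrC.
by rewrite haar_left pZ pairing1; apply: mulrC.
Qed.

Definition hform (a b : A) : C := h (star a * b).

Lemma hform_lin a : scalar (hform a).
Proof. by move=> c x y; rewrite /hform mulrDr -scalerAr haar_lin. Qed.

Lemma hformDr a b c : hform a (b + c) = hform a b + hform a c.
Proof. by have [_ e _ _ _] := linear_of_morph (hform_lin a); rewrite e. Qed.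
Lemma hformZr a x c : hform a (x *: c) = x * hform a c.
Proof. by have [_ _ e _ _] := linear_of_morph (hform_lin a); rewrite e. Qed.
Lemma hform0r a : hform a 0 = 0.
Proof. by have [e _ _ _ _] := linear_of_morph (hform_lin a); rewrite e. Qed.
Lemma hformDl a b c : hform (a + b) c = hform a c + hform b c.
Proof.
have [_ e _ _ _] := linear_of_morph (haar_lin h).
by rewrite /hform starD mulrDl e.
Qed.
Lemma hformZl x a b : hform (x *: a) b = Num.conj x * hform a b.
Proof.
have [_ _ e _ _] := linear_of_morph (haar_lin h).
by rewrite /hform starZ -scalerAl e.
Qed.
Lemma hform0l a : hform 0 a = 0.
Proof. by rewrite -(scale0r 0) hformZl rmorph0 mul0r. Qed.

Lemma hform_eq0 a : hform a a = 0 -> a = 0.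
Proof. exact: haar_faithful. Qed.

Definition adjoint (k k' : UU) : Prop := forall a b, hform (a <<| k) b = hform a (b <<| k').

Lemma adjointK i : adjoint (gK q i) (gK q i).
Proof.
move=> a b; rewrite /hform -act_star_KV // -{1}[b](act_KKV act _ i) -act_mulKV.
by rewrite haar_act epsUKV mul1r.
Qed.

Lemma adjointKV i : adjoint (gKV q i) (gKV q i).
Proof.
by move=> a b; rewrite -{1}[b](act_KVK act _ i) -adjointK act_KVK.
Qed.

Lemma gK_gE_same i : gK q i * gE q i = q%:C *: (gE q i * gK q i).
Proof. by have [_ _ _ _ _ e _ _ _ _] := Uq_genP q; apply: e. Qed.

Lemma gF_gK_same i : gF q i * gK q i = q%:C *: (gK q i * gF q i).
Proof.
by rewrite -[LHS]starK starM star_gF star_gK gK_gE_same starZ starM star_gE star_gK conj_real.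
Qed.

Lemma act_FK_same x i : x <<| gF q i <<| gK q i = q%:C *: (x <<| gK q i <<| gF q i).
Proof. by rewrite -!act_comp gF_gK_same actZr. Qed.

Lemma act_KE_same x i : x <<| gK q i <<| gE q i = q%:C *: (x <<| gE q i <<| gK q i).
Proof. by rewrite -!act_comp gK_gE_same actZr. Qed.

Lemma haarZ (c : C) x : h (c *: x) = c * h x.
Proof. by have [_ _ e _ _] := linear_of_morph (haar_lin h); rewrite e. Qed.
Lemma haarD x y : h (x + y) = h x + h y.
Proof. by have [_ e _ _ _] := linear_of_morph (haar_lin h); rewrite e. Qed.

(** Integration by parts. Invariance is applied to [x * (y <<| gKV q i)]: the twist cancels the
    factor K in the first term of the coproduct of F_i. *)
Lemma haar_actF_mul x y i : h (x <<| gF q i * y) = - q%:C * h (x * (y <<| gF q i)).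
Proof.
have : h ((x * (y <<| gKV q i)) <<| gF q i) = 0.
  by rewrite haar_act epsUF mul0r.
rewrite act_mulF haarD act_KVK => /eqP; rewrite addr_eq0 => /eqP ->.
have -> : y <<| gKV q i <<| gF q i = q%:C *: (y <<| gF q i <<| gKV q i).
  by rewrite -{2}(act_KVK act y i) -actZl -act_FK_same act_KKV.
by rewrite -scalerAr haarZ -act_mulKV haar_act epsUKV mul1r mulNr.
Qed.

Lemma haar_actE_mul x y i : h (x <<| gE q i * y) = - (q^-1)%:C * h (x * (y <<| gE q i)).
Proof.
have : h ((x * (y <<| gKV q i)) <<| gE q i) = 0.
  by rewrite haar_act epsUE mul0r.
rewrite act_mulE haarD act_KVK => /eqP; rewrite addr_eq0 => /eqP ->.
have -> : y <<| gKV q i <<| gE q i = (q^-1)%:C *: (y <<| gE q i <<| gKV q i).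
  rewrite -{2}(act_KVK act y i) -actZl act_KE_same scalerA -rmorphM mulVf ?gt_eqF //.
  by rewrite scale1r act_KKV.
by rewrite -scalerAr haarZ -act_mulKV haar_act epsUKV mul1r mulNr.
Qed.

Lemma adjointE i : adjoint (gE q i) ((q ^+ 2)%:C *: gF q i).
Proof.
move=> a b; rewrite actZr hformZr /hform.
have := haar_actF_mul (star a) b i.
rewrite act_star_F // -scalerAl haarZ => key.
have e : - (q%:C) * (- (q^-1)%:C) = 1 :> C.
  by rewrite mulrNN -rmorphM divff ?gt_eqF.
by rewrite -[LHS]mul1r -e -mulrA key !mulrA mulrNN -rmorphM expr2.
Qed.

Lemma adjointF i : adjoint (gF q i) ((q ^- 2)%:C *: gE q i).
Proof.
move=> a b; rewrite actZr hformZr /hform.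
have := haar_actE_mul (star a) b i.
rewrite act_star_E // -scalerAl haarZ => key.
have e : - ((q^-1)%:C) * (- q%:C) = 1 :> C.
  by rewrite mulrNN -rmorphM mulVf ?gt_eqF.
by rewrite -[LHS]mul1r -e -mulrA key !mulrA mulrNN -rmorphM -exprVn expr2.
Qed.

Lemma adjoint_exists k : exists k', adjoint k k'.
Proof.
elim/Uq_ind: k => [i|i|i|i||c x y [x' hx] [y' hy]|x y [x' hx] [y' hy]].
- by exists (gK q i); apply: adjointK.
- by exists (gKV q i); apply: adjointKV.
- by exists ((q ^+ 2)%:C *: gF q i); apply: adjointE.
- by exists ((q ^- 2)%:C *: gE q i); apply: adjointF.
- by exists 1 => a b; rewrite !act_id.
- exists (Num.conj c *: x' + y') => a b.
  by rewrite !actDr !actZr hformDl hformZl hformDr hformZr hx hy.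
- by exists (y' * x') => a b; rewrite !act_comp hy hx.
Qed.

(** Adjoints in the opposite direction, needed in [L2_act_emb] to move the action off a block
    projection. *)
Lemma adjoint_exists' k' : exists k, adjoint k k'.
Proof.
elim/Uq_ind: k' => [i|i|i|i||c x y [x' hx] [y' hy]|x y [x' hx] [y' hy]].
- by exists (gK q i); apply: adjointK.
- by exists (gKV q i); apply: adjointKV.
- exists ((q ^+ 2)%:C *: gF q i) => a b; rewrite actZr hformZl adjointF actZr hformZr.
  by rewrite conj_real mulrA -rmorphM divff ?mul1r // expf_eq0 gt_eqF.
- exists ((q ^- 2)%:C *: gE q i) => a b; rewrite actZr hformZl adjointE actZr hformZr.
  by rewrite conj_real mulrA -rmorphM mulVf ?mul1r // expf_eq0 gt_eqF.
- by exists 1 => a b; rewrite !act_id.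
- exists (Num.conj c *: x' + y') => a b.
  by rewrite !actDr !actZr hformDl hformZl hformDr hformZr hx hy conjCK.
- by exists (y' * x') => a b; rewrite !act_comp hx hy.
Qed.

End Haar.

(** * Normal forms in quantum matrices *)

(* The triple (c, e, w) stands for c q^e times the word w, whose letter 3i + j is u i j;
   normal words are the weakly increasing ones. *)
Definition qmono := (int * int * seq nat)%type.
Definition ncpoly := seq qmono.

(** Rewriting rule for two letters in decreasing order. The middle case is the cross relation solved
    for the wrong order, its coefficient q^-1 - q being stored as two terms. *)
Definition qswap (a b : nat) : ncpoly :=
  let i := (a %/ 3)%N in let j := (a %% 3)%N in
  let k := (b %/ 3)%N in let l := (b %% 3)%N in
  if (i == k) || (j == l) then [:: (1, -1, [:: b; a])]
  else if (l < j)%N then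
    [:: (1, 0, [:: b; a]); (-1, 1, [:: (3 * k + j)%N; (3 * i + l)%N]);
        (1, -1, [:: (3 * k + j)%N; (3 * i + l)%N])]
  else [:: (1, 0, [:: b; a])].

Fixpoint qstep (w : seq nat) : ncpoly :=
  match w with
  | a :: ((b :: t) as s) =>
    if (b < a)%N then [seq (m.1, m.2 ++ t) | m <- qswap a b]
    else [seq (m.1, a :: m.2) | m <- qstep s]
  | _ => [:: (1, 0, w)]
  end.

Definition qscale (c e : int) (p : ncpoly) : ncpoly :=
  [seq (c * m.1.1, e + m.1.2, m.2) | m <- p].

Definition qmul (p r : ncpoly) : ncpoly :=
  flatten [seq [seq (m.1.1 * n.1.1, m.1.2 + n.1.2, m.2 ++ n.2) | n <- r] | m <- p].

Fixpoint qinsert (m : qmono) (p : ncpoly) : ncpoly :=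
  match p with
  | [::] => [:: m]
  | n :: s => if (n.1.2 == m.1.2) && (n.2 == m.2)
              then (n.1.1 + m.1.1, n.1.2, n.2) :: s else n :: qinsert m s
  end.

Definition qcollect (p : ncpoly) : ncpoly :=
  [seq m <- foldr qinsert [::] p | m.1.1 != 0].

(** Rewriting with [n] rounds of fuel. Termination and confluence are never claimed: an identity
    counts as proved when the result happens to be the empty list. *)
Fixpoint qnorm (n : nat) (p : ncpoly) : ncpoly :=
  match n with
  | 0 => qcollect p
  | n'.+1 => qnorm n' (qcollect (flatten [seq qscale m.1.1 m.1.2 (qstep m.2) | m <- p]))
  end.

Definition qletter (i j : nat) : ncpoly := [:: (1, 0, [:: (3 * i + j)%N])].
Definition qlo (i : nat) : nat := if i == 0%N then 1%N else 0%N.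
Definition qhi (i : nat) : nat := if i == 2%N then 1%N else 2%N.
Definition qminorp (k1 k2 l1 l2 : nat) : ncpoly :=
  qmul (qletter k1 l1) (qletter k2 l2)
    ++ qscale (-1) 1 (qmul (qletter k1 l2) (qletter k2 l1)).
Definition qstar (i j : nat) : ncpoly :=
  qscale (if odd (i + j) then -1 else 1) (j%:Z - i%:Z)
    (qminorp (qlo i) (qhi i) (qlo j) (qhi j)).
Definition qdet : ncpoly :=
  let m i j k := qmul (qmul (qletter 0 i) (qletter 1 j)) (qletter 2 k) in
  m 0%N 1%N 2%N ++ qscale (-1) 1 (m 0%N 2%N 1%N) ++ qscale (-1) 1 (m 1%N 0%N 2%N)
    ++ qscale 1 2 (m 1%N 2%N 0%N) ++ qscale 1 2 (m 2%N 0%N 1%N)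
    ++ qscale (-1) 3 (m 2%N 1%N 0%N).

Section QuantumMatrices.
Local Open Scope complex_scope.
Variables (R : realType) (q : R).
Hypotheses (hq0 : 0 < q).
Local Notation C := R[i].
Local Notation A := (SUq3 q).

Lemma u_col (i j k : 'I_3) : (i < j)%N -> u q i k * u q j k = q%:C *: (u q j k * u q i k).
Proof. by have [e _ _ _ _ _] := SUq3_genP q; apply: e. Qed.
Lemma u_row (i j k : 'I_3) : (i < j)%N -> u q k i * u q k j = q%:C *: (u q k j * u q k i).
Proof. by have [_ e _ _ _ _] := SUq3_genP q; apply: e. Qed.
Lemma u_comm (i j k l : 'I_3) : (i < j)%N -> (k < l)%N ->
  u q i l * u q j k = u q j k * u q i l.
Proof. by have [_ _ e _ _ _] := SUq3_genP q; apply: e. Qed.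
Lemma u_cross (i j k l : 'I_3) : (i < j)%N -> (k < l)%N ->
  u q i k * u q j l - u q j l * u q i k = (q - q^-1)%:C *: (u q i l * u q j k).
Proof. by have [_ _ _ e _ _] := SUq3_genP q; apply: e. Qed.
Lemma u_star (i j : 'I_3) : star (u q i j) = ((- q) ^ (j%:Z - i%:Z))%:C *:
  qminor q (u q) (lift i ord0) (lift i ord_max) (lift j ord0) (lift j ord_max).
Proof. by have [_ _ _ _ _ e] := SUq3_genP q; apply: e. Qed.

Definition qval_letter (n : nat) : A := u q (inord (n %/ 3)) (inord (n %% 3)).
Definition qval_word (w : seq nat) : A := \prod_(n <- w) qval_letter n.
Definition qval_coef (c e : int) : C := c%:~R * q%:C ^ e.
Definition qval (p : ncpoly) : A := \sum_(m <- p) qval_coef m.1.1 m.1.2 *: qval_word m.2.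

Let qC0 : (q%:C : C) != 0 := qC_neq0 hq0.

Lemma qval_coefM c d e f :
  qval_coef (c * d) (e + f) = qval_coef c e * qval_coef d f.
Proof. by rewrite /qval_coef rmorphM expfzDr // mulrACA. Qed.

Lemma qval_nil : qval [::] = 0. Proof. exact: big_nil. Qed.
Lemma qval_cons m p : qval (m :: p) = qval_coef m.1.1 m.1.2 *: qval_word m.2 + qval p.
Proof. exact: big_cons. Qed.
Lemma qval_cat p r : qval (p ++ r) = qval p + qval r.
Proof. exact: big_cat. Qed.
Lemma qval_wordM v w : qval_word (v ++ w) = qval_word v * qval_word w.
Proof. exact: big_cat. Qed.

Lemma qval_scale c e p : qval (qscale c e p) = qval_coef c e *: qval p.
Proof.
rewrite /qval big_map scaler_sumr; apply: eq_bigr => m _ /=.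
by rewrite qval_coefM scalerA.
Qed.

Lemma qval_mul p r : qval (qmul p r) = qval p * qval r.
Proof.
elim: p => [|m p ih]; first by rewrite /qmul /= !qval_nil mul0r.
rewrite /qmul /= qval_cat -/(qmul p r) ih qval_cons mulrDl; congr (_ + _).
rewrite /qval big_map mulr_sumr; apply: eq_bigr => n _ /=.
rewrite qval_coefM qval_wordM -[RHS]scalerAr -[_ *: qval_word m.2 * _]scalerAl.
by rewrite [RHS]scalerA [in RHS]mulrC.
Qed.

Lemma qval_insert m p : qval (qinsert m p) = qval [:: m] + qval p.
Proof.
elim: p => [|n p ih] //=; first by rewrite qval_nil addr0.
case: ifP => [/andP[/eqP e1 /eqP e2]|_]; rewrite !qval_cons /=.
  rewrite qval_nil addr0 addrA -e1 -e2 -scalerDl /qval_coef rmorphD mulrDl.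
  by rewrite [X in X *: _ + _]addrC.
by rewrite ih qval_cons qval_nil !addr0 addrCA.
Qed.

Lemma qval_collect p : qval (qcollect p) = qval p.
Proof.
transitivity (qval (foldr qinsert [::] p)).
  rewrite /qcollect; elim: (foldr _ _ _) => //= m s ih.
  case: ifP => [_|/eqP e0]; rewrite ?qval_cons ih // e0.
  by rewrite /qval_coef mul0r scale0r add0r.
by elim: p => //= m p ih; rewrite qval_insert ih !qval_cons qval_nil addr0.
Qed.

Definition qletter_ok (w : seq nat) := all (fun n => n < 9)%N w.

Lemma inord_lt3 (i j : nat) : (i < j)%N -> (j < 3)%N -> ((inord i : 'I_3) < (inord j : 'I_3))%N.
Proof. by move=> ij j3; rewrite !inordK // (ltn_trans ij). Qed.

Lemma qswapP (a b : nat) : (b < a)%N -> (a < 9)%N ->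
  qval_letter a * qval_letter b = qval (qswap a b).
Proof.
move=> ba a9.
have ha := divn_eq a 3; have hb := divn_eq b 3.
have a3 : (a %/ 3 < 3)%N by rewrite ltn_divLR.
have b3 : (b %/ 3 < 3)%N by rewrite ltn_divLR // (ltn_trans ba).
have aj : (a %% 3 < 3)%N by rewrite ltn_mod.
have bj : (b %% 3 < 3)%N by rewrite ltn_mod.
have le : (b %/ 3 <= a %/ 3)%N by apply: leq_div2r; apply: ltnW.
rewrite /qswap /qval_letter.
move: ha hb; set i := (a %/ 3)%N in a3 le *; set j := (a %% 3)%N in aj *.
set k := (b %/ 3)%N in b3 le *; set l := (b %% 3)%N in bj * => ha hb.
have E x y : (y < 3)%N -> qval_letter (3 * x + y) = u q (inord x) (inord y).
  by move=> y3; rewrite /qval_letter mulnC divnMDl // divn_small // addn0 modnMDl modn_small.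
have wordE v w : qval_word [:: v; w] = qval_letter v * qval_letter w.
  by rewrite /qval_word !big_cons big_nil mulr1.
have vaE : qval_letter a = u q (inord i) (inord j) by [].
have vbE : qval_letter b = u q (inord k) (inord l) by [].
case: ifP => [/orP ikjl|/negbT]; last rewrite negb_or => /andP[ik jl].
  rewrite qval_cons qval_nil addr0 /= wordE vaE vbE /qval_coef mul1r exprN1.
  apply: (scalerI qC0); rewrite scalerA divff // scale1r.
  case: (eqVneq i k) ikjl => [ikE|ik] ikjl.
    have lj : (l < j)%N by move: ba; rewrite ha hb -ikE ltn_add2l.
    rewrite -ikE.
    exact: (esym (u_row _ (inord_lt3 lj aj))).
  have jl : j = l by case: ikjl => [//|/eqP].
  have ki : (k < i)%N by rewrite ltn_neqAle eq_sym ik.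
  by rewrite jl; exact: (esym (u_col _ (inord_lt3 ki a3))).
have ki : (k < i)%N by rewrite ltn_neqAle eq_sym ik.
case: ifP => lj.
  rewrite !qval_cons qval_nil addr0 /= !wordE !E // vaE vbE /qval_coef !mul1r.
  rewrite expr0z scale1r expr1z exprN1 -scalerDl rmorphN mulN1r.
  have /eqP := u_cross (inord_lt3 ki a3) (inord_lt3 lj aj).
  rewrite subr_eq => /eqP ->; rewrite rmorphB fmorphV addrC addrA -scalerDl.
  by rewrite addrACA subrr addNr addr0 scale0r add0r.
rewrite !qval_cons qval_nil addr0 /= wordE vaE vbE /qval_coef mul1r expr0z scale1r.
have jl' : (j < l)%N by rewrite ltn_neqAle jl leqNgt lj.
by apply/esym; apply: u_comm; rewrite ?inord_lt3.
Qed.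

Lemma qstepP w : qletter_ok w -> qval (qstep w) = qval_word w.
Proof.
elim: w => [|a [|b t] ih] ok.
- by rewrite /= qval_cons qval_nil addr0 /qval_coef mul1r expr0z scale1r.
- by rewrite /= qval_cons qval_nil addr0 /qval_coef mul1r expr0z scale1r.
have [a9 ok'] := andP ok.
rewrite [qstep _]/=; case: ifP => ba.
  transitivity (qval (qswap a b) * qval_word t).
    rewrite /qval big_map mulr_suml; apply: eq_bigr => m _ /=.
    by rewrite qval_wordM scalerAl.
  by rewrite -qswapP // /qval_word !big_cons mulrA.
rewrite -/(qstep (b :: t)).
transitivity (qval_letter a * qval (qstep (b :: t))).
  rewrite /qval big_map mulr_sumr; apply: eq_bigr => m _ /=.
  by rewrite {1}/qval_word big_cons scalerAr.
by rewrite ih // /qval_word [in RHS]big_cons.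
Qed.

Definition ncpoly_ok (p : ncpoly) := all (fun m => qletter_ok m.2) p.

(** The rules are sound for letters below 9. That rewriting preserves this bound is not proved but
    checked by computation, round by round. *)
Fixpoint qnorm_ok (n : nat) (p : ncpoly) : bool :=
  match n with
  | 0 => true
  | n'.+1 => ncpoly_ok p &&
      qnorm_ok n' (qcollect (flatten [seq qscale m.1.1 m.1.2 (qstep m.2) | m <- p]))
  end.

Lemma qnormP n p : qnorm_ok n p -> qval (qnorm n p) = qval p.
Proof.
elim: n p => [|n ih] p /=; first by rewrite qval_collect.
move=> /andP[ok] /ih ->; rewrite qval_collect.
elim: p ok => //= m p ihp /andP[okm okp].
by rewrite qval_cat qval_scale qstepP // qval_cons ihp.
Qed.

Lemma qval_eq0 n p : qnorm_ok n p && nilp (qnorm n p) -> qval p = 0.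
Proof. by move=> /andP[/qnormP <- /nilP ->]; rewrite qval_nil. Qed.

Lemma qval_qletter (i j : 'I_3) : qval (qletter i j) = u q i j.
Proof.
rewrite /qletter qval_cons qval_nil addr0 /qval_coef mul1r expr0z scale1r.
rewrite /qval_word big_cons big_nil mulr1 /qval_letter /=.
by rewrite mulnC divnMDl // divn_small // addn0 modnMDl modn_small // !inord_val.
Qed.

Lemma qlo_lift (i : 'I_3) : qlo i = lift i ord0 :> nat.
Proof. by case: i => [[|[|[|]]]]. Qed.
Lemma qhi_lift (i : 'I_3) : qhi i = lift i ord_max :> nat.
Proof. by case: i => [[|[|[|]]]]. Qed.

Lemma qval_qstar (i j : 'I_3) : qval (qstar i j) = star (u q i j).
Proof.
rewrite u_star /qstar qval_scale; congr (_ *: _).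
  have -> : ((- q) ^ (j%:Z - i%:Z))%:C = (- 1) ^ (j%:Z - i%:Z) * q%:C ^ (j%:Z - i%:Z) :> C.
    by rewrite -expfzMl mulN1r -rmorphN -fmorphXz.
  rewrite /qval_coef; congr (_ * _).
  rewrite expfzDr ?oppr_eq0 ?oner_eq0 // -exprnP -invr_expz -exprnP invr_sign -exprD.
  by rewrite -signr_odd addnC; case: odd.
rewrite /qminorp /qminor qval_cat qval_scale !qval_mul !qlo_lift !qhi_lift !qval_qletter.
by rewrite /qval_coef rmorphN mulN1r expr1z scaleNr.
Qed.

End QuantumMatrices.

(** * Computed identities among the u^i_j and their stars *)

Definition o0 : 'I_3 := inord 0.
Definition o1 : 'I_3 := inord 1.
Definition o2 : 'I_3 := inord 2.

Lemma val_o0 : o0 = 0%N :> nat. Proof. by rewrite inordK. Qed.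
Lemma val_o1 : o1 = 1%N :> nat. Proof. by rewrite inordK. Qed.
Lemma val_o2 : o2 = 2%N :> nat. Proof. by rewrite inordK. Qed.

Lemma ord3_case (i : 'I_3) : [\/ i = o0, i = o1 | i = o2].
Proof.
case: i => [[|[|[|]]]] // ?; [constructor 1|constructor 2|constructor 3];
  by apply: val_inj; rewrite /= inordK.
Qed.

Lemma sum_ord3 (V : nmodType) (F : 'I_3 -> V) :
  \sum_(i < 3) F i = F o0 + F o1 + F o2.
Proof.
rewrite !big_ord_recr big_ord0 /= add0r; congr (F _ + F _ + F _);
  by apply: val_inj; rewrite /= inordK.
Qed.

Lemma o01 : (o0 == o1) = false. Proof. by rewrite -val_eqE /= !inordK. Qed.
Lemma o02 : (o0 == o2) = false. Proof. by rewrite -val_eqE /= !inordK. Qed.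
Lemma o12 : (o1 == o2) = false. Proof. by rewrite -val_eqE /= !inordK. Qed.
Lemma o10 : (o1 == o0) = false. Proof. by rewrite -val_eqE /= !inordK. Qed.
Lemma o20 : (o2 == o0) = false. Proof. by rewrite -val_eqE /= !inordK. Qed.
Lemma o21 : (o2 == o1) = false. Proof. by rewrite -val_eqE /= !inordK. Qed.
Definition o_neq := (o01, o02, o12, o10, o20, o21).

Lemma perm_lengthE (s : 'S_3) : perm_length s =
  ((s o1 < s o0) + (s o2 < s o0) + (s o2 < s o1))%N.
Proof.
pose F (i j : 'I_3) := if (i < j)%N && (s j < s i)%N then 1%N else 0%N.
rewrite /perm_length -sum1_card big_mkcond /=.
rewrite (eq_bigr (fun p => F p.1 p.2)) => [|p _]; last by rewrite inE.
rewrite -(pair_bigA _ F) /= /F.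
have e n (f : 'I_3 -> nat) : n = (f o0 + f o1 + f o2)%N -> (\sum_(i < 3) f i)%N = n.
  move=> ->; rewrite !big_ord_recr big_ord0 /= add0n; congr (f _ + f _ + f _)%N;
    by apply: val_inj; rewrite /= inordK.
rewrite !(e _ _ erefl) /= !val_o0 !val_o1 !val_o2 /=.
by do 3!case: (_ < _)%N.
Qed.

(** Coding a permutation by its three values is injective and lands in a list of six triples; since
    3! = 6 the codes exhaust the list. *)
Lemma sum_S3 (V : nmodType) (G : 'I_3 -> 'I_3 -> 'I_3 -> V) :
  \sum_(s : 'S_3) G (s o0) (s o1) (s o2) =
  G o0 o1 o2 + G o0 o2 o1 + G o1 o0 o2 + G o1 o2 o0 + G o2 o0 o1 + G o2 o1 o0.
Proof.
pose vals (s : 'S_3) := (s o0, s o1, s o2).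
pose l := [:: (o0, o1, o2); (o0, o2, o1); (o1, o0, o2); (o1, o2, o0); (o2, o0, o1); (o2, o1, o0)].
have vals_inj : injective vals.
  move=> s t [e0 e1 e2]; apply/permP => i.
  by case: (ord3_case i) => ->.
have sub : {subset [seq vals s | s <- index_enum 'S_3] <= l}.
  move=> _ /mapP[s _ ->].
  have n01 : s o0 != s o1 by rewrite (inj_eq perm_inj) o01.
  have n02 : s o0 != s o2 by rewrite (inj_eq perm_inj) o02.
  have n12 : s o1 != s o2 by rewrite (inj_eq perm_inj) o12.
  move: n01 n02 n12; rewrite /vals !inE !xpair_eqE.
  case: (ord3_case (s o0)) => ->; case: (ord3_case (s o1)) => ->;
    case: (ord3_case (s o2)) => ->; by rewrite ?eqxx ?o_neq.
have un : uniq [seq vals s | s <- index_enum 'S_3].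
  by rewrite map_inj_uniq ?index_enum_uniq.
have sz : (size l <= size [seq vals s | s <- index_enum 'S_3])%N.
  have e : size (index_enum 'S_3) = #|{: 'S_3}| by rewrite cardE enumT.
  by rewrite size_map [X in (_ <= X)%N]e card_Sn.
have [eqi szE] := uniq_min_size un sub sz.
have ul : uniq l by rewrite (leq_size_uniq un sub sz).
rewrite -(big_map vals xpredT (fun v => G v.1.1 v.1.2 v.2)) (perm_big l) /=; last by apply: uniq_perm.
by rewrite /l !big_cons big_nil addr0 !addrA.
Qed.

Section Identities.
Local Open Scope complex_scope.
Variables (R : realType) (q : R).
Hypotheses (hq0 : 0 < q).
Local Notation C := R[i].
Local Notation A := (SUq3 q).

Lemma qval_letterE (i j : nat) (I J : 'I_3) : i = I -> j = J -> qval q (qletter i j) = u q I J.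
Proof. by move=> -> ->; rewrite qval_qletter. Qed.

Lemma qval_qdet : qval q qdet = 1.
Proof.
have [_ _ _ _ <- _] := SUq3_genP q.
pose G (i j k : 'I_3) : A :=
  ((- q) ^+ ((j < i) + (k < i) + (k < j)))%:C *: (u q o0 i * u q o1 j * u q o2 k).
rewrite (eq_bigr (fun s : 'S_3 => G (s o0) (s o1) (s o2))) => [|s _]; last first.
  by rewrite /G perm_lengthE.
rewrite sum_S3 /G !val_o0 !val_o1 !val_o2 /=.
rewrite /qdet !(qval_cat, qval_scale hq0, qval_mul hq0).
rewrite !(qval_letterE (esym val_o0) (esym val_o0), qval_letterE (esym val_o0) (esym val_o1),
  qval_letterE (esym val_o0) (esym val_o2), qval_letterE (esym val_o1) (esym val_o0),
  qval_letterE (esym val_o1) (esym val_o1), qval_letterE (esym val_o1) (esym val_o2),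
  qval_letterE (esym val_o2) (esym val_o0), qval_letterE (esym val_o2) (esym val_o1),
  qval_letterE (esym val_o2) (esym val_o2)).
have cE c n : qval_coef q ((-1) ^+ n) c = (-1) ^+ n * q%:C ^ c.
  by rewrite /qval_coef rmorphXn rmorphN1.
have qE n : ((- q) ^+ n)%:C = (-1) ^+ n * q%:C ^+ n :> C.
  by rewrite rmorphXn /= rmorphN /= -mulN1r exprMn.
rewrite !qE /= !addn0 !addrA !expr0 !mul1r !scale1r.
rewrite /qval_coef.
by congr (_ + _ *: _ + _ *: _ + _ *: _ + _ *: _ + _ *: _); rewrite -exprnP; ring.
Qed.

Definition qzero (n : nat) (p : ncpoly) := qnorm_ok n p && nilp (qnorm n p).

Lemma qval_zero2 (n : nat) (F : nat -> nat -> ncpoly) :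
  all (fun l => all (fun k => qzero n (F l k)) (iota 0 3)) (iota 0 3) ->
  forall l k : 'I_3, qval q (F l k) = 0.
Proof.
move=> /allP H l k; apply: (@qval_eq0 _ _ hq0 n).
have in3 (i : 'I_3) : (i : nat) \in iota 0 3 by rewrite mem_iota leq0n add0n ltn_ord.
exact: (allP (H _ (in3 l)) _ (in3 k)).
Qed.

Let lets := (qval_qdet, qval_qstar hq0, qval_qletter, qval_cat, qval_scale hq0, qval_mul hq0).

Lemma qval_o0 (f : nat -> ncpoly) : f 0%N = f o0. Proof. by rewrite val_o0. Qed.
Lemma qval_o1 (f : nat -> ncpoly) : f 1%N = f o1. Proof. by rewrite val_o1. Qed.
Lemma qval_o2 (f : nat -> ncpoly) : f 2%N = f o2. Proof. by rewrite val_o2. Qed.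

Lemma qval_coefN1 : qval_coef q (-1) 0 = -1.
Proof. by rewrite /qval_coef expr0z mulr1 rmorphN1. Qed.

Lemma qval_starE (i j : nat) (I J : 'I_3) : i = I -> j = J ->
  qval q (qstar i j) = star (u q I J).
Proof. by move=> -> ->; rewrite qval_qstar. Qed.

Let e0 := esym val_o0.
Let e1 := esym val_o1.
Let e2 := esym val_o2.

(** Unitarity of u. The scalar 1 is entered as [qdet], so that the identity becomes homogeneous of
    degree three and follows from the commutation relations alone. *)
Lemma star_u_mul_u (l k : 'I_3) :
  star (u q o0 l) * u q o0 k + star (u q o1 l) * u q o1 k + star (u q o2 l) * u q o2 k
  = (l == k)%:R.
Proof.
pose F (l k : nat) :=
  qmul (qstar 0 l) (qletter 0 k) ++ qmul (qstar 1 l) (qletter 1 k)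
  ++ qmul (qstar 2 l) (qletter 2 k) ++ (if l == k then qscale (-1) 0 qdet else [::]).
have : qval q (F l k) = 0 by apply: (@qval_zero2 10 F); vm_compute.
rewrite /F (qval_o0 (fun i => qstar i l)) (qval_o0 (fun i => qletter i k)).
rewrite (qval_o1 (fun i => qstar i l)) (qval_o1 (fun i => qletter i k)).
rewrite (qval_o2 (fun i => qstar i l)) (qval_o2 (fun i => qletter i k)).
rewrite !lets -val_eqE.
case: ifP => _; rewrite ?lets ?qval_nil ?addr0 !addrA //.
by rewrite qval_coefN1 scaleN1r => /eqP; rewrite subr_eq0 => /eqP.
Qed.

(** The sphere relation with the stars on the left; it drives the induction in [sum_psi_neg]. *)
Lemma sum_z_star_z : q%:C ^+ 4 *: (star (u q o2 o0) * u q o2 o0)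
  + q%:C ^+ 2 *: (star (u q o2 o1) * u q o2 o1) + star (u q o2 o2) * u q o2 o2 = 1.
Proof.
pose F := qscale 1 4 (qmul (qstar 2 0) (qletter 2 0)) ++ qscale 1 2 (qmul (qstar 2 1) (qletter 2 1))
  ++ qmul (qstar 2 2) (qletter 2 2) ++ qscale (-1) 0 qdet.
have : qval q F = 0 by apply: (@qval_eq0 _ _ hq0 10); vm_compute.
rewrite /F !(qval_letterE e2 e0, qval_letterE e2 e1, qval_letterE e2 e2,
  qval_starE e2 e0, qval_starE e2 e1, qval_starE e2 e2, lets) qval_coefN1 scaleN1r.
by rewrite /qval_coef !mul1r !addrA => /eqP; rewrite subr_eq0 => /eqP.
Qed.

Lemma sum_z_z_star : u q o2 o0 * star (u q o2 o0) + u q o2 o1 * star (u q o2 o1)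
  + u q o2 o2 * star (u q o2 o2) = 1.
Proof.
pose F := qmul (qletter 2 0) (qstar 2 0) ++ qmul (qletter 2 1) (qstar 2 1)
  ++ qmul (qletter 2 2) (qstar 2 2) ++ qscale (-1) 0 qdet.
have : qval q F = 0 by apply: (@qval_eq0 _ _ hq0 10); vm_compute.
rewrite /F !(qval_letterE e2 e0, qval_letterE e2 e1, qval_letterE e2 e2,
  qval_starE e2 e0, qval_starE e2 e1, qval_starE e2 e2, lets) qval_coefN1 scaleN1r.
by rewrite !addrA => /eqP; rewrite subr_eq0 => /eqP.
Qed.

Definition third (l k : nat) : nat := (3 - l - k)%N.

Lemma third_ord3 (l k : 'I_3) : exists j : 'I_3, l != k -> third l k = j.
Proof.
case: (ltnP (third l k) 3) => h; first by exists (Ordinal h).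
exists o0 => lk; move: l k h lk => [[|[|[|]]] // ?] [[|[|[|]]] // ?] //=.
Qed.

(** The left side is a quantum minor of the last two rows: zero for l = k, and otherwise a multiple
    of the star of an entry of the first row, that is of a letter w. *)
Lemma u_flip (l k : 'I_3) : exists (c : C) (j : 'I_3),
  u q o1 l * u q o2 k - q%:C *: (u q o2 l * u q o1 k) = c *: star (u q o0 j).
Proof.
pose G (l k : nat) : ncpoly := if l == k then [::] else
  qscale (if odd (third l k + (k < l)) then 1 else -1)
    (((k < l)%N : nat)%:Z - (third l k)%:Z) (qstar 0 (third l k)).
pose F (l k : nat) := qmul (qletter 1 l) (qletter 2 k)
  ++ qscale (-1) 1 (qmul (qletter 2 l) (qletter 1 k)) ++ G l k.
have : qval q (F l k) = 0 by apply: (@qval_zero2 10 F); vm_compute.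
rewrite /F (qval_o1 (fun i => qletter i l)) (qval_o1 (fun i => qletter i k)).
rewrite (qval_o2 (fun i => qletter i l)) (qval_o2 (fun i => qletter i k)).
rewrite !lets addrA => /eqP; rewrite addr_eq0 {1}/qval_coef rmorphN1 expr1z mulN1r scaleNr => /eqP ->.
rewrite /G; case: eqVneq => [_|lk].
  by exists 0, o0; rewrite qval_nil oppr0 scale0r.
have [j /(_ lk) ->] := third_ord3 l k.
by rewrite (qval_scale hq0) (qval_starE e0 (erefl (j : nat))) -scaleNr; do 2!eexists.
Qed.

Lemma u_flip01 (l k : 'I_3) : exists (c : C) (j : 'I_3),
  u q o0 l * u q o1 k - q%:C *: (u q o1 l * u q o0 k) = c *: star (u q o2 j).
Proof.
pose G (l k : nat) : ncpoly := if l == k then [::] else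
  qscale (if odd (third l k + (k < l)) then 1 else -1)
   (((k < l)%N : nat)%:Z + 2%:Z - (third l k)%:Z) (qstar 2 (third l k)).
pose F (l k : nat) := qmul (qletter 0 l) (qletter 1 k)
  ++ qscale (-1) 1 (qmul (qletter 1 l) (qletter 0 k)) ++ G l k.
have : qval q (F l k) = 0 by apply: (@qval_zero2 10 F); vm_compute.
rewrite /F (qval_o0 (fun i => qletter i l)) (qval_o0 (fun i => qletter i k)).
rewrite (qval_o1 (fun i => qletter i l)) (qval_o1 (fun i => qletter i k)).
rewrite !lets addrA => /eqP; rewrite addr_eq0 {1}/qval_coef rmorphN1 expr1z mulN1r scaleNr => /eqP ->.
rewrite /G; case: eqVneq => [_|lk].
  by exists 0, o0; rewrite qval_nil oppr0 scale0r.
have [j /(_ lk) ->] := third_ord3 l k.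
by rewrite (qval_scale hq0) (qval_starE e2 (erefl (j : nat))) -scaleNr; do 2!eexists.
Qed.

Lemma star_u_flip (l k : 'I_3) : exists (c : C) (j : 'I_3),
  star (u q o1 l) * star (u q o0 k) - q%:C *: (star (u q o0 l) * star (u q o1 k))
  = c *: u q o2 j.
Proof.
have [c [j e]] := u_flip01 k l; exists (Num.conj c), j.
have := congr1 star e; rewrite starD starN !starZ !starM starK => <-.
by rewrite conj_real.
Qed.

(** The rule that moves a letter z to the right of a letter w, so that every product of such letters
    can be written with the w first. *)
Lemma z_star_u (k l : 'I_3) : exists f : 'I_3 -> C,
  u q o2 k * star (u q o0 l) =
  (if k == l then \sum_(a < 3) f a *: (star (u q o0 a) * u q o2 a)
   else star (u q o0 l) * u q o2 k).
Proof.
pose G (k l : nat) : ncpoly := if k == l then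
   (if k == 0 then qscale (-1) 1 (qmul (qstar 0 0) (qletter 2 0))
   else if k == 1 then qscale (-1) 1 (qmul (qstar 0 1) (qletter 2 1))
     ++ qscale (-1) 3 (qmul (qstar 0 0) (qletter 2 0))
     ++ qscale 1 1 (qmul (qstar 0 0) (qletter 2 0))
   (* For the last column: the sum of all z_a w_a is an off-diagonal entry of u times its adjoint,
      hence 0; it is solved for the third summand with the two formulas above. *)
   else qscale 1 3 (qmul (qstar 0 0) (qletter 2 0))
     ++ qscale 1 1 (qmul (qstar 0 1) (qletter 2 1)))
  else qscale (-1) 0 (qmul (qstar 0 l) (qletter 2 k)).
pose F (k l : nat) := qmul (qletter 2 k) (qstar 0 l) ++ G k l.
have : qval q (F k l) = 0 by apply: (@qval_zero2 10 F); vm_compute.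
rewrite /F (qval_o2 (fun i => qletter i k)) (qval_o0 (fun i => qstar i l)) !lets.
move=> /eqP; rewrite addr_eq0 => /eqP ->.
rewrite /G val_eqE; case: eqVneq => [_|kl]; last first.
  exists (fun=> 0); rewrite (qval_o2 (fun i => qletter i k)) (qval_o0 (fun i => qstar i l)) !lets.
  by rewrite qval_coefN1 scaleN1r opprK.
case: ifP => _; last case: ifP => _.
- exists (fun a => if a == o0 then - qval_coef q (-1) 1 else 0).
  rewrite sum_ord3 eqxx !o_neq !scale0r !addr0.
  by rewrite !(qval_letterE e2 e0, qval_starE e0 e0, lets) scaleNr.
- exists (fun a => if a == o0 then - qval_coef q (-1) 3 - qval_coef q 1 1 else
     if a == o1 then - qval_coef q (-1) 1 else 0).
  rewrite sum_ord3 eqxx !o_neq eqxx scale0r !addr0.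
  rewrite !(qval_letterE e2 e0, qval_letterE e2 e1, qval_starE e0 e0, qval_starE e0 e1, lets).
  by rewrite !scalerDl !scaleNr addrC !opprD addrA.
- exists (fun a => if a == o0 then - qval_coef q 1 3 else
     if a == o1 then - qval_coef q 1 1 else 0).
  rewrite sum_ord3 eqxx !o_neq eqxx scale0r !addr0.
  rewrite !(qval_letterE e2 e0, qval_letterE e2 e1, qval_starE e0 e0, qval_starE e0 e1, lets).
  by rewrite !scaleNr opprD.
Qed.

End Identities.

(** * Generation by highest weight vectors *)

Section LinClosed.
Variables (K : fieldType) (V : lmodType K).

Definition lin_closed (P : V -> Prop) : Prop :=
  P 0 /\ forall c x y, P x -> P y -> P (c *: x + y).

Variables (P : V -> Prop) (hP : lin_closed P).

Lemma lin_closed0 : P 0. Proof. by case: hP. Qed.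
Lemma lin_closedZ c x : P x -> P (c *: x).
Proof. by case: hP => h0 hl hx; rewrite -[_ *: _]addr0; apply: hl. Qed.
Lemma lin_closedD x y : P x -> P y -> P (x + y).
Proof. by case: hP => h0 hl hx hy; rewrite -[x]scale1r; apply: hl. Qed.
Lemma lin_closedN x : P x -> P (- x).
Proof. by move=> hx; rewrite -scaleN1r; apply: lin_closedZ. Qed.
Lemma lin_closedB x y : P x -> P y -> P (x - y).
Proof. by move=> hx hy; apply: lin_closedD => //; apply: lin_closedN. Qed.
Lemma lin_closed_sum I (r : seq I) (p : pred I) F :
  (forall i, p i -> P (F i)) -> P (\sum_(i <- r | p i) F i).
Proof. by apply: big_ind; [apply: lin_closed0|apply: lin_closedD]. Qed.
Lemma lin_closedDl x y : P y -> P (x + y) -> P x.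
Proof. by move=> hy hxy; rewrite -[x](addrK y); apply: lin_closedB. Qed.
Lemma lin_closedZl c x : c != 0 -> P (c *: x) -> P x.
Proof. by move=> c0 hx; rewrite -[x]scale1r -(mulVf c0) -scalerA; apply: lin_closedZ. Qed.
End LinClosed.

(* If [y_l x_k - q x_l y_k] is negligible for all [k], [l], then so is every difference
   between the suitably rescaled ways of placing one letter [y] in a word in the [x]. *)
Section Flip.
Local Open Scope complex_scope.
Variables (R : realType) (q : R).
Hypotheses (hq0 : 0 < q).
Local Notation C := R[i].
Variables (A : algType C) (I : Type) (x y : I -> A) (H : A -> Prop).
Hypothesis H_lin : lin_closed H.
Hypothesis H_mull : forall k a, H a -> H (x k * a).
Hypothesis H_mulr : forall k a, H a -> H (a * x k).
Hypothesis H_flip : forall l k, H (y l * x k - q%:C *: (x l * y k)).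

Definition mon (s : seq I) : A := \prod_(k <- s) x k.

Lemma mon_nil : mon [::] = 1. Proof. exact: big_nil. Qed.
Lemma mon_cons k s : mon (k :: s) = x k * mon s. Proof. exact: big_cons. Qed.
Lemma mon_cat r s : mon (r ++ s) = mon r * mon s. Proof. exact: big_cat. Qed.
Lemma mon_rcons s k : mon (rcons s k) = mon s * x k.
Proof. by rewrite -cats1 mon_cat mon_cons mon_nil mulr1. Qed.

Lemma mull_mon s a : H a -> H (mon s * a).
Proof.
by elim: s => [|k s ih] ha; rewrite ?mon_nil ?mul1r // mon_cons -mulrA; apply/H_mull/ih.
Qed.

Lemma mulr_mon s a : H a -> H (a * mon s).
Proof.
elim: s a => [|k s ih] a ha; rewrite ?mon_nil ?mulr1 // mon_cons mulrA.
by apply/ih/H_mulr.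
Qed.

(** Telescoping: the letter y travels through the word one flip at a time, each flip costing a
    factor q. *)
Lemma flip_ends s l k :
  H (y l * mon s * x k - q%:C ^+ (size s).+1 *: (x l * mon s * y k)).
Proof.
elim: s l => [|a s ih] l; first by rewrite mon_nil !mulr1.
rewrite mon_cons.
have -> : y l * (x a * mon s) * x k
    - q%:C ^+ (size (a :: s)).+1 *: (x l * (x a * mon s) * y k) =
  (y l * x a - q%:C *: (x l * y a)) * mon s * x k
  + q%:C *: (x l * (y a * mon s * x k - q%:C ^+ (size s).+1 *: (x a * mon s * y k))).
  rewrite mulrBr !mulrBl scalerBr -scalerAr scalerA -exprS -!scalerAl !mulrA.
  by rewrite addrA subrK.
apply: (lin_closedD H_lin); first by apply/H_mulr/mulr_mon.
by apply/(lin_closedZ H_lin)/H_mull/ih.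
Qed.

Variables (E : A -> A) (c : C).
Hypothesis E1 : E 1 = 0.
Hypothesis E_rcons : forall s a, E (mon s * x a) =
  (Num.sqrt q)%:C *: (E (mon s) * x a) + ((Num.sqrt q)%:C ^+ size s)^-1 *: (mon s * (c *: y a)).

(** Total weight collected when E acts on each of the m + 1 letters and the resulting y is brought
    to the front: a q-analogue of m + 1. Only its positivity is used. *)
Fixpoint flip_coef (m : nat) : R :=
  match m with
  | 0 => 1
  | m'.+1 => Num.sqrt q * flip_coef m' + (Num.sqrt q ^+ m)^-1 * (q ^+ m)^-1
  end.

Lemma flip_coef_gt0 m : 0 < flip_coef m.
Proof.
have s0 : 0 < Num.sqrt q by rewrite sqrtr_gt0.
elim: m => [|m ih] /=; first exact: ltr01.
by rewrite addr_gt0 ?mulr_gt0 ?invr_gt0 ?exprn_gt0.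
Qed.

(** By the twisted Leibniz rule E replaces one letter x by y in all possible places; modulo [H] all
    these words are positive multiples of the one with y in front, so they add up without
    cancelling. *)
Lemma E_flip k s : H (E (x k * mon s) - (c * (flip_coef (size s))%:C) *: (y k * mon s)).
Proof.
elim/last_ind: s => [|s a ih].
  rewrite mon_nil !mulr1 -[x k]mul1r -mon_nil E_rcons mon_nil E1 mul0r scaler0 add0r.
  by rewrite expr0 invr1 scale1r mul1r subrr; apply: lin_closed0.
rewrite mon_rcons mulrA -mon_cons E_rcons mon_cons size_rcons /=.
have -> : (Num.sqrt q)%:C *: (E (x k * mon s) * x a)
    + ((Num.sqrt q)%:C ^+ (size s).+1)^-1 *: (x k * mon s * (c *: y a))
    - (c * (Num.sqrt q * flip_coef (size s) + (Num.sqrt q ^+ (size s).+1)^-1 * (q ^+ (size s).+1)^-1)%:C)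
       *: (y k * (mon s * x a))
  = (Num.sqrt q)%:C *: ((E (x k * mon s) - (c * (flip_coef (size s))%:C) *: (y k * mon s)) * x a)
   - (c * ((Num.sqrt q)%:C ^+ (size s).+1)^-1 * (q%:C ^+ (size s).+1)^-1) *:
      (y k * mon s * x a - q%:C ^+ (size s).+1 *: (x k * mon s * y a)).
  rewrite -scalerAr mulrBl -scalerAl !mulrA !scalerBr !scalerA.
  set X := E _ * _; set Y := _ * y a; set Z := _ * x a.
  have -> : c * (Num.sqrt q * flip_coef (size s)
      + (Num.sqrt q ^+ (size s).+1)^-1 * (q ^+ (size s).+1)^-1)%:C
    = (Num.sqrt q)%:C * (c * (flip_coef (size s))%:C)
      + c * ((Num.sqrt q)%:C ^+ (size s).+1)^-1 * (q%:C ^+ (size s).+1)^-1.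
    rewrite rmorphD !rmorphM !fmorphV !rmorphXn /=; ring.
  rewrite divfK ?expf_neq0 ?qC_neq0 // [c / _]mulrC.
  rewrite scalerDl opprD opprB -!addrA; congr (_ + _).
  by rewrite addrC -!addrA; congr (_ + _); rewrite addrC.
apply: (lin_closedB H_lin); apply: (lin_closedZ H_lin); last exact: flip_ends.
exact: H_mulr.
Qed.

End Flip.

Definition i1 : 'I_2 := ord0.
Definition i2 : 'I_2 := ord_max.

Lemma ord2_case (i : 'I_2) : i = i1 \/ i = i2.
Proof. by case: i => [[|[|]]] // ?; [left|right]; apply: val_inj. Qed.

Lemma ilo1 : ilo i1 = o0. Proof. by apply: val_inj; rewrite /= inordK. Qed.
Lemma ilo2 : ilo i2 = o1. Proof. by apply: val_inj; rewrite /= inordK. Qed.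
Lemma ihi1 : ihi i1 = o1. Proof. by apply: val_inj; rewrite /= inordK. Qed.
Lemma ihi2 : ihi i2 = o2. Proof. by apply: val_inj; rewrite /= inordK. Qed.
Definition ilohi := (ilo1, ilo2, ihi1, ihi2).

(** * The action on the generators, their stars and the words in z and w *)

Section Table.
Local Open Scope complex_scope.
Variables (R : realType) (q : R).
Hypotheses (hq0 : 0 < q).
Local Notation C := R[i].
Local Notation A := (SUq3 q).
Variables (U : Uq_hopf q) (act : right_action U).
Local Notation "a <<| k" := (act a k) (at level 39, left associativity).

Definition kw (i : 'I_2) (j : 'I_3) : int := (ihi i == j)%:Z - (ilo i == j)%:Z.

Lemma kwE : (kw i1 o0 = -1) * (kw i1 o1 = 1) * (kw i1 o2 = 0) *
  (kw i2 o0 = 0) * (kw i2 o1 = -1) * (kw i2 o2 = 1).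
Proof. by rewrite /kw !ilohi !eqxx !o_neq. Qed.

Lemma act_u_K i j k : u q j k <<| gK q i = qw q (kw i j) *: u q j k.
Proof. exact: act_K. Qed.

Lemma act_u_KV i j k : u q j k <<| gKV q i = qw q (- kw i j) *: u q j k.
Proof.
rewrite -[in RHS](act_KKV act (u q j k) i) act_u_K actZl scalerA -qwD // addNr qw0 //.
by rewrite scale1r.
Qed.

Lemma conj_qw n : Num.conj (qw q n) = qw q n.
Proof. exact: conj_real. Qed.

Lemma act_su_K i j k : star (u q j k) <<| gK q i = qw q (- kw i j) *: star (u q j k).
Proof. by rewrite act_star_K act_u_KV starZ conj_qw. Qed.

Lemma act_su_KV i j k : star (u q j k) <<| gKV q i = qw q (kw i j) *: star (u q j k).
Proof. by rewrite act_star_KV act_u_K starZ conj_qw. Qed.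

Lemma act_u_E i j k : u q j k <<| gE q i = if ihi i == j then u q (ilo i) k else 0.
Proof. by rewrite act_E; case: (_ == _); rewrite ?scale1r ?scale0r. Qed.

Lemma act_u_F i j k : u q j k <<| gF q i = if ilo i == j then u q (ihi i) k else 0.
Proof. by rewrite act_F; case: (_ == _); rewrite ?scale1r ?scale0r. Qed.

Lemma act_su_E i j k : star (u q j k) <<| gE q i =
  if ilo i == j then - q%:C *: star (u q (ihi i) k) else 0.
Proof. by rewrite act_star_E // act_u_F; case: ifP => _ //; rewrite star0 scaler0. Qed.

Lemma act_su_F i j k : star (u q j k) <<| gF q i =
  if ihi i == j then - (q^-1)%:C *: star (u q (ilo i) k) else 0.
Proof. by rewrite act_star_F // act_u_E; case: ifP => _ //; rewrite star0 scaler0. Qed.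

Lemma mulr_scale (a b : A) (c d : C) : (c *: a) * (d *: b) = (c * d) *: (a * b).
Proof. by rewrite -scalerAl -scalerAr scalerA. Qed.

Definition zmn (s : seq 'I_3) : A := mon (u q o2) s.
Definition wmn (s : seq 'I_3) : A := mon (fun l => star (u q o0 l)) s.

Lemma act_mon_K (x : 'I_3 -> A) i n s : (forall k, x k <<| gK q i = qw q n *: x k) ->
  mon x s <<| gK q i = qw q (n *+ size s) *: mon x s.
Proof.
move=> h; elim: s => [|k s ih].
  by rewrite mon_nil act1 epsUK mulr0n qw0 // scale1r.
by rewrite mon_cons act_mulK h ih mulr_scale -qwD // -mulrS.
Qed.

Lemma act_mon_KV (x : 'I_3 -> A) i n s : (forall k, x k <<| gKV q i = qw q n *: x k) ->
  mon x s <<| gKV q i = qw q (n *+ size s) *: mon x s.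
Proof.
move=> h; elim: s => [|k s ih].
  by rewrite mon_nil act1 epsUKV mulr0n qw0 // scale1r.
by rewrite mon_cons act_mulKV h ih mulr_scale -qwD // -mulrS.
Qed.

Lemma act_mon_E0 (x : 'I_3 -> A) i s : (forall k, x k <<| gE q i = 0) ->
  mon x s <<| gE q i = 0.
Proof.
move=> h; elim: s => [|k s ih]; first by rewrite mon_nil act1 epsUE scale0r.
by rewrite mon_cons act_mulE h ih mul0r mulr0 addr0.
Qed.

Lemma act_mon_F0 (x : 'I_3 -> A) i s : (forall k, x k <<| gF q i = 0) ->
  mon x s <<| gF q i = 0.
Proof.
move=> h; elim: s => [|k s ih]; first by rewrite mon_nil act1 epsUF scale0r.
by rewrite mon_cons act_mulF h ih mul0r mulr0 addr0.
Qed.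

Lemma zmn_K1 s : zmn s <<| gK q i1 = zmn s.
Proof.
by rewrite (act_mon_K (n := 0)) => [|k]; rewrite ?act_u_K ?kwE // mul0rn qw0 ?scale1r.
Qed.
Lemma zmn_KV1 s : zmn s <<| gKV q i1 = zmn s.
Proof.
by rewrite (act_mon_KV (n := 0)) => [|k]; rewrite ?act_u_KV ?kwE // mul0rn qw0 ?scale1r.
Qed.
Lemma zmn_K2 s : zmn s <<| gK q i2 = qw q (size s) *: zmn s.
Proof.
by rewrite (act_mon_K (n := 1)) => [|k]; rewrite ?act_u_K ?kwE // -mulr_natl mulr1 natz.
Qed.
Lemma zmn_KV2 s : zmn s <<| gKV q i2 = qw q (- (size s)%:Z) *: zmn s.
Proof.
by rewrite (act_mon_KV (n := -1)) => [|k]; rewrite ?act_u_KV ?kwE // mulNrn natz.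
Qed.
Lemma zmn_E1 s : zmn s <<| gE q i1 = 0.
Proof. by apply: act_mon_E0 => k; rewrite act_u_E ilohi o_neq. Qed.
Lemma zmn_F i s : zmn s <<| gF q i = 0.
Proof.
by apply: act_mon_F0 => k; rewrite act_u_F; case: (ord2_case i) => ->; rewrite ilohi o_neq.
Qed.

Lemma wmn_K1 s : wmn s <<| gK q i1 = qw q (size s) *: wmn s.
Proof.
by rewrite (act_mon_K (n := 1)) => [|k]; rewrite ?act_su_K ?kwE // -mulr_natl mulr1 natz.
Qed.
Lemma wmn_KV1 s : wmn s <<| gKV q i1 = qw q (- (size s)%:Z) *: wmn s.
Proof.
by rewrite (act_mon_KV (n := -1)) => [|k]; rewrite ?act_su_KV ?kwE // mulNrn natz.
Qed.
Lemma wmn_K2 s : wmn s <<| gK q i2 = wmn s.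
Proof.
by rewrite (act_mon_K (n := 0)) => [|k]; rewrite ?act_su_K ?kwE // mul0rn qw0 ?scale1r.
Qed.
Lemma wmn_KV2 s : wmn s <<| gKV q i2 = wmn s.
Proof.
by rewrite (act_mon_KV (n := 0)) => [|k]; rewrite ?act_su_KV ?kwE // mul0rn qw0 ?scale1r.
Qed.
Lemma wmn_E2 s : wmn s <<| gE q i2 = 0.
Proof. by apply: act_mon_E0 => k; rewrite act_su_E ilohi o_neq. Qed.
Lemma wmn_F i s : wmn s <<| gF q i = 0.
Proof.
by apply: act_mon_F0 => k; rewrite act_su_F; case: (ord2_case i) => ->; rewrite ilohi o_neq.
Qed.

End Table.

(** * The subalgebra of words in w and z, and how it is raised *)

Section Generation.
Local Open Scope complex_scope.
Variables (R : realType) (q : R).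
Hypotheses (hq0 : 0 < q).
Local Notation C := R[i].
Local Notation A := (SUq3 q).
Variables (U : Uq_hopf q) (act : right_action U).
Local Notation "a <<| k" := (act a k) (at level 39, left associativity).
Local Notation zm := (zmn q).
Local Notation wm := (wmn q).
Local Notation w l := (star (u q o0 l)).
Local Notation v l := (star (u q o1 l)).

Lemma zmn_nil : zm [::] = 1. Proof. exact: mon_nil. Qed.
Lemma wmn_nil : wm [::] = 1. Proof. exact: mon_nil. Qed.
Lemma zmn_cons k s : zm (k :: s) = u q o2 k * zm s. Proof. exact: mon_cons. Qed.
Lemma wmn_cons k s : wm (k :: s) = w k * wm s. Proof. exact: mon_cons. Qed.
Lemma zmn_rcons k s : zm (rcons s k) = zm s * u q o2 k. Proof. exact: mon_rcons. Qed.
Lemma wmn_rcons k s : wm (rcons s k) = wm s * w k. Proof. exact: mon_rcons. Qed.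
Lemma zmn_cat r s : zm (r ++ s) = zm r * zm s. Proof. exact: mon_cat. Qed.
Lemma wmn_cat r s : wm (r ++ s) = wm r * wm s. Proof. exact: mon_cat. Qed.
Lemma zmn1 k : u q o2 k = zm [:: k]. Proof. by rewrite zmn_cons zmn_nil mulr1. Qed.
Lemma wmn1 k : w k = wm [:: k]. Proof. by rewrite wmn_cons wmn_nil mulr1. Qed.

(** Only ordered words are taken. The reordering rule [z_star_u] makes their span stable under
    multiplication by z and w on both sides, so it can serve as the negligible subspace of the flip
    argument. *)
Inductive hw_span : A -> Prop :=
| hw_span_mon r s : hw_span (wm r * zm s)
| hw_span0 : hw_span 0
| hw_span_lin (c : C) x y : hw_span x -> hw_span y -> hw_span (c *: x + y).

Lemma hw_span_closed : lin_closed hw_span.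
Proof. by split; [apply: hw_span0|apply: hw_span_lin]. Qed.

Lemma lin_closed_mull (P : A -> Prop) a : lin_closed P -> lin_closed (fun x => P (a * x)).
Proof.
case=> h0 hl; split=> [|c x y hx hy]; first by rewrite mulr0.
by rewrite mulrDr -scalerAr; apply: hl.
Qed.

Lemma lin_closed_mulr (P : A -> Prop) a : lin_closed P -> lin_closed (fun x => P (x * a)).
Proof.
case=> h0 hl; split=> [|c x y hx hy]; first by rewrite mul0r.
by rewrite mulrDl -scalerAl; apply: hl.
Qed.

Lemma hw_span_mon_ind (P : A -> Prop) : lin_closed P ->
  (forall r s, P (wm r * zm s)) -> forall x, hw_span x -> P x.
Proof. by case=> h0 hl hm x; elim=> // c {}x y _ hx _ hy; apply: hl. Qed.

Lemma zmn_hw_span s : hw_span (zm s).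
Proof. by rewrite -[zm s]mul1r -wmn_nil; apply: hw_span_mon. Qed.

Lemma wmn_hw_span s : hw_span (wm s).
Proof. by rewrite -[wm s]mulr1 -zmn_nil; apply: hw_span_mon. Qed.

Lemma hw_span_wl l x : hw_span x -> hw_span (w l * x).
Proof.
apply: (hw_span_mon_ind (P := fun x => hw_span (w l * x))) => [|r s].
  exact/lin_closed_mull/hw_span_closed.
by rewrite mulrA -wmn_cons; apply: hw_span_mon.
Qed.

Lemma hw_span_zr k x : hw_span x -> hw_span (x * u q o2 k).
Proof.
apply: (hw_span_mon_ind (P := fun x => hw_span (x * u q o2 k))) => [|r s].
  exact/lin_closed_mulr/hw_span_closed.
by rewrite -mulrA -zmn_rcons; apply: hw_span_mon.
Qed.

Lemma hw_span_zl k x : hw_span x -> hw_span (u q o2 k * x).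
Proof.
move=> hx; move: x hx k.
suff H r s k : hw_span (u q o2 k * (wm r * zm s)).
  move=> x hx k; move: x hx.
  apply: (hw_span_mon_ind (P := fun x => hw_span (u q o2 k * x))) => //.
  exact/lin_closed_mull/hw_span_closed.
elim: r k => [|l r ih] k.
  by rewrite wmn_nil mul1r -zmn_cons; apply: zmn_hw_span.
rewrite wmn_cons !mulrA; have [f ->] := z_star_u hq0 k l.
case: eqVneq => [_|_]; last by rewrite -!mulrA; apply/hw_span_wl; apply: ih.
rewrite !mulr_suml; apply: (lin_closed_sum hw_span_closed) => a _.
rewrite -!scalerAl; apply: (lin_closedZ hw_span_closed).
by rewrite -!mulrA; apply/hw_span_wl; apply: ih.
Qed.

Lemma hw_span_wr l x : hw_span x -> hw_span (x * w l).
Proof.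
apply: (hw_span_mon_ind (P := fun x => hw_span (x * w l))) => [|r s].
  exact/lin_closed_mulr/hw_span_closed.
rewrite -mulrA; apply: mull_mon => [*|]; first exact: hw_span_wl.
apply: mull_mon => [*|]; first exact: hw_span_zl.
by rewrite wmn1; apply: wmn_hw_span.
Qed.

Inductive hw_gen : A -> Prop :=
| hw_gen_span x : hw_span x -> hw_gen x
| hw_gen_lin (c : C) x y : hw_gen x -> hw_gen y -> hw_gen (c *: x + y)
| hw_gen_act x k : hw_gen x -> hw_gen (x <<| k).

Lemma hw_gen_closed : lin_closed hw_gen.
Proof.
split; last exact: hw_gen_lin.
by apply: hw_gen_span; apply: hw_span0.
Qed.

Let s2 := (Num.sqrt q)%:C : C.

Lemma s2E : s2 = qw q 1. Proof. by rewrite /qw /qhalf expr1z. Qed.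
Lemma s2XE n : s2 ^+ n = qw q n.
Proof.
elim: n => [|n ih]; first by rewrite expr0 qw0.
by rewrite exprS ih s2E -qwD // -intS.
Qed.
Lemma s2VE n : (s2 ^+ n)^-1 = qw q (- n%:Z).
Proof. by rewrite s2XE qwN. Qed.

Lemma E2_rcons s a : (zm s * u q o2 a) <<| gE q i2 =
  s2 *: ((zm s <<| gE q i2) * u q o2 a) + (s2 ^+ size s)^-1 *: (zm s * (1 *: u q o1 a)).
Proof.
rewrite act_mulE zmn_KV2 // act_u_K kwE act_u_E !ilohi eqxx -s2E scale1r.
by congr (_ + _); rewrite ?s2VE -?scalerAr -?scalerAl.
Qed.

Lemma E1_rcons s a : (wm s * w a) <<| gE q i1 =
  s2 *: ((wm s <<| gE q i1) * w a) + (s2 ^+ size s)^-1 *: (wm s * (- q%:C *: v a)).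
Proof.
rewrite act_mulE wmn_KV1 // act_su_K // kwE act_su_E // !ilohi eqxx -s2E.
by rewrite s2VE; congr (_ + _); [rewrite scalerAr|rewrite scalerAl].
Qed.

Lemma flip_z l k : hw_span (u q o1 l * u q o2 k - q%:C *: (u q o2 l * u q o1 k)).
Proof.
have [c [j ->]] := u_flip hq0 l k; apply: (lin_closedZ hw_span_closed).
by rewrite wmn1; apply: wmn_hw_span.
Qed.

Lemma flip_w l k : hw_span (v l * w k - q%:C *: (w l * v k)).
Proof.
have [c [j ->]] := star_u_flip hq0 l k; apply: (lin_closedZ hw_span_closed).
by rewrite zmn1; apply: zmn_hw_span.
Qed.

Lemma unit_act_E i : (1 : A) <<| gE q i = 0.
Proof. by rewrite act1 epsUE scale0r. Qed.

Lemma z_flip_ends s l k :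
  hw_span (u q o1 l * zm s * u q o2 k - q%:C ^+ (size s).+1 *: (u q o2 l * zm s * u q o1 k)).
Proof. by apply: (flip_ends hw_span_closed); [apply: hw_span_zl|apply: hw_span_zr|apply: flip_z]. Qed.

Lemma w_flip_ends s l k :
  hw_span (v l * wm s * w k - q%:C ^+ (size s).+1 *: (w l * wm s * v k)).
Proof.
by apply: (flip_ends hw_span_closed (x := fun l => w l) (y := fun l => v l));
  [apply: hw_span_wl|apply: hw_span_wr|apply: flip_w].
Qed.

(** [E_flip] applies because the minors that measure the failure of the flip are themselves letters
    w, hence negligible. *)
Lemma E2_flip k s : hw_span (zm (k :: s) <<| gE q i2 - (flip_coef q (size s))%:C *: (u q o1 k * zm s)).
Proof.
rewrite -[(flip_coef _ _)%:C]mul1r zmn_cons.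
exact: (E_flip (x := u q o2) (y := u q o1) (E := fun x => x <<| gE q i2) hq0
  hw_span_closed hw_span_zl hw_span_zr flip_z (unit_act_E _) E2_rcons).
Qed.

Lemma E1_flip k s :
  hw_span (wm (k :: s) <<| gE q i1 - (- q%:C * (flip_coef q (size s))%:C) *: (v k * wm s)).
Proof.
rewrite wmn_cons.
exact: (E_flip (x := fun l => w l) (y := fun l => v l) (E := fun x => x <<| gE q i1) hq0
  hw_span_closed hw_span_wl hw_span_wr flip_w (unit_act_E _) E1_rcons).
Qed.

End Generation.

(** * Translates of the words in w and z span A(SU_q(3)) *)

Section GenerationTheorem.
Local Open Scope complex_scope.
Variables (R : realType) (q : R).
Hypotheses (hq0 : 0 < q).
Local Notation C := R[i].
Local Notation A := (SUq3 q).
Variables (U : Uq_hopf q) (act : right_action U).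
Local Notation "a <<| k" := (act a k) (at level 39, left associativity).
Local Notation zm := (zmn q).
Local Notation wm := (wmn q).
Local Notation w l := (star (u q o0 l)).
Local Notation v l := (star (u q o1 l)).
Local Notation t l := (star (u q o2 l)).
Local Notation hw_gen := (hw_gen act).

Let clH := @hw_span_closed R q.
Let clG := hw_gen_closed act.

(** E_2 kills words in w and K_2^-1 fixes them, so the Leibniz rule lets E_2 pass to the right
    factor. *)
Lemma hw_gen_wm_E2 r y : hw_gen (wm r * y) -> hw_gen (wm r * (y <<| gE q i2)).
Proof.
move=> h; have := hw_gen_act (gE q i2) h.
by rewrite act_mulE wmn_E2 // wmn_KV2 // mul0r add0r.
Qed.

Lemma hw_gen_zm_E1 x s : hw_gen (x * zm s) -> hw_gen ((x <<| gE q i1) * zm s).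
Proof.
move=> h; have := hw_gen_act (gE q i1) h.
by rewrite act_mulE zmn_E1 // zmn_K1 // mulr0 addr0.
Qed.

Lemma real_neq0 (d : R) : 0 < d -> (d%:C : C) != 0.
Proof. by move=> d0; rewrite fmorph_eq0 gt_eqF. Qed.

Lemma hw_span_wml r x : hw_span x -> hw_span (wm r * x).
Proof. by apply: mull_mon => *; apply: hw_span_wl. Qed.

Lemma hw_span_zmr s x : hw_span x -> hw_span (x * zm s).
Proof. by apply: mulr_mon => *; apply: hw_span_zr. Qed.

(** The word with z_k in place of u^2_k is raised by E_2. Modulo words in w and z this puts a letter
    u^2 in front, and a flip carries it to the last place. *)
Lemma hw_gen_u1 r s k : hw_gen (wm r * zm s * u q o1 k).
Proof.
case: s => [|a s].
  rewrite zmn_nil mulr1.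
  have := @hw_gen_wm_E2 r (zm [:: k]) (hw_gen_span act (hw_span_mon q r [:: k])).
  by rewrite -zmn1 act_u_E !ilohi eqxx.
pose d := flip_coef q (size s).+1.
have e1 := E2_flip hq0 act a (rcons s k).
have e2 := z_flip_ends hq0 s a k.
rewrite zmn_rcons -rcons_cons zmn_rcons size_rcons -/d !mulrA in e1.
have G : hw_gen (wm r * ((zm (a :: s) * u q o2 k) <<| gE q i2)).
  apply: hw_gen_wm_E2; rewrite -zmn_rcons.
  by apply: hw_gen_span; apply: hw_span_mon.
have c0 : (d%:C * q%:C ^+ (size s).+1 : C) != 0.
  apply: mulf_neq0; last by rewrite expf_neq0 // qC_neq0.
  by apply: real_neq0; apply: flip_coef_gt0.
apply: (lin_closedZl clG c0).
rewrite zmn_cons -mulrA.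
have -> : (d%:C * q%:C ^+ (size s).+1) *: (wm r * (u q o2 a * zm s * u q o1 k)) =
  wm r * ((zm (a :: s) * u q o2 k) <<| gE q i2)
  - wm r * (((zm (a :: s) * u q o2 k) <<| gE q i2) - d%:C *: (u q o1 a * zm s * u q o2 k))
  - d%:C *: (wm r * (u q o1 a * zm s * u q o2 k - q%:C ^+ (size s).+1 *: (u q o2 a * zm s * u q o1 k))).
  rewrite !mulrBr opprB addrCA subrr addr0 scalerBr -!scalerAr scalerA.
  by rewrite opprB addrCA subrr addr0.
apply: (lin_closedB clG); first apply: (lin_closedB clG) => //.
  by apply: hw_gen_span; apply: hw_span_wml.
by apply: (lin_closedZ clG); apply: hw_gen_span; apply: hw_span_wml.
Qed.

Lemma hw_gen_span_u1 x k : hw_span x -> hw_gen (x * u q o1 k).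
Proof.
apply: (hw_span_mon_ind (P := fun x => hw_gen (x * u q o1 k))) => [|r s].
  exact/lin_closed_mulr/clG.
exact: hw_gen_u1.
Qed.

(** The two letters may exchange their columns. For this reason [u_zm_move] and [zm_u_move] assume
    the target for all columns and all words. *)
Lemma u_z_move (i k b : 'I_3) : (i < o2)%N -> exists c d : C,
  u q i k * u q o2 b = c *: (u q o2 b * u q i k) + d *: (u q o2 k * u q i b).
Proof.
move=> i2; case: (ltngtP k b) => kb.
- exists 1, (q - q^-1)%:C; rewrite scale1r.
  have /eqP := u_cross q i2 kb; rewrite subr_eq (u_comm q i2 kb) => /eqP ->.
  by rewrite addrC.
- by exists 1, 0; rewrite scale1r scale0r addr0 u_comm.
- exists q%:C, 0; rewrite scale0r addr0 (val_inj kb); exact: u_col.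
Qed.

Lemma z_u_move (i k b : 'I_3) : (i < o2)%N -> exists c d : C,
  u q o2 b * u q i k = c *: (u q i k * u q o2 b) + d *: (u q i b * u q o2 k).
Proof.
move=> i2; case: (ltngtP k b) => kb.
- exists 1, (- (q - q^-1)%:C); rewrite scale1r scaleNr.
  by have /eqP := u_cross q i2 kb; rewrite subr_eq addrC -subr_eq => /eqP ->.
- by exists 1, 0; rewrite scale1r scale0r addr0 (u_comm q i2 kb).
- exists (q%:C)^-1, 0; rewrite scale0r addr0 (val_inj kb) (u_col _ _ i2) scalerA.
  by rewrite mulVf ?qC_neq0 // scale1r.
Qed.

Lemma u_zm_move (P : A -> Prop) (i : 'I_3) : lin_closed P -> (i < o2)%N ->
  forall s k L, (forall s' a, P (L * zm s' * u q i a)) -> P (L * u q i k * zm s).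
Proof.
move=> clP i2; elim=> [|b s ih] k L hP.
  by have := hP [::] k; rewrite zmn_nil !mulr1.
rewrite zmn_cons !mulrA -[L * _ * _]mulrA.
have [c [d ->]] := u_z_move k b i2.
rewrite mulrDr -!scalerAr mulrDl -!scalerAl !mulrA.
by apply: (lin_closedD clP); apply: (lin_closedZ clP); apply: ih => s' a;
  rewrite -[L * _ * _]mulrA -zmn_cons.
Qed.

Lemma zm_u_move (P : A -> Prop) (i : 'I_3) : lin_closed P -> (i < o2)%N ->
  forall s k L, (forall s' a, P (L * u q i a * zm s')) -> P (L * zm s * u q i k).
Proof.
move=> clP i2 s k L hP.
suff H s' : P (L * zm s * u q i k * zm s').
  by have := H [::]; rewrite zmn_nil mulr1.
elim/last_ind: s s' k => [|s b ih] s' k.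
  by rewrite zmn_nil mulr1; apply: hP.
rewrite zmn_rcons !mulrA -[_ * u q o2 b * _]mulrA.
have [c [d ->]] := z_u_move k b i2.
rewrite mulrDr -!scalerAr mulrDl -!scalerAl !mulrA.
by apply: (lin_closedD clP); apply: (lin_closedZ clP);
  rewrite -[_ * u q o2 _ * _]mulrA -zmn_cons; apply: ih.
Qed.

Lemma o0_lt2 : (o0 < o2)%N. Proof. by rewrite val_o0 val_o2. Qed.
Lemma o1_lt2 : (o1 < o2)%N. Proof. by rewrite val_o1 val_o2. Qed.

Lemma hw_gen_u1_zm r s k : hw_gen (wm r * u q o1 k * zm s).
Proof. by apply: (u_zm_move clG o1_lt2) => s' a; apply: hw_gen_u1. Qed.

Lemma hw_gen_span_u1_zm x s k : hw_span x -> hw_gen (x * u q o1 k * zm s).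
Proof.
move=> hx; apply: (u_zm_move clG o1_lt2) => s' a.
by apply: hw_gen_span_u1; apply: hw_span_zmr.
Qed.

Lemma hw_gen_v_wm l r s : hw_gen (v l * wm r * zm s).
Proof.
pose c := - q%:C * (flip_coef q (size r))%:C : C.
have c0 : c != 0.
  apply: mulf_neq0; first by rewrite oppr_eq0 qC_neq0.
  by apply: real_neq0; apply: flip_coef_gt0.
apply: (lin_closedZl clG c0).
have -> : c *: (v l * wm r * zm s) = (wm (l :: r) <<| gE q i1) * zm s
   - ((wm (l :: r) <<| gE q i1) - c *: (v l * wm r)) * zm s.
  by rewrite mulrBl opprB addrCA subrr addr0 -scalerAl.
apply: (lin_closedB clG).
  by apply: hw_gen_zm_E1; apply: hw_gen_span; apply: hw_span_mon.
by apply: hw_gen_span; apply: hw_span_zmr; apply: E1_flip.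
Qed.

Lemma hw_gen_wm_v_wm r1 l r2 s : hw_gen (wm r1 * v l * wm r2 * zm s).
Proof.
case: r1 => [|a r1]; first by rewrite wmn_nil mul1r; apply: hw_gen_v_wm.
have c0 : (q%:C ^+ (size r1).+1 : C) != 0 by rewrite expf_neq0 ?qC_neq0.
apply: (lin_closedZl clG c0).
have -> : q%:C ^+ (size r1).+1 *: (wm (a :: r1) * v l * wm r2 * zm s) =
  v a * wm (r1 ++ l :: r2) * zm s -
  (v a * wm r1 * w l - q%:C ^+ (size r1).+1 *: (w a * wm r1 * v l)) * wm r2 * zm s.
  rewrite !mulrBl opprB wmn_cat !wmn_cons !mulrA addrCA subrr addr0.
  by rewrite -!scalerAl.
apply: (lin_closedB clG); first exact: hw_gen_v_wm.
apply: hw_gen_span; apply: hw_span_zmr; apply: mulr_mon => [*|]; first exact: hw_span_wr.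
exact: w_flip_ends.
Qed.

Lemma hw_gen_wm_v_span r l x : hw_span x -> hw_gen (wm r * v l * x).
Proof.
apply: (hw_span_mon_ind (P := fun x => hw_gen (wm r * v l * x))) => [|r' s].
  exact/lin_closed_mull/clG.
by rewrite mulrA; apply: hw_gen_wm_v_wm.
Qed.

(* The unitarity relation gives the sum of the three products w u0, v u1, t z; modulo
   generated elements each of them is a positive multiple of v u1, so all are generated. *)
Lemma contraction_rel1 r l k s : exists2 a : R, 0 < a &
  hw_gen (wm r * t l * u q o2 k * zm s - a%:C *: (wm r * v l * u q o1 k * zm s)).
Proof.
(* Absolute values of the coefficients of the two Leibniz terms of E_2 on [v l * zm (k :: s)]. The
   sign from the star makes the terms opposite, so the ratio in the relation is positive. *)
pose al := q * qhalf q (size s).+1; pose be := qhalf q (-1) * flip_coef q (size s).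
have al0 : 0 < al by rewrite mulr_gt0 ?qhalf_gt0.
have be0 : 0 < be by rewrite mulr_gt0 ?qhalf_gt0 ?flip_coef_gt0.
exists (be / al); first by rewrite divr_gt0.
have al_neq0 := real_neq0 al0.
have [e he Ee] : exists2 e, hw_span e &
    zm (k :: s) <<| gE q i2 = e + (flip_coef q (size s))%:C *: (u q o1 k * zm s).
  by eexists; [apply: (E2_flip hq0 act k s)|rewrite subrK].
have G : hw_gen (wm r * ((v l * zm (k :: s)) <<| gE q i2)).
  apply: hw_gen_wm_E2; rewrite mulrA.
  by apply: hw_gen_wm_v_span; apply: zmn_hw_span.
apply: (lin_closedZl clG al_neq0).
have -> : al%:C *: (wm r * t l * u q o2 k * zm s
      - (be / al)%:C *: (wm r * v l * u q o1 k * zm s)) =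
   qw q (-1) *: (wm r * v l * e) - wm r * ((v l * zm (k :: s)) <<| gE q i2).
  rewrite act_mulE zmn_K2 // act_su_KV // act_su_E // !ilohi eqxx kwE Ee.
  rewrite zmn_cons mulr_scale -[_ *: v l * _]scalerAl !mulrDr -!scalerAr !scalerDr.
  rewrite mulrDr -scalerAr scalerDr !scalerA !mulrA.
  rewrite !opprD addrCA [in RHS]addNKr -!scaleNr.
  congr (_ *: _ + _ *: _); first by rewrite mulNr opprK /al rmorphM.
  by rewrite mulrN1 mulNr -rmorphM mulrCA divff ?gt_eqF // mulr1 /be rmorphM.
apply: (lin_closedB clG) => //; apply: (lin_closedZ clG).
exact: hw_gen_wm_v_span.
Qed.

(** Dual to [contraction_rel1]: E_1 is applied to [wm (rcons r l) * u q o1 k], the minus sign now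
    coming from E_1 on a letter w. *)
Lemma contraction_rel2 r l k s : exists2 b : R, 0 < b &
  hw_gen (wm r * w l * u q o0 k * zm s - b%:C *: (wm r * v l * u q o1 k * zm s)).
Proof.
(* The power of q is the cost of carrying v from the front of the word, where [E1_flip] leaves it,
   to the last place. *)
pose f := flip_coef q (size r) * q ^+ size r.
have f0 : 0 < f by rewrite mulr_gt0 ?flip_coef_gt0 ?exprn_gt0.
have [e he Ee] : exists2 e, hw_span e &
    wm (rcons r l) <<| gE q i1 = e - (q * f)%:C *: (wm r * v l).
  case: r @f f0 => [|a r] f f0.
    exists 0; first exact: hw_span0.
    rewrite wmn_cons wmn_nil mulr1 act_su_E // !ilohi eqxx sub0r mul1r scaleNr.
    by rewrite /f /= expr0 !mulr1.
  have h1 := E1_flip hq0 act a (rcons r l).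
  have h2 := w_flip_ends hq0 r a l.
  eexists; first apply: (lin_closedB clH h1 (lin_closedZ clH (q * flip_coef q (size r).+1)%:C h2)).
  rewrite rcons_cons size_rcons !wmn_rcons !wmn_cons wmn_rcons /f /= !mulrA.
  rewrite scalerBr scalerA mulNr scaleNr opprK -rmorphM opprB addrA addrAC.
  rewrite [_ + _ - _ in RHS]addrAC /= addrK.
  by rewrite [X in _ - X *: _](rmorphM (real_complex R)) rmorphXn subrK.
pose al := qhalf q (- (size r).+1%:Z); pose be := q * f * qhalf q 1.
have al0 : 0 < al by rewrite qhalf_gt0.
have be0 : 0 < be by apply: mulr_gt0; [apply: mulr_gt0|apply: qhalf_gt0].
exists (be / al); first by rewrite divr_gt0.
have al_neq0 := real_neq0 al0.
have G : hw_gen ((wm (rcons r l) * u q o1 k) <<| gE q i1 * zm s).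
  by apply: hw_gen_zm_E1; apply: hw_gen_u1_zm.
apply: (lin_closedZl clG al_neq0).
have -> : al%:C *: (wm r * w l * u q o0 k * zm s
      - (be / al)%:C *: (wm r * v l * u q o1 k * zm s)) =
   (wm (rcons r l) * u q o1 k) <<| gE q i1 * zm s - qw q 1 *: (e * u q o1 k * zm s).
  rewrite act_mulE Ee wmn_KV1 // size_rcons act_u_K act_u_E !ilohi eqxx kwE wmn_rcons.
  rewrite !mulrDl !mulNr -?scalerAl -?scalerAr -?scalerAl -?scalerAr -?scalerAl scalerBr !scalerA.
  rewrite [RHS]addrAC [X in _ = X + _]addrAC subrr sub0r addrC.
  by rewrite -rmorphM mulrCA divff ?gt_eqF // mulr1 /be rmorphM.
apply: (lin_closedB clG) => //; apply: (lin_closedZ clG).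
exact: hw_gen_span_u1_zm.
Qed.

Lemma hw_gen_u0_zm r k s : hw_gen (wm r * u q o0 k * zm s).
Proof.
elim/last_ind: r => [|r l _].
  rewrite wmn_nil mul1r.
  have := hw_gen_act (gE q i1) (@hw_gen_u1_zm [::] s k).
  rewrite wmn_nil mul1r act_mulE zmn_K1 // zmn_E1 // mulr0 addr0 act_u_E !ilohi eqxx //.
rewrite wmn_rcons.
have [a a0 ha] := contraction_rel1 r l k s.
have [b b0 hb] := contraction_rel2 r l k s.
move: ha hb; set X1 := wm r * w l * _ * _; set X2 := wm r * v l * _ * _.
set X3 := wm r * _ * _ * _ => ha hb.
have hs : hw_gen (X1 + X2 + X3).
  have -> : X1 + X2 + X3 =
      wm r * (w l * u q o0 k + v l * u q o1 k + t l * u q o2 k) * zm s.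
    by rewrite !mulrDr !mulrDl !mulrA.
  rewrite star_u_mul_u //; case: (l == k).
    by rewrite mulr1; apply: hw_gen_span; apply: hw_span_mon.
  by rewrite mulr0 mul0r; apply: lin_closed0 clG.
have c0 : ((1 + a + b)%:C : C) != 0.
  by apply: real_neq0; rewrite addr_gt0 // addr_gt0.
have h2 : hw_gen X2.
  apply: (lin_closedZl clG c0).
  have -> : (1 + a + b)%:C *: X2 = X1 + X2 + X3 - (X3 - a%:C *: X2) - (X1 - b%:C *: X2).
    rewrite !rmorphD rmorph1 !scalerDl scale1r !opprB !addrA addrAC [X1 + X2 + X3]addrAC /=.
    rewrite -[X1 + X3 + X2 + _]addrA (addrC (X1 + X3)) !addrA !addrK //.
  by apply: (lin_closedB clG) => //; apply: (lin_closedB clG).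
by rewrite -(subrK (b%:C *: X2) X1); apply: (lin_closedD clG) => //; apply: (lin_closedZ clG).
Qed.

(** For a translate x <| g the Leibniz rule exchanges (x <| g) u for (x u) <| g and terms in which
    the generator acts on u; the induction on [g] therefore keeps [x] and the entry of u
    arbitrary. *)
Lemma hw_gen_mul_u x : hw_gen x -> forall j k, hw_gen (x * u q j k).
Proof.
elim=> {x} [x hx|c x y _ hx _ hy|x g _] j k.
- move: x hx; apply: (hw_span_mon_ind (P := fun x => hw_gen (x * u q j k))) => [|r s].
    exact/lin_closed_mulr/clG.
  case: (ord3_case j) => ->.
  + apply: (zm_u_move clG o0_lt2) => s' a; exact: hw_gen_u0_zm.
  + exact: hw_gen_u1.
  + by apply: hw_gen_span; rewrite -mulrA -zmn_rcons; apply: hw_span_mon.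
- by rewrite mulrDl -scalerAl; apply: hw_gen_lin.
- elim/Uq_ind: g x j k => [i|i|i|i||c g h hg hh|g h hg hh] x hx j k.
  + have := hw_gen_act (gK q i) (hx j k).
    by rewrite act_mulK act_u_K -scalerAr; apply: (lin_closedZl clG); apply: qw_neq0.
  + have := hw_gen_act (gKV q i) (hx j k).
    by rewrite act_mulKV act_u_KV // -scalerAr; apply: (lin_closedZl clG); apply: qw_neq0.
  + have hKV l m : hw_gen (x <<| gKV q i * u q l m).
      have := hw_gen_act (gKV q i) (hx l m).
      by rewrite act_mulKV act_u_KV // -scalerAr; apply: (lin_closedZl clG); apply: qw_neq0.
    have := hw_gen_act (gE q i) (hx j k).
    rewrite act_mulE act_u_K -scalerAr => h.
    apply: (lin_closedZl clG (qw_neq0 hq0 (kw i j))); apply: (lin_closedDl clG _ h).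
    by rewrite act_u_E; case: ifP => _ //; rewrite mulr0; apply: lin_closed0 clG.
  + have hKV l m : hw_gen (x <<| gKV q i * u q l m).
      have := hw_gen_act (gKV q i) (hx l m).
      by rewrite act_mulKV act_u_KV // -scalerAr; apply: (lin_closedZl clG); apply: qw_neq0.
    have := hw_gen_act (gF q i) (hx j k).
    rewrite act_mulF act_u_K -scalerAr => h.
    apply: (lin_closedZl clG (qw_neq0 hq0 (kw i j))); apply: (lin_closedDl clG _ h).
    by rewrite act_u_F; case: ifP => _ //; rewrite mulr0; apply: lin_closed0 clG.
  + by rewrite act_id.
  + by rewrite actDr actZr mulrDl -scalerAl; apply: hw_gen_lin; [apply: hg|apply: hh].
  + by rewrite act_comp; apply: hh => l m; apply: hg.
Qed.

Lemma hw_gen_all x : hw_gen x.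
Proof.
suff H : forall y, hw_gen y -> hw_gen (y * x).
  have := H 1; rewrite mul1r; apply; apply: hw_gen_span.
  by rewrite -(mulr1 1) -{1}wmn_nil -zmn_nil; apply: hw_span_mon.
elim/SUq3_ind: x => [j k|| c a b ha hb|a b ha hb] y hy.
- exact: hw_gen_mul_u.
- by rewrite mulr1.
- by rewrite mulrDr -scalerAr; apply: hw_gen_lin; [apply: ha|apply: hb].
- by rewrite mulrA; apply/hb/ha.
Qed.

End GenerationTheorem.

(** * Highest weight modules *)

Section HighestWeightModule.
Variables (K : fieldType) (V : lmodType K).
Variables (e f k kv : 'I_2 -> V -> V) (c : K) (a b : 'I_2 -> 'I_2 -> K) (th : K).
Hypotheses (e_lin : forall i, linear (e i)) (f_lin : forall i, linear (f i))
  (k_lin : forall i, linear (k i)) (kv_lin : forall i, linear (kv i)).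
Hypothesis ef_neq : forall i j x, i != j -> e i (f j x) = f j (e i x).
Hypothesis ef_eq : forall i x, e i (f i x) = f i (e i x) + c *: (k i (k i x) - kv i (kv i x)).
Hypothesis kf : forall i j x, k i (f j x) = a i j *: f j (k i x).
Hypothesis kvf : forall i j x, kv i (f j x) = b i j *: f j (kv i x).
Hypothesis a_th : forall j, a i1 j * a i2 j = th.
Hypothesis th_pow : forall m, (0 < m)%N -> th ^+ m != 1.
Variables (v : V) (la lb : 'I_2 -> K).
Hypotheses (ev : forall i, e i v = 0) (kv_v : forall i, k i v = la i *: v)
  (kvv : forall i, kv i v = lb i *: v).
Hypothesis la_neq0 : forall i, la i != 0.
Hypothesis th_neq0 : th != 0.

(** Images of v under words of length m in the f_i, closed under combinations. The operators are
    abstract because the section is applied twice: with e = E, f = F to column vectors of a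
    representation, and with e = F, f = E to right modules. *)
Inductive fword : nat -> V -> Prop :=
| fword0 x : fword 0 (x *: v)
| fwordS m i x : fword m x -> fword m.+1 (f i x)
| fword_lin m x y z : fword m y -> fword m z -> fword m (x *: y + z).

Lemma fword_zero m : fword m 0.
Proof.
elim: m => [|m ih]; first by rewrite -(scale0r v); apply: fword0.
by have [<- _ _ _ _] := linear_of_morph (f_lin i1); apply: fwordS.
Qed.

Lemma fword_closed m : lin_closed (fword m).
Proof. by split; [apply: fword_zero|apply: fword_lin]. Qed.

Lemma fword0P x : fword 0 x -> exists y, x = y *: v.
Proof.
suff H m y : fword m y -> m = 0%N -> exists z, y = z *: v by move=> /H; apply.
elim=> {m y} [y _|m i y _ _ //|m y z t _ hz _ ht m0]; first by exists y.
have [z' ->] := hz m0; have [t' ->] := ht m0.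
by exists (y * z' + t'); rewrite scalerA scalerDl.
Qed.

Lemma fword_k m x i : fword m x -> fword m (k i x).
Proof.
elim=> {m x} [x|m j x _ h|m x y z _ hy _ hz].
- have [_ _ -> _ _] := linear_of_morph (k_lin i).
  by rewrite kv_v scalerA; apply: fword0.
- by rewrite kf; apply: (lin_closedZ (fword_closed _)); apply: fwordS.
- by rewrite k_lin; apply: fword_lin.
Qed.

Lemma fword_kv m x i : fword m x -> fword m (kv i x).
Proof.
elim=> {m x} [x|m j x _ h|m x y z _ hy _ hz].
- have [_ _ -> _ _] := linear_of_morph (kv_lin i).
  by rewrite kvv scalerA; apply: fword0.
- by rewrite kvf; apply: (lin_closedZ (fword_closed _)); apply: fwordS.
- by rewrite kv_lin; apply: fword_lin.
Qed.

Lemma fword_e m x i : fword m x -> if m is m'.+1 then fword m' (e i x) else e i x = 0.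
Proof.
have [e0 _ eZ _ _] := linear_of_morph (e_lin i).
elim=> {m x} [x|m j x h he|[|m] x y z _ hy _ hz].
- by rewrite eZ ev scaler0.
- have hf : fword m (f j (e i x)).
    case: m h he => [|m] h he; last exact: fwordS.
    by have [f0 _ _ _ _] := linear_of_morph (f_lin j); rewrite he f0; apply: fword_zero.
  have [ij|/eqP ij] := eqVneq i j; last by rewrite ef_neq //; apply/eqP.
  rewrite -ij in hf *; rewrite ef_eq; apply: (lin_closedD (fword_closed _)) => //.
  apply: (lin_closedZ (fword_closed _)); apply: (lin_closedB (fword_closed _)).
    by do 2!apply: fword_k.
  by do 2!apply: fword_kv.
- by rewrite e_lin hy hz scaler0 addr0.
- by rewrite e_lin; apply: fword_lin.
Qed.

Definition kt x := k i1 (k i2 x).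
Definition ktw (m : nat) : K := la i1 * la i2 * th ^+ m.

Lemma kt_lin : linear kt.
Proof. by move=> x y z; rewrite /kt !k_lin. Qed.

Lemma fword_kt m x : fword m x -> kt x = ktw m *: x.
Proof.
have [_ _ kZ1 _ _] := linear_of_morph (k_lin i1).
have [_ _ kZ2 _ _] := linear_of_morph (k_lin i2).
have [_ _ fZ1 _ _] := linear_of_morph (f_lin i1).
elim=> {m x} [x|m j x _ h|m x y z _ hy _ hz].
- by rewrite /kt kZ2 kZ1 !kv_v kZ1 kv_v !scalerA /ktw; congr (_ *: _); ring.
- have [_ _ fZ _ _] := linear_of_morph (f_lin j).
  rewrite /kt kf kZ1 kf scalerA [a i2 j * _]mulrC a_th -/(kt x) h fZ scalerA.
  by rewrite /ktw exprS mulrCA mulrA.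
- by rewrite kt_lin hy hz !scalerDr !scalerA mulrC.
Qed.

(** Product of the [kt - ktw j] for j from 1 to M. It kills the words of length 1 to M and rescales
    v by a nonzero factor, so on [fspan M] it is, up to a scalar, the projection onto the line of v,
    and it is a polynomial in k_1 k_2. *)
Fixpoint wproj (M : nat) (x : V) : V :=
  if M is M'.+1 then kt (wproj M' x) - ktw M *: wproj M' x else x.

Lemma wproj_lin M : linear (wproj M).
Proof.
elim: M => [|M ih] x y z //=.
rewrite ih kt_lin scalerDr opprD addrACA; congr (_ + _).
by rewrite scalerBr !scalerA mulrC.
Qed.

Lemma fword_wproj m M x : fword m x ->
  wproj M x = (\prod_(1 <= j < M.+1) (ktw m - ktw j)) *: x.
Proof.
move=> h; elim: M => [|M ih]; first by rewrite big_nil scale1r.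
have [_ _ kZ _ _] := linear_of_morph kt_lin.
rewrite /= ih kZ (fword_kt h) [in RHS]big_nat_recr //= !scalerA -scalerBl.
by rewrite mulrBr [ktw M.+1 * _]mulrC.
Qed.

Lemma fword_wproj0 m M x : fword m x -> (0 < m <= M)%N -> wproj M x = 0.
Proof.
move=> h /andP[m0 mM]; rewrite (fword_wproj M h) (bigD1_seq m) ?iota_uniq //=.
  by rewrite subrr mul0r scale0r.
by rewrite mem_index_iota m0 ltnS.
Qed.

Lemma wproj_v_neq0 M : exists2 x, x != 0 & wproj M v = x *: v.
Proof.
have hv : fword 0 v by rewrite -[v]scale1r; apply: fword0.
eexists; last exact: fword_wproj hv.
rewrite prodf_seq_neq0; apply/allP => j; rewrite mem_index_iota => /andP[j0 _].
apply/implyP => _; rewrite /ktw -mulrBr !mulf_neq0 // expr0 subr_eq0 eq_sym.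
exact: th_pow.
Qed.

Inductive fspan (M : nat) : V -> Prop :=
| fspan_word m x : (m <= M)%N -> fword m x -> fspan M x
| fspan_lin x y z : fspan M y -> fspan M z -> fspan M (x *: y + z).

Lemma fspan_closed M : lin_closed (fspan M).
Proof.
by split; [apply: (@fspan_word _ 0) => //; apply: fword_zero|apply: fspan_lin].
Qed.

Lemma fspan_le M M' x : (M <= M')%N -> fspan M x -> fspan M' x.
Proof.
move=> MM'; elim=> {x} [m x mM h|x y z _ hy _ hz]; last exact: fspan_lin.
by apply: fspan_word h; apply: leq_trans MM'.
Qed.

Lemma fspan_f M x i : fspan M x -> fspan M.+1 (f i x).
Proof.
elim=> {x} [m x mM h|x y z _ hy _ hz]; last by rewrite f_lin; apply: fspan_lin.
by apply: (@fspan_word _ m.+1) => //; apply: fwordS.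
Qed.

Lemma fspan_e M x i : fspan M x -> fspan M (e i x).
Proof.
elim=> {x} [m x mM h|x y z _ hy _ hz]; last by rewrite e_lin; apply: fspan_lin.
have := fword_e i h; case: m mM h => [|m] mM h; last by apply: fspan_word; apply: ltnW.
by move=> ->; apply: lin_closed0 (fspan_closed M).
Qed.

Lemma fspan_k M x i : fspan M x -> fspan M (k i x).
Proof.
elim=> {x} [m x mM h|x y z _ hy _ hz]; last by rewrite k_lin; apply: fspan_lin.
by apply: fspan_word mM _; apply: fword_k.
Qed.

Lemma fspan_kv M x i : fspan M x -> fspan M (kv i x).
Proof.
elim=> {x} [m x mM h|x y z _ hy _ hz]; last by rewrite kv_lin; apply: fspan_lin.
by apply: fspan_word mM _; apply: fword_kv.
Qed.

Lemma fspan_v M : fspan M v.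
Proof. by apply: (@fspan_word _ 0) => //; rewrite -[v]scale1r; apply: fword0. Qed.

Lemma fspan_wproj M x : fspan M x -> exists y, wproj M x = y *: v.
Proof.
elim=> {x} [[|m] x mM h|x y z _ [y' hy] _ [z' hz]].
- by have [y ->] := fword0P h; have [_ _ wZ _ _] := linear_of_morph (wproj_lin M);
    have [d _ dE] := wproj_v_neq0 M; exists (y * d); rewrite wZ dE scalerA.
- by exists 0; rewrite scale0r; apply: fword_wproj0 h _.
- by exists (x * y' + z'); rewrite wproj_lin hy hz scalerA scalerDl.
Qed.

Lemma fspan_wproj_f M x i : fspan M x -> wproj M.+1 (f i x) = 0.
Proof.
elim=> {x} [m x mM h|x y z _ hy _ hz].
  by apply: (@fword_wproj0 m.+1) => //; apply: fwordS.
by rewrite f_lin wproj_lin hy hz scaler0 addr0.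
Qed.

Lemma fspan_wproj_k M x i : fspan M x -> wproj M (k i x) = la i *: wproj M x.
Proof.
have [_ _ wZ _ _] := linear_of_morph (wproj_lin M).
have [_ _ kZ _ _] := linear_of_morph (k_lin i).
elim=> {x} [[|m] x mM h|x y z _ hy _ hz].
- have [y ->] := fword0P h.
  by rewrite kZ kv_v !wZ !scalerA mulrC.
- by rewrite !(@fword_wproj0 m.+1) ?scaler0 //; apply: fword_k.
- by rewrite k_lin !wproj_lin hy hz scalerDr !scalerA mulrC.
Qed.

Lemma fspan_elim (P : V -> Prop) : lin_closed P -> P v -> (forall x i, P (f i x)) ->
  forall M x, fspan M x -> P x.
Proof.
move=> clP Pv Pf M x; elim=> {x} [m x _|x y z _ hy _ hz]; last by case: clP => _; apply.
elim=> {m x} [x|m i x _ _|m x y z _ hy _ hz] //.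
  exact: lin_closedZ.
by case: clP => _; apply.
Qed.

End HighestWeightModule.

(** * Subspaces of finite spans *)

Section FiniteDimension.
Variables (K : fieldType) (V : lmodType K).

Definition lcomb n (e : 'I_n -> V) (c : 'rV[K]_n) : V := \sum_i c 0 i *: e i.

Lemma lcomb_lin n (e : 'I_n -> V) : linear (lcomb e).
Proof.
move=> x c d; rewrite /lcomb scaler_sumr -big_split; apply: eq_bigr => i _ /=.
by rewrite !mxE scalerA scalerDl.
Qed.

Lemma lcomb_mul n m (s : 'I_n -> V) (B : 'M[K]_(m, n)) c :
  lcomb (fun i => lcomb s (row i B)) c = lcomb s (c *m B).
Proof.
rewrite /lcomb; under eq_bigr => i _ do rewrite scaler_sumr.
rewrite exchange_big; apply: eq_bigr => j _ /=.
by rewrite mxE scaler_suml; apply: eq_bigr => i _; rewrite !mxE scalerA.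
Qed.

Lemma lin_closed_lcomb n (e : 'I_n -> V) (P : V -> Prop) :
  lin_closed P -> (forall i, P (e i)) -> forall c, P (lcomb e c).
Proof.
move=> clP he c; apply: (lin_closed_sum clP) => i _; exact: (lin_closedZ clP).
Qed.

(** Despite the abbreviation, this is linear independence. *)
Definition lindep n (e : 'I_n -> V) := forall c, lcomb e c = 0 -> c = 0.

(** A rank argument bounds the length of independent families in [P] by n; one of maximal length
    spans. *)
Lemma subspace_basis (P : V -> Prop) n (s : 'I_n -> V) : lin_closed P ->
  (forall x, P x -> exists c, x = lcomb s c) ->
  exists d (e : 'I_d -> V), [/\ forall i, P (e i), lindep e &
    forall x, P x -> exists c, x = lcomb e c].
Proof.
move=> clP hs.
pose good m := `[< exists e : 'I_m -> V, (forall i, P (e i)) /\ lindep e >].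
have g0 : exists m, good m.
  exists 0%N; apply/asboolP; exists (fun i => 0); split=> [[]|c _] //.
  by apply/rowP => -[].
have bound m : good m -> (m <= n)%N.
  move=> /asboolP[e [he ie]].
  have [C0 hC] := choice (fun i => hs _ (he i)).
  pose B := \matrix_i C0 i.
  have eB c : lcomb e c = lcomb s (c *m B).
    rewrite -lcomb_mul; apply: eq_bigr => i _; by rewrite hC rowK.
  have : row_free B.
    rewrite -kermx_eq0; apply/eqP/row_matrixP => i; rewrite row0.
    by apply: ie; rewrite eB -row_mul mulmx_ker row0; have [-> _ _ _ _] := linear_of_morph (lcomb_lin s).
  by move=> /eqP <-; apply: rank_leq_col.
case: (ex_maxnP g0 bound) => d /asboolP[e [he ie]] dmax.
exists d, e; split=> // x Px.
apply: contrapT => nx.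
suff : good d.+1 by move=> /dmax; rewrite ltnn.
apply/asboolP; exists (fun i => if unlift ord0 i is Some j then e j else x); split.
  by move=> i; case: (unlift _ _).
move=> c; rewrite /lcomb big_ord_recl /= unlift_none.
under eq_bigr => i _ do rewrite liftK.
move=> c0.
have cc : c 0 ord0 = 0.
  apply/eqP/negPn/negP => cn0; apply: nx.
  exists (\row_i (- (c 0 ord0)^-1 * c 0 (lift ord0 i))).
  move/eqP: c0; rewrite addr_eq0 => /eqP /(congr1 (fun y => (c 0 ord0)^-1 *: y)).
  rewrite scalerA mulVf // scale1r => ->; rewrite scalerN scaler_sumr -sumrN.
  by apply: eq_bigr => i _; rewrite mxE scalerA mulNr scaleNr.
have cr : \row_i c 0 (lift ord0 i) = 0.
  apply: ie; rewrite -[RHS]c0 cc scale0r add0r.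
  by apply: eq_bigr => i _; rewrite mxE.
apply/rowP => i; rewrite mxE; case: (unliftP ord0 i) => [j|] -> //.
by have := congr1 (fun r : 'rV_d => r 0 j) cr; rewrite !mxE.
Qed.

End FiniteDimension.

Lemma lin_closed_full (K : fieldType) d (P : 'cV[K]_d -> Prop) : lin_closed P ->
  (forall r : 'rV_d, (forall x, P x -> r *m x = 0) -> r = 0) -> forall x, P x.
Proof.
move=> clP full.
have [|m [e [he _ span]]] := @subspace_basis K _ P d (fun i => delta_mx i 0) clP _.
  move=> x _; exists x^T; rewrite /lcomb [LHS]matrix_sum_delta.
  by apply: eq_bigr => i _; rewrite big_ord1 mxE.
pose B := \matrix_(i, j) e j i 0.
have eB c : lcomb e c = B *m c^T.
  apply/colP => i; rewrite /lcomb summxE mxE; apply: eq_bigr => j _.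
  by rewrite !mxE mulrC.
have : row_free B.
  rewrite -kermx_eq0; apply/eqP/row_matrixP => i; rewrite row0.
  apply: full => x /span[c ->]; rewrite eB mulmxA -row_mul mulmx_ker row0 mul0mx //.
move=> /row_freeP[B' BB'] x.
have -> : x = lcomb e (B' *m x)^T by rewrite eB trmxK mulmxA BB' mul1mx.
exact: lin_closed_lcomb.
Qed.

(** * Weights in U_q(su(3)) and modules with a highest weight vector *)

Section UqRelations.
Local Open Scope complex_scope.
Variables (R : realType) (q : R).
Hypotheses (hq0 : 0 < q) (hq1 : q < 1).
Local Notation C := R[i].

(** This is q^(-a_ij/2), where a is the Cartan matrix of sl(3). *)
Definition KE_coef (i j : 'I_2) : C := qw q (if i == j then - 2%:Z else 1).

Lemma KE_coef_neq0 i j : KE_coef i j != 0. Proof. exact: qw_neq0. Qed.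

Lemma gE_gK i j : gE q j * gK q i = KE_coef i j *: (gK q i * gE q j).
Proof.
have [_ _ _ _ _ hs _ hn _ _] := Uq_genP q; rewrite /KE_coef.
have [<-|ij] := eqVneq i j.
  have -> : gK q i * gE q i = q%:C *: (gE q i * gK q i) := hs i.
  by rewrite qwN // qw2 // scalerA mulVf ?qC_neq0 // scale1r.
have -> : gK q i * gE q j = qw q (-1) *: (gE q j * gK q i) := hn i j ij.
by rewrite scalerA -qwD // subrr qw0 // scale1r.
Qed.

Lemma gE_gKV i j : gE q j * gKV q i = (KE_coef i j)^-1 *: (gKV q i * gE q j).
Proof.
rewrite -[LHS]mul1r -(gKV_gK q i) !mulrA -[gKV q i * _ * _]mulrA.
have -> : gK q i * gE q j = (KE_coef i j)^-1 *: (gE q j * gK q i).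
  by rewrite gE_gK scalerA mulVf ?KE_coef_neq0 // scale1r.
by rewrite -scalerAr -scalerAl -!mulrA gK_gKV mulr1.
Qed.

Lemma conj_KE_coef i j : Num.conj (KE_coef i j) = KE_coef i j.
Proof. exact: conj_qw. Qed.

Lemma gK_gF i j : gK q i * gF q j = KE_coef i j *: (gF q j * gK q i).
Proof.
have := congr1 star (gE_gK i j).
by rewrite starZ !starM star_gE star_gK /= conj_KE_coef.
Qed.

Lemma gKV_gF i j : gKV q i * gF q j = (KE_coef i j)^-1 *: (gF q j * gKV q i).
Proof.
have := congr1 star (gE_gKV i j).
by rewrite starZ !starM star_gE star_gKV fmorphV /= conj_KE_coef.
Qed.

Lemma gE_gF_neq i j : i != j -> gE q i * gF q j = gF q j * gE q i.
Proof. by have [_ _ _ _ _ _ _ _ h _] := Uq_genP q; apply: h. Qed.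

Definition EF_coef : C := ((q - q^-1)^-1)%:C.

Lemma gE_gF i : gE q i * gF q i =
  gF q i * gE q i + EF_coef *: (gK q i * gK q i - gKV q i * gKV q i).
Proof.
have [_ _ _ _ _ _ h _ _ _] := Uq_genP q.
by apply/eqP; rewrite addrC -subr_eq; apply/eqP; apply: h.
Qed.

(** Each column of the Cartan matrix sums to 1, so K_1 K_2 detects word length whatever the letters
    are; this is the constant [th] of the abstract section. *)
Lemma KE_coef_sum j : KE_coef i1 j * KE_coef i2 j = qw q (-1).
Proof. by rewrite /KE_coef; case: (ord2_case j) => ->; rewrite -qwD. Qed.

Lemma qwN1_pow m : (0 < m)%N -> qw q (-1) ^+ m != 1.
Proof.
move=> m0; rewrite qwN // exprVn invr_eq1 /qw /qhalf expr1z -rmorphXn.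
rewrite -(rmorph1 (real_complex R)) (inj_eq (fmorph_inj _)) lt_eqF //.
rewrite exprn_ilt1 ?sqrtr_ge0 -?lt0n // -[ltRHS]sqrtr1 ltr_sqrt //.
Qed.

Lemma qw_inj m n : qw q m = qw q n -> m = n.
Proof.
move=> e; have e1 : qw q (m - n) = 1 by rewrite qwD // qwN // e divff ?qw_neq0.
have {e1} : (m - n = 0)%R.
  case: (m - n) e1 => [[|k]|k] // e1; exfalso.
    have := @qwN1_pow k.+1 isT; rewrite qwN // exprVn.
    have -> : qw q 1 ^+ k.+1 = 1 by rewrite -s2E s2XE.
    by rewrite invr1 eqxx.
  have := @qwN1_pow k.+1 isT; rewrite qwN // exprVn -s2E s2XE // -qwN // -NegzE e1 eqxx //.
by move/eqP; rewrite subr_eq0 => /eqP.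
Qed.

End UqRelations.

Section HwModules.
Local Open Scope complex_scope.
Variables (R : realType) (q : R).
Hypotheses (hq0 : 0 < q) (hq1 : q < 1).
Local Notation C := R[i].
Local Notation UU := (Uq q).

Definition lw (n1 n2 : nat) (i : 'I_2) : C := qw q (nth_weight n1 n2 i)%:Z.

Lemma lw_neq0 n1 n2 i : lw n1 n2 i != 0. Proof. exact: qw_neq0. Qed.

Section Right.
Variables (V : lmodType C) (r : V -> UU -> V).
Hypotheses (r_linl : forall k, linear (r^~ k)) (r_linr : forall x, linear (r x)).
Hypotheses (r1 : forall x, r x 1 = x) (rM : forall x g h, r x (g * h) = r (r x g) h).
Variables (n1 n2 : nat) (v : V).
Hypotheses (rF : forall i, r v (gF q i) = 0) (rK : forall i, r v (gK q i) = lw n1 n2 i *: v).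

Let rD x g h : r x (g + h) = r x g + r x h.
Proof. by have [_ e _ _ _] := linear_of_morph (r_linr x); rewrite e. Qed.
Let rB x g h : r x (g - h) = r x g - r x h.
Proof. by have [_ e _ e' _] := linear_of_morph (r_linr x); rewrite e e'. Qed.
Let rZ x c h : r x (c *: h) = c *: r x h.
Proof. by have [_ _ e _ _] := linear_of_morph (r_linr x); rewrite e. Qed.

Lemma right_KV i : r v (gKV q i) = (lw n1 n2 i)^-1 *: v.
Proof.
have [_ _ e _ _] := linear_of_morph (r_linl (gKV q i)).
by rewrite -[in RHS](r1 v) -(gK_gKV q i) rM rK e scalerA mulVf ?lw_neq0 // scale1r.
Qed.

Let P M := fspan (fun i x => r x (gE q i)) v M.

(** In a right module [r x (gE * gF)] applies E first, so F_i plays the role of e and E_i that of f,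
    with the same structure constants. *)
Lemma right_fspan k : exists M, P M (r v k).
Proof.
suff H : forall k x, (exists M, P M x) -> exists M, P M (r x k).
  by apply: H; exists 0%N; apply: fspan_v.
have ef_neq i j x : i != j ->
    r (r x (gE q j)) (gF q i) = r (r x (gF q i)) (gE q j).
  by move=> ij; rewrite -!rM gE_gF_neq // eq_sym.
have ef_eq i x : r (r x (gE q i)) (gF q i) = r (r x (gF q i)) (gE q i)
     + EF_coef q *: (r (r x (gK q i)) (gK q i) - r (r x (gKV q i)) (gKV q i)).
  by rewrite -!rM gE_gF rD rZ rB.
have kf i j x : r (r x (gE q j)) (gK q i) = KE_coef q i j *: r (r x (gK q i)) (gE q j).
  by rewrite -!rM gE_gK // rZ.
have kvf i j x : r (r x (gE q j)) (gKV q i) = (KE_coef q i j)^-1 *: r (r x (gKV q i)) (gE q j).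
  by rewrite -!rM gE_gKV // rZ.
elim/Uq_ind => [i|i|i|i||c g h hg hh|g h hg hh] x [M hx].
- by exists M; apply: (fspan_k (fun i => r_linl (gE q i)) (fun i => r_linl (gK q i)) kf rK).
- by exists M; apply: (fspan_kv (fun i => r_linl (gE q i)) (fun i => r_linl (gKV q i)) kvf right_KV).
- by exists M.+1; apply: (fspan_f (f := fun i x => r x (gE q i)) (fun i => r_linl (gE q i))).
- exists M.
  exact: (fspan_e (fun i => r_linl (gF q i)) (fun i => r_linl (gE q i))
    (fun i => r_linl (gK q i)) (fun i => r_linl (gKV q i)) ef_neq ef_eq kf kvf rF rK right_KV).
- by exists M; rewrite r1.
- have [Mg hg'] := hg x (ex_intro _ M hx); have [Mh hh'] := hh x (ex_intro _ M hx).
  exists (maxn Mg Mh); rewrite rD rZ; apply: fspan_lin.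
    exact: fspan_le (leq_maxl _ _) hg'.
  exact: fspan_le (leq_maxr _ _) hh'.
- by rewrite rM; apply: hh; apply: hg; exists M.
Qed.

Lemma right_hw_elim (Q : V -> Prop) : lin_closed Q -> Q v ->
  (forall x i, Q (r x (gE q i))) -> forall k, Q (r v k).
Proof.
move=> clQ Qv QE k; have [M hM] := right_fspan k.
exact: (fspan_elim clQ Qv QE hM).
Qed.

End Right.

Section Left.
Variables (d : nat) (rho : UU -> 'M[C]_d) (hrho : is_rep rho).
Variables (n1 n2 : nat) (v : 'cV[C]_d).
Hypotheses (rE : forall i, rho (gE q i) *m v = 0)
  (rK : forall i, rho (gK q i) *m v = lw n1 n2 i *: v).
Hypothesis v0 : v != 0.
Hypothesis cyclic : forall r : 'rV_d, (forall k, r *m rho k *m v = 0) -> r = 0.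

Lemma repD g h : rho (g + h) = rho g + rho h.
Proof. by have [_ e _ _ _] := linear_of_morph (rep_lin hrho); rewrite e. Qed.
Lemma repZ c h : rho (c *: h) = c *: rho h.
Proof. by have [_ _ e _ _] := linear_of_morph (rep_lin hrho); rewrite e. Qed.
Lemma repN h : rho (- h) = - rho h.
Proof. by have [_ _ _ e _] := linear_of_morph (rep_lin hrho); rewrite e. Qed.

Let mul_lin (B : 'M[C]_d) : linear (mulmx B : 'cV_d -> 'cV_d).
Proof. by move=> c x y; rewrite mulmxDr -scalemxAr. Qed.

Let f i (x : 'cV[C]_d) := rho (gF q i) *m x.
Let e i (x : 'cV[C]_d) := rho (gE q i) *m x.
Let k i (x : 'cV[C]_d) := rho (gK q i) *m x.
Let kv i (x : 'cV[C]_d) := rho (gKV q i) *m x.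

Let rKV i : kv i v = (lw n1 n2 i)^-1 *: v.
Proof.
rewrite /kv -[v in RHS]mul1mx -(rep1 hrho) -(gKV_gK q i) (repM hrho) -mulmxA rK.
by rewrite -scalemxAr scalerA mulVf ?lw_neq0 // scale1r.
Qed.

Let ef_neq i j x : i != j -> e i (f j x) = f j (e i x).
Proof. by move=> ij; rewrite /e /f !mulmxA -!(repM hrho) gE_gF_neq. Qed.
Let ef_eq i x : e i (f i x) = f i (e i x) + EF_coef q *: (k i (k i x) - kv i (kv i x)).
Proof.
rewrite /e /f /k /kv !mulmxA -!(repM hrho) gE_gF repD repZ repD repN.
by rewrite mulmxDl -scalemxAl mulmxBl.
Qed.
Let kf i j x : k i (f j x) = KE_coef q i j *: f j (k i x).
Proof. by rewrite /k /f !mulmxA -!(repM hrho) gK_gF // repZ scalemxAl. Qed.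
Let kvf i j x : kv i (f j x) = (KE_coef q i j)^-1 *: f j (kv i x).
Proof. by rewrite /kv /f !mulmxA -!(repM hrho) gKV_gF // repZ scalemxAl. Qed.

Let P M := fspan f v M.

Lemma left_fspan k0 : exists M, P M (rho k0 *m v).
Proof.
suff H : forall g x, (exists M, P M x) -> exists M, P M (rho g *m x).
  by apply: H; exists 0%N; apply: fspan_v.
elim/Uq_ind => [i|i|i|i||c g h hg hh|g h hg hh] x [M hx].
- by exists M; apply: (fspan_k (fun i => mul_lin _) (fun i => mul_lin _) kf rK).
- by exists M; apply: (fspan_kv (fun i => mul_lin _) (fun i => mul_lin _) kvf rKV).
- exists M.
  exact: (fspan_e (fun i => mul_lin _) (fun i => mul_lin _)
    (fun i => mul_lin _) (fun i => mul_lin _) ef_neq ef_eq kf kvf rE rK rKV).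
- by exists M.+1; apply: (fspan_f (f := f) (fun i => mul_lin _)).
- by exists M; rewrite (rep1 hrho) mul1mx.
- have [Mg hg'] := hg x (ex_intro _ M hx); have [Mh hh'] := hh x (ex_intro _ M hx).
  exists (maxn Mg Mh); rewrite repD repZ mulmxDl -scalemxAl; apply: fspan_lin.
    exact: fspan_le (leq_maxl _ _) hg'.
  exact: fspan_le (leq_maxr _ _) hh'.
- by rewrite (repM hrho) -mulmxA; apply: hg; apply: hh; exists M.
Qed.

Lemma left_fspan_all : exists M, forall x, P M x.
Proof.
have Hx x : exists M, P M x.
  apply: (lin_closed_full (P := fun x => exists M, P M x)) => [|r hr].
    split; first by exists 0%N; apply: lin_closed0 (fspan_closed (f := f) (fun i => mul_lin _) v _).
    move=> c y z [My hy] [Mz hz]; exists (maxn My Mz); apply: fspan_lin.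
      exact: fspan_le (leq_maxl _ _) hy.
    exact: fspan_le (leq_maxr _ _) hz.
  apply: cyclic => g; rewrite -mulmxA; apply: hr; exact: left_fspan.
have [Mf hM] := choice (fun i : 'I_d => Hx (delta_mx i 0)).
exists (\max_i Mf i)%N => x.
have -> : x = \sum_i x i 0 *: (delta_mx i 0 : 'cV_d).
  rewrite [LHS]matrix_sum_delta; apply: eq_bigr => i _; by rewrite big_ord1.
apply: (lin_closed_sum (fspan_closed (f := f) (fun i => mul_lin _) v _)) => i _.
apply: (lin_closedZ (fspan_closed (f := f) (fun i => mul_lin _) v _)).
by apply: fspan_le (hM i); apply: leq_bigmax.
Qed.

Let wpr := wproj k (qw q (-1)) (lw n1 n2).

Fixpoint wprojU (M : nat) : UU :=
  if M is M'.+1 then gK q i1 * gK q i2 * wprojU M'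
     - ktw (qw q (-1)) (lw n1 n2) M *: wprojU M' else 1.

Lemma wprojUE M x : rho (wprojU M) *m x = wpr M x.
Proof.
elim: M x => [|M ih] x /=; first by rewrite (rep1 hrho) mul1mx.
rewrite repD repN repZ !(repM hrho) mulmxBl -scalemxAl ih; congr (_ - _).
by rewrite /kt /k -!mulmxA ih.
Qed.

(** The separating polynomial in K_1 K_2 has the line of v as image, hence it is a rank-one matrix v
    l. Since it kills everything in the image of F_i, the row l is a highest weight vector for right
    multiplication. *)
Lemma rep_hw_projector : exists (p : UU) (l : 'rV[C]_d),
  [/\ rho p = v *m l, l *m v = 1%:M, forall i, l *m rho (gF q i) = 0 &
      forall i, l *m rho (gK q i) = lw n1 n2 i *: l].
Proof.
have [M hM] := left_fspan_all.
(* One factor more than the length bound, so that F_i x is also covered for every x. *)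
have hM' x : P M.+1 x by apply: fspan_le (hM x).
have klin i : linear (k i) by apply: mul_lin.
have flin i : linear (f i) by apply: mul_lin.
have [c c0 hc] := wproj_v_neq0 flin klin kf (KE_coef_sum hq0) (qwN1_pow hq0 hq1) rK
  (lw_neq0 n1 n2) M.+1.
have [y hy] := choice (fun x => fspan_wproj flin klin kf (KE_coef_sum hq0)
  (qwN1_pow hq0 hq1) rK (lw_neq0 n1 n2) (hM' x)).
pose l' := \row_j y (delta_mx j 0).
have v_inj (n : nat) (r : 'rV[C]_n) : v *m r = 0 -> r = 0.
  have [i vi] : exists i, v i 0 != 0.
    apply: contrapT => /forallNP h; case/eqP: v0; apply/colP => i.
    by rewrite mxE; apply/eqP; have /negP := h i; rewrite negbK.
  move=> /matrixP h; apply/rowP => j; have := h i j.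
  by rewrite !mxE big_ord1 => /eqP; rewrite mulf_eq0 (negbTE vi) /= => /eqP.
have E : rho (wprojU M.+1) = v *m l'.
  apply/matrixP => i j.
  have -> : rho (wprojU M.+1) i j = (rho (wprojU M.+1) *m (delta_mx j 0 : 'cV_d)) i 0.
    by rewrite -colE mxE.
  by rewrite wprojUE /wpr hy !mxE big_ord1 !mxE mulrC.
have ext n (A B : 'M[C]_(n, d)) : (forall x : 'cV_d, A *m x = B *m x) -> A = B.
  move=> h; apply/matrixP => i j.
  by have := congr1 (fun z : 'cV_n => z i 0) (h (delta_mx j 0)); rewrite -!colE !mxE.
have lF i : l' *m rho (gF q i) = 0.
  apply: v_inj; rewrite mulmxA -E; apply: ext => x.
  rewrite -mulmxA wprojUE mul0mx.
  exact: (fspan_wproj_f flin klin kf (KE_coef_sum hq0) rK i (hM x)).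
have lK i : l' *m rho (gK q i) = lw n1 n2 i *: l'.
  apply/eqP; rewrite -subr_eq0; apply/eqP; apply: v_inj.
  rewrite mulmxBr mulmxA -scalemxAr -E; apply: ext => x.
  rewrite mul0mx mulmxBl -mulmxA -scalemxAl !wprojUE.
  by rewrite /wpr (fspan_wproj_k flin klin kf (KE_coef_sum hq0) rK i (hM' x)) subrr.
have lv : l' *m v = c%:M.
  apply/eqP; rewrite -subr_eq0; apply/eqP; apply: v_inj.
  by rewrite mulmxBr mulmxA -E wprojUE /wpr hc mul_mx_scalar subrr.
exists (c^-1 *: wprojU M.+1), (c^-1 *: l'); split.
- by rewrite repZ E scalemxAr.
- by rewrite -scalemxAl lv scale_scalar_mx mulVf.
- by move=> i; rewrite -scalemxAl lF scaler0.
- by move=> i; rewrite -scalemxAl lK !scalerA mulrC.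
Qed.

End Left.
End HwModules.

Lemma lin_closed_vspace (K : fieldType) d (P : 'cV[K]_d -> Prop) : lin_closed P ->
  exists W : {vspace 'cV[K]_d}, forall x, x \in W <-> P x.
Proof.
move=> clP.
have [|m [e [he _ span]]] := @subspace_basis K _ P d (fun i => delta_mx i 0) clP _.
  move=> x _; exists x^T; rewrite /lcomb [LHS]matrix_sum_delta.
  by apply: eq_bigr => i _; rewrite big_ord1 mxE.
exists (\sum_(i < m) <[e i]>)%VS => x; split.
  move=> /memv_sumP[f hf ->]; apply: (lin_closed_sum clP) => i _.
  by have /vlineP[c ->] := hf i isT; apply: (lin_closedZ clP).
move=> /span[c ->]; apply: memv_sumr => i _.
exact/memvZ/memv_line.
Qed.

(** * Matrix units in the image of an irreducible representation *)

Section Burnside.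
Local Open Scope complex_scope.
Variables (R : realType) (q : R).
Hypotheses (hq0 : 0 < q) (hq1 : q < 1).
Local Notation C := R[i].
Local Notation UU := (Uq q).
Variables (d : nat) (rho : UU -> 'M[C]_d) (n1 n2 : nat).

(** The lifted matrix units are required to factor through [p], the lift of the rank-one projection,
    because the image of x * p in a block consists of highest weight vectors; see [block_orth]. *)
Record hw_rep_data (p : UU) (l : 'rV[C]_d) (v : 'cV[C]_d)
    (e : 'I_d -> 'I_d -> UU) : Prop := {
  hwd_rep : is_rep rho;
  hwd_E : forall i, rho (gE q i) *m v = 0;
  hwd_p : rho p = v *m l;
  hwd_lv : l *m v = 1%:M;
  hwd_F : forall i, l *m rho (gF q i) = 0;
  hwd_K : forall i, l *m rho (gK q i) = lw q n1 n2 i *: l;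
  hwd_unit : forall i j, rho (e i j) = delta_mx i j;
  hwd_unit_factor : forall i j, exists x y, e i j = x * p * y
}.

(** Irreducibility makes v and l cyclic. Choosing x_i with rho x_i v the i-th basis column and y_j
    with l rho y_j the j-th basis row, the product x_i p y_j lifts the matrix unit (i,j). *)
Lemma is_V_data : is_V n1 n2 rho -> exists p l v e, hw_rep_data p l v e.
Proof.
move=> [hr [d0 irr] [v [v0 vE vK]]].
have rep_inv (P : 'cV[C]_d -> Prop) : lin_closed P ->
    (forall h x, P x -> P (rho h *m x)) -> (forall x, P x -> x = 0) \/ (forall x, P x).
  move=> clP hP; have [W hW] := lin_closed_vspace clP.
  have [|W0|W1] := irr W.
  - by move=> h x /hW /(hP h) /hW.
  - by left => x /hW; rewrite W0 memv0 => /eqP.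
  - by right => x; apply/hW; rewrite W1 memvf.
have cyc (r : 'rV_d) : (forall k, r *m rho k *m v = 0) -> r = 0.
  move=> hk; pose P (x : 'cV[C]_d) := forall k, r *m rho k *m x = 0.
  have clP : lin_closed P.
    split=> [k|c x y hx hy k]; first by rewrite mulmx0.
    by rewrite mulmxDr -scalemxAr hx hy scaler0 addr0.
  have [|h|h] := rep_inv P clP.
  - by move=> h x hx k; have := hx (k * h); rewrite (repM hr) !mulmxA.
  - by case/eqP: v0; apply: h.
  - apply/rowP => j; have := h (delta_mx j 0) 1.
    by rewrite (rep1 hr) mulmx1 -colE => /colP/(_ 0); rewrite !mxE.
have [p [l [pE lv lF lK]]] := rep_hw_projector hq0 hq1 hr vE vK v0 cyc.
have cocyc (c : 'cV_d) : (forall k, l *m rho k *m c = 0) -> c = 0.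
  move=> hk; pose P (x : 'cV[C]_d) := forall k, l *m rho k *m x = 0.
  have clP : lin_closed P.
    split=> [k|a x y hx hy k]; first by rewrite mulmx0.
    by rewrite mulmxDr -scalemxAr hx hy scaler0 addr0.
  have [|h|h] := rep_inv P clP.
  - by move=> h x hx k; have := hx (k * h); rewrite (repM hr) !mulmxA.
  - exact: h.
  - have := h v 1; rewrite (rep1 hr) mulmx1 lv => /matrixP/(_ 0 0).
    by rewrite !mxE => /eqP; rewrite oner_eq0.
have r0 : rho 0 = 0 by have [-> _ _ _ _] := linear_of_morph (rep_lin hr).
have colx x : exists k, x = rho k *m v.
  apply: (lin_closed_full (P := fun x => exists k, x = rho k *m v)) => [|r hr'].
    split; first by exists 0; rewrite r0 mul0mx.
    move=> c y z [k ->] [k' ->]; exists (c *: k + k').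
    by rewrite (rep_lin hr) mulmxDl -scalemxAl.
  by apply: cyc => k; rewrite -mulmxA; apply: hr'; exists k.
have rowx (x : 'cV_d) : exists k, x = (l *m rho k)^T.
  apply: (lin_closed_full (P := fun x => exists k, x = (l *m rho k)^T)) => [|r hr'].
    split; first by exists 0; rewrite r0 mulmx0 trmx0.
    move=> c y z [k ->] [k' ->]; exists (c *: k + k').
    by rewrite (rep_lin hr) mulmxDr -scalemxAr linearP.
  apply: trmx_inj; rewrite trmx0; apply: cocyc => k.
  by apply: trmx_inj; rewrite trmx_mul trmxK trmx0; apply: hr'; exists k.
have [xs hx] := choice (fun i : 'I_d => colx (delta_mx i 0)).
have [ys hy] := choice (fun i : 'I_d => rowx (delta_mx i 0)).
exists p, l, v, (fun i j => xs i * p * ys j); split=> // i j; last by exists (xs i), (ys j).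
rewrite !(repM hr) pE !mulmxA -hx -mulmxA.
have -> : l *m rho (ys j) = delta_mx 0 j by apply: trmx_inj; rewrite -hy trmx_delta.
by rewrite mul_delta_mx.
Qed.

End Burnside.

(** * Isotypic decomposition *)

Section Isotypic.
Local Open Scope complex_scope.
Variables (R : realType) (q : R).
Hypotheses (hq0 : 0 < q) (hq1 : q < 1).
Local Notation C := R[i].
Local Notation A := (SUq3 q).
Local Notation UU := (Uq q).
Variables (U : Uq_hopf q) (act : right_action U).
Local Notation "a <<| k" := (act a k) (at level 39, left associativity).
Variables (D : SUq3_coproduct q) (h : haar_state D).
Local Notation hform := (hform h).

Definition is_hw (n1 n2 : nat) (g : A) : Prop :=
  (forall i, g <<| gF q i = 0) /\ (forall i, g <<| gK q i = lw q n1 n2 i *: g).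

Lemma conj_lw n1 n2 i : Num.conj (lw q n1 n2 i) = lw q n1 n2 i.
Proof. exact: conj_qw. Qed.

Lemma is_hw_mon r s : is_hw (size r) (size s) (wmn q r * zmn q s).
Proof.
split=> i.
  rewrite act_mulF zmn_F // (wmn_F hq0 act i r) mul0r mulr0 addr0 //.
rewrite act_mulK /lw /nth_weight; case: (ord2_case i) => ->.
  by rewrite wmn_K1 // zmn_K1 // scalerAl.
by rewrite wmn_K2 // zmn_K2 // scalerAr.
Qed.

Lemma hw_elim n1 n2 g (Q : A -> Prop) : is_hw n1 n2 g -> lin_closed Q -> Q g ->
  (forall x i, Q (x <<| gE q i)) -> forall k, Q (g <<| k).
Proof.
move=> [gF0 gK0] clQ Qg QE k.
exact: (@right_hw_elim _ _ hq0 _ (fun x k => x <<| k) (act_linl act) (act_linr act)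
  (act_id act) (act_comp act) n1 n2 g gF0 gK0 Q).
Qed.

Lemma hform_actE a b i : hform a (b <<| gE q i) = (q ^+ 2)%:C * hform (a <<| gF q i) b.
Proof.
rewrite (adjointF hq0 act h i a b) actZr hformZr mulrA -rmorphM divff ?mul1r //.
by rewrite expf_neq0 ?gt_eqF.
Qed.

Lemma hform_hw_E n1 n2 g x i : is_hw n1 n2 g -> hform g (x <<| gE q i) = 0.
Proof. by case=> gF0 _; rewrite hform_actE gF0 hform0l mulr0. Qed.

Lemma hform_null_closed a : lin_closed (fun x => hform a x = 0).
Proof.
by split=> [|c x y hx hy]; rewrite ?hform0r // hformDr hformZr hx hy mulr0 addr0.
Qed.

Lemma lw_inj n1 n2 m1 m2 : (forall i, lw q n1 n2 i = lw q m1 m2 i) -> n1 = m1 /\ n2 = m2.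
Proof.
move=> e; have := e i1; have := e i2; rewrite /lw /nth_weight /=.
by move=> /(qw_inj hq0 hq1) [->] /(qw_inj hq0 hq1) [->].
Qed.

(** After moving [l] across by its adjoint, [hw_elim] reduces the claim to f and g themselves, which
    are eigenvectors of the self-adjoint K_i with some eigenvalue different. *)
Lemma hw_orth n1 n2 m1 m2 g f k l : is_hw n1 n2 g -> is_hw m1 m2 f ->
  (n1, n2) != (m1, m2) -> hform (f <<| l) (g <<| k) = 0.
Proof.
move=> hg hf nm; have [l' hl] := adjoint_exists hq0 act h l.
rewrite hl -act_comp; apply: (hw_elim (Q := fun x => hform f x = 0) hg).
- exact: hform_null_closed.
- apply: contrapT => fg0; case/eqP: nm.
  suff [-> ->] : n1 = m1 /\ n2 = m2 by [].
  apply: lw_inj => i.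
  have := adjointK hq0 act h i f g; case: hg hf => _ hg [_ hf].
  rewrite hg hf hformZl hformZr conj_lw => /mulIf -> //; exact/eqP.
- by move=> x i; apply: hform_hw_E hf.
Qed.

Section WithRep.
Variables (d : nat) (rho : UU -> 'M[C]_d) (n1 n2 : nat).
Variables (p : UU) (l : 'rV[C]_d) (v : 'cV[C]_d) (e : 'I_d -> 'I_d -> UU).
Hypothesis hV : hw_rep_data rho n1 n2 p l v e.

Let hr := hwd_rep hV.

Let V2 := ('rV[C]_d * A)%type.
Let r2 (x : V2) (k : UU) : V2 := (x.1 *m rho k, x.2 <<| k).

(** The form determines the module of g: the pair (l, g) is a highest weight vector in the direct
    sum of rows and A(SU_q(3)), and comparing its two components gives h(g^* (g <| k)) = (l rho(k)
    v) h(g^* g). Applied to k = x x', with x' adjoint to x, this makes the norm of g <| x vanish. *)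
Lemma hw_ker_rep g x : is_hw n1 n2 g -> rho x = 0 -> g <<| x = 0.
Proof.
move=> [gF0 gK0] x0.
have key k : hform g (g <<| k) = (l *m rho k *m v) 0 0 * hform g g.
  pose Q (y : V2) := hform g y.2 = (y.1 *m v) 0 0 * hform g g.
  apply: (@right_hw_elim _ _ hq0 V2 r2 _ _ _ _ n1 n2 (l, g) _ _ Q).
  - move=> k' c [y1 y2] [z1 z2]; rewrite /r2 /= actDl actZl mulmxDl -scalemxAl //.
  - move=> [y1 y2] c k1 k2; rewrite /r2 /= actDr actZr (rep_lin hr) mulmxDr -scalemxAr //.
  - by move=> [y1 y2]; rewrite /r2 /= act_id (rep1 hr) mulmx1.
  - by move=> [y1 y2] k1 k2; rewrite /r2 /= act_comp (repM hr) mulmxA.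
  - by move=> i; rewrite /r2 /= gF0 (hwd_F hV).
  - by move=> i; rewrite /r2 /= gK0 (hwd_K hV).
  - split; first by rewrite /Q /= hform0r mul0mx mxE mul0r.
    move=> c [y1 y2] [z1 z2]; rewrite /Q /= => hy hz.
    by rewrite hformDr hformZr hy hz mulmxDl -scalemxAl !mxE mulrDl mulrA.
  - by rewrite /Q /= (hwd_lv hV) mxE eqxx mul1r.
  - move=> [y1 y2] i; rewrite /Q /= (hform_hw_E _ _ (conj gF0 gK0)).
    by rewrite -mulmxA (hwd_E hV) mulmx0 mxE mul0r.
apply: (hform_eq0 (h := h)); have [x' hx] := adjoint_exists hq0 act h x.
by rewrite hx -act_comp key (repM hr) x0 mul0mx mulmx0 mul0mx mxE mul0r.
Qed.

Lemma hw_ker_rep_mid g k x : is_hw n1 n2 g -> rho x = 0 -> g <<| k <<| x = 0.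
Proof.
by move=> hg x0; rewrite -act_comp; apply: hw_ker_rep => //; rewrite (repM hr) x0 mulmx0.
Qed.

(** Modulo the kernel every k is a combination of the lifted matrix units, so the values of [phi]
    there are the entries of T. *)
Lemma kernel_functional (phi : UU -> C) : scalar phi -> (forall k, rho k = 0 -> phi k = 0) ->
  exists T : 'M[C]_d, forall k, phi k = \tr (T *m rho k).
Proof.
move=> hphi hker; exists (\matrix_(i, j) phi (e j i)) => k.
have [_ pD pZ pN ps] := linear_of_morph hphi.
pose k' := \sum_i \sum_j rho k i j *: e i j.
have [_ rD rZ rN rs] := linear_of_morph (rep_lin hr).
have ek : rho (k - k') = 0.
  rewrite rD rN; apply/eqP; rewrite subr_eq0; apply/eqP.
  rewrite /k' rs [LHS]matrix_sum_delta; apply: eq_bigr => i _.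
  by rewrite rs; apply: eq_bigr => j _; rewrite rZ (hwd_unit hV).
have /eqP := hker _ ek; rewrite pD pN subr_eq0 => /eqP ->.
rewrite /k' ps /mxtrace [RHS](eq_bigr (fun j => \sum_i phi (e i j) * rho k i j)) => [|j _]; last first.
  by rewrite mxE; apply: eq_bigr => i _; rewrite mxE.
rewrite [RHS]exchange_big; apply: eq_bigr => i _ /=.
by rewrite ps; apply: eq_bigr => j _; rewrite pZ; apply: mulrC.
Qed.

Lemma rep_unit_sum : rho (\sum_i e i i) = 1%:M.
Proof.
have [_ _ _ _ rs] := linear_of_morph (rep_lin hr).
rewrite rs; apply/matrixP => i j; rewrite summxE.
under eq_bigr => k _ do rewrite (hwd_unit hV) mxE.
rewrite (bigD1 i) //= eqxx mxE big1 ?addr0 => [|k ki]; last first.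
  by rewrite [i == k]eq_sym (negbTE ki).
by rewrite eq_sym.
Qed.

(** Otherwise the counit would factor through rho. Being 1 on K_i it would vanish on [p], whose
    weight is nontrivial, hence on all lifted matrix units, hence on 1. *)
Lemma ker_not_counit : (0 < n1 + n2)%N -> exists2 k, rho k = 0 & epsU k = 1.
Proof.
move=> n0; have [_ eD eZ eN es] := linear_of_morph (@epsU_lin R q).
have [_ rD rZ rN rs] := linear_of_morph (rep_lin hr).
suff [k k0 ek] : exists2 k, rho k = 0 & epsU k != 0.
  by exists ((epsU k)^-1 *: k); [rewrite rZ k0 scaler0|rewrite eZ; apply: mulVf].
apply: contrapT => hn.
have H k : rho k = 0 -> epsU k = 0.
  by move=> k0; apply/eqP/negPn/negP => ek; apply: hn; exists k.
have ep : epsU p = 0.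
  apply/eqP/negPn/negP => ep0.
  have lw1 i : lw q n1 n2 i = 1.
    have : epsU (p * gK q i - lw q n1 n2 i *: p) = 0.
      apply: H; rewrite rD rN rZ (repM hr) (hwd_p hV) -mulmxA (hwd_K hV).
      by rewrite scalemxAr subrr.
    rewrite eD eN eZ epsUM epsUK mulr1 => /eqP; rewrite subr_eq0 => /eqP e1.
    by apply: (mulIf ep0); rewrite mul1r [RHS]e1.
  have [e1 e2] : n1 = 0%N /\ n2 = 0%N.
    by apply: lw_inj => i; rewrite lw1 /lw /nth_weight if_same qw0.
  by rewrite e1 e2 in n0.
have : epsU (1 - \sum_i e i i) = 0.
  by apply: H; rewrite rD rN (rep1 hr) rep_unit_sum subrr.
rewrite eD eN es big1 => [|i _]; last first.
  by have [x [y ->]] := hwd_unit_factor hV i i; rewrite !epsUM ep mulr0 mul0r.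
by rewrite epsU1 subr0 => /eqP; rewrite oner_eq0.
Qed.

End WithRep.

End Isotypic.

(** * Realization of V(n1,n2) inside A(SU_q(3)) *)

Section Existence.
Local Open Scope complex_scope.
Variables (R : realType) (q : R).
Hypotheses (hq0 : 0 < q) (hq1 : q < 1).
Local Notation C := R[i].
Local Notation A := (SUq3 q).
Local Notation UU := (Uq q).
Variables (U : Uq_hopf q) (act : right_action U).
Local Notation "a <<| k" := (act a k) (at level 39, left associativity).
Variables (D : SUq3_coproduct q) (h : haar_state D).
Local Notation hform := (hform h).
Local Notation is_hw := (is_hw act).

Definition loc_finite (a : A) : Prop := exists (I : finType) (s : I -> A),
  forall k, exists c : I -> C, a <<| k = \sum_i c i *: s i.

Lemma loc_finite_all a : loc_finite a.
Proof.
elim/SUq3_ind: a => [i j|| c a b [I [s hs]] [J [t ht]]|a b [I [s hs]] [J [t ht]]].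
- exists 'I_3, (fun l => u q l j) => k.
  by have [rho hr] := act_u_matrix hq0 act k; exists (rho i).
- exists unit, (fun=> 1) => k; exists (fun=> epsU k).
  by rewrite big_const card_unit /= addr0 act1.
- exists (I + J)%type, (fun x => match x with inl i => s i | inr j => t j end) => k.
  have [x hx] := hs k; have [y hy] := ht k.
  exists (fun z => match z with inl i => c * x i | inr j => y j end).
  rewrite big_sumType /= actDl actZl hx hy scaler_sumr; congr (_ + _).
  by apply: eq_bigr => i _; rewrite scalerA.
- exists (I * J)%type, (fun x => s x.1 * t x.2) => k.
  have [x hx] := choice hs; have [y hy] := choice ht.
  exists (fun z => \sum_(p <- copU U k) x p.1 z.1 * y p.2 z.2).
  rewrite act_mul (eq_bigr (fun p => (\sum_i x p.1 i *: s i) * (\sum_j y p.2 j *: t j))) => [|p _];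
    last by rewrite -hx -hy.
  under [RHS]eq_bigr => z _ do rewrite scaler_suml.
  rewrite exchange_big /=; apply: eq_bigr => p _.
  rewrite big_distrlr /= pair_big /=; apply: eq_bigr => z _.
  by rewrite mulr_scale.
Qed.

Lemma loc_finite_ord a : exists n (s : 'I_n -> A), forall k, exists c, a <<| k = lcomb s c.
Proof.
have [I [s hs]] := loc_finite_all a.
exists #|I|, (fun i => s (enum_val i)) => k; have [c ->] := hs k.
exists (\row_i c (enum_val i)); rewrite /lcomb (reindex (@enum_val I xpredT)) /=.
  by apply: eq_bigr => i _; rewrite mxE.
exact: onW_bij (enum_val_bij I).
Qed.

(** Powers of star u^1_1 and of u^3_3, both of counit 1, so that the counit shows that the product
    is nonzero. *)
Definition hw_vector (n1 n2 : nat) : A := wmn q (nseq n1 o0) * zmn q (nseq n2 o2).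

Lemma is_hw_vector n1 n2 : is_hw n1 n2 (hw_vector n1 n2).
Proof. by have := is_hw_mon hq0 act (nseq n1 o0) (nseq n2 o2); rewrite !size_nseq. Qed.

Lemma hw_vector_neq0 n1 n2 : hw_vector n1 n2 != 0.
Proof.
suff e : epsA (hw_vector n1 n2) = 1.
  by apply/eqP => e0; move: e; rewrite e0 epsA0 => /eqP; rewrite eq_sym oner_eq0.
rewrite epsA_M.
have -> : epsA (wmn q (nseq n1 o0)) = 1.
  elim: n1 => [|n ih]; first by rewrite wmn_nil epsA1.
  by rewrite wmn_cons epsA_M ih epsA_star epsA_u eqxx conjC1 mulr1.
elim: n2 => [|n ih]; first by rewrite zmn_nil epsA1 mulr1.
by move: ih; rewrite !mul1r zmn_cons epsA_M => ->; rewrite epsA_u eqxx mulr1.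
Qed.

(** The module generated by g = [hw_vector], finite-dimensional by local finiteness. Coordinates are
    rows, so a right action gives matrices multiplying in the order of U_q. Faithfulness of the Haar
    state yields cyclicity of the column v, and the rank-one p then puts v into every nonzero
    invariant subspace. *)
Lemma V_exists n1 n2 : exists d (rho : UU -> 'M[C]_d), is_V n1 n2 rho.
Proof.
have hg := is_hw_vector n1 n2; have g0 := hw_vector_neq0 n1 n2.
set g := hw_vector n1 n2 in hg g0.
pose P x := exists k, x = g <<| k.
have clP : lin_closed P.
  split; first by exists 0; rewrite act0r.
  by move=> c x y [k ->] [k' ->]; exists (c *: k + k'); rewrite actDr actZr.
have [n [s hs]] := loc_finite_ord g.
have [|d [e [he ie span]]] := @subspace_basis _ _ P n s clP _.
  by move=> x [k ->]; apply: hs.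
have Pact x k : P x -> P (x <<| k) by move=> [k' ->]; exists (k' * k); rewrite act_comp.
have inj c c' : lcomb e c = lcomb e c' -> c = c'.
  move=> ecc; apply/eqP; rewrite -subr_eq0; apply/eqP; apply: ie.
  have [_ lD _ lN _] := linear_of_morph (lcomb_lin e).
  by rewrite lD lN ecc subrr.
have [rw hrw] := choice (fun ik : 'I_d * UU => span _ (Pact _ ik.2 (he ik.1))).
pose rho (k : UU) := \matrix_i rw (i, k).
have rhoE c k : lcomb e c <<| k = lcomb e (c *m rho k).
  rewrite -lcomb_mul {1}/lcomb act_suml; apply: eq_bigr => i _.
  by rewrite actZl rowK -(hrw (i, k)).
have ext (B B' : 'M[C]_d) : (forall c : 'rV_d, c *m B = c *m B') -> B = B'.
  by move=> hc; apply/row_matrixP => i; rewrite !rowE.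
have hr : is_rep rho.
  split.
  - move=> c k k'; apply: ext => r; apply: inj.
    rewrite -rhoE actDr actZr !rhoE mulmxDr -scalemxAr.
    by have [_ lD lZ _ _] := linear_of_morph (lcomb_lin e); rewrite lD lZ.
  - by apply: ext => r; apply: inj; rewrite -rhoE act_id mulmx1.
  - by move=> k k'; apply: ext => r; apply: inj; rewrite -rhoE act_comp !rhoE mulmxA.
(* The functional <g, .> on the module; E_i kills it because g is killed by F_i. *)
pose v : 'cV[C]_d := \col_i hform g (e i).
have vE c : c *m v = (hform g (lcomb e c))%:M.
  apply/matrixP => i j; rewrite !ord1 !mxE eqxx mulr1n.
  have [_ _ _ _ fs] := linear_of_morph (hform_lin h g).
  by rewrite /lcomb fs; apply: eq_bigr => k _; rewrite mxE hformZr.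
have [rg hrg] : exists rg, g = lcomb e rg by apply: span; exists 1; rewrite act_id.
have gg0 : hform g g != 0 by apply/eqP => /hform_eq0 /eqP; rewrite (negbTE g0).
have extc (B B' : 'cV[C]_d) : (forall c : 'rV_d, c *m B = c *m B') -> B = B'.
  by move=> hc; apply/row_matrixP => i; rewrite !rowE.
have vF i : rho (gE q i) *m v = 0.
  apply: extc => c; rewrite mulmxA vE -rhoE (hform_hw_E hq0 _ _ _ hg) mulmx0.
  by apply/matrixP => ? ?; rewrite !mxE mul0rn.
have vK i : rho (gK q i) *m v = lw q n1 n2 i *: v.
  apply: extc => c; rewrite mulmxA vE -rhoE -scalemxAr vE.
  rewrite -(adjointK hq0 act h i g) (proj2 hg) hformZl conj_lw.
  by apply/matrixP => a b; rewrite !mxE mulrnAr.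
have v0 : v != 0.
  apply/eqP => v0; have := vE rg; rewrite v0 mulmx0 -hrg => /matrixP/(_ 0 0).
  by rewrite !mxE eqxx => /esym/eqP; rewrite mulr1n (negbTE gg0).
have cyc (r : 'rV_d) : (forall k, r *m rho k *m v = 0) -> r = 0.
  move=> hk; apply: ie.
  have [y ye] : P (lcomb e r) by apply: lin_closed_lcomb.
  apply: (hform_eq0 (h := h)); rewrite {1}ye.
  have [y' hy'] := adjoint_exists hq0 act h y; rewrite hy' rhoE.
  have := hk y'; rewrite vE => /matrixP/(_ 0 0).
  by rewrite !mxE eqxx mulr1n.
have [p [l [pE lv lF lK]]] := rep_hw_projector hq0 hq1 hr vF vK v0 cyc.
have rF i : rg *m rho (gF q i) = 0.
  apply: ie; rewrite -rhoE -hrg; exact: (proj1 hg).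
have rK i : rg *m rho (gK q i) = lw q n1 n2 i *: rg.
  apply: inj; rewrite -rhoE -hrg (proj2 hg).
  by have [_ _ lZ _ _] := linear_of_morph (lcomb_lin e); rewrite lZ -hrg.
(* The difference is again a highest weight row; it annihilates v, hence by [right_hw_elim] every
   rho(k) v. *)
have rgl : rg = hform g g *: l.
  apply/eqP; rewrite -subr_eq0; apply/eqP; apply: cyc => k.
  pose Q (x : 'rV[C]_d) := x *m v = 0.
  apply: (@right_hw_elim _ _ hq0 'rV[C]_d (fun x k => x *m rho k) _ _ _ _ n1 n2 _ _ _ Q).
  - by move=> k' c x y /=; rewrite mulmxDl -scalemxAl.
  - by move=> x c k1 k2; rewrite (rep_lin hr) mulmxDr -scalemxAr.
  - by move=> x; rewrite (rep1 hr) mulmx1.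
  - by move=> x k1 k2; rewrite (repM hr) mulmxA.
  - by move=> i; rewrite mulmxBl rF -scalemxAl lF scaler0 subr0.
  - by move=> i; rewrite mulmxBl rK -scalemxAl lK scalerBr !scalerA mulrC.
  - split; first by rewrite /Q mul0mx.
    by move=> c x y; rewrite /Q mulmxDl -scalemxAl => -> ->; rewrite scaler0 addr0.
  - by rewrite /Q mulmxBl vE -hrg -scalemxAl lv scalemx1 subrr.
  - by move=> x i; rewrite /Q -mulmxA vF mulmx0.
have cocyc (c : 'cV_d) : (forall k, l *m rho k *m c = 0) -> c = 0.
  move=> hk; apply: extc => r; rewrite mulmx0.
  have [y ye] : P (lcomb e r) by apply: lin_closed_lcomb.
  have -> : r = rg *m rho y by apply: inj; rewrite -rhoE -hrg.
  by rewrite rgl -!scalemxAl hk scaler0.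
exists d, rho; split=> //; last by exists v.
split.
  rewrite lt0n; apply/negP => /eqP d0; case/eqP: v0; apply/matrixP => i.
  by have := ltn_ord i; rewrite [X in (_ < X)%N]d0.
move=> W hW; case: (eqVneq W 0%VS) => [|W0]; [by left|right].
have [c cW c0] : exists2 c, c \in W & c != 0.
  by exists (vpick W); [apply: memv_pick|rewrite vpick0].
have [k lk] : exists k, l *m rho k *m c != 0.
  apply: contrapT => hn; case/eqP: c0; apply: cocyc => k.
  by apply/eqP/negPn/negP => ne; apply: hn; exists k.
have vW : v \in W.
  have : rho (p * k) *m c \in W by apply: hW.
  rewrite (repM hr) pE.
  have -> : v *m l *m rho k *m c = v *m (l *m rho k *m c) by rewrite !mulmxA.
  rewrite [l *m rho k *m c]mx11_scalar mul_mx_scalar => hv.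
  have s0 : (l *m rho k *m c) 0 0 != 0.
    by apply/eqP => s0; move: lk; rewrite [_ *m c]mx11_scalar s0 -scalemx1 scale0r eqxx.
  by rewrite -[v]scale1r -(mulVf s0) -scalerA; apply: memvZ.
apply/eqP; rewrite eqEsubv subvf; apply/subvP => x _.
apply: (lin_closed_full (P := fun x => x \in W)) => [|r hr'].
  by split=> [|a y y' hy hy']; rewrite ?mem0v // memvD // memvZ.
by apply: cyc => k'; rewrite -mulmxA; apply: hr'; apply: hW.
Qed.

End Existence.

(** * Nondegeneracy of the pairing and block projections *)

Section Blocks.
Local Open Scope complex_scope.
Variables (R : realType) (q : R).
Hypotheses (hq0 : 0 < q) (hq1 : q < 1).
Local Notation C := R[i].
Local Notation A := (SUq3 q).
Local Notation UU := (Uq q).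
Variables (U : Uq_hopf q) (act : right_action U).
Local Notation "a <<| k" := (act a k) (at level 39, left associativity).
Variables (D : SUq3_coproduct q) (h : haar_state D).
Local Notation hform := (hform h).
Local Notation is_hw := (is_hw act).

Lemma hw_mon_ind (P : A -> Prop) : lin_closed P ->
  (forall r s k, P ((wmn q r * zmn q s) <<| k)) -> forall a, P a.
Proof.
move=> clP hP a; rewrite -(act_id act a).
elim: (hw_gen_all hq0 act a) 1 => {a} [x hx|c x y _ hx _ hy|x k _ hx] k'.
- elim: hx => [r s||c y z _ hy _ hz]; first exact: hP.
    by rewrite act0l; apply: lin_closed0.
  by rewrite actDl actZl; case: clP => _; apply.
- by rewrite actDl actZl; case: clP => _; apply.
- by rewrite -act_comp; apply: hx.
Qed.

Lemma V_data_exists n1 n2 : exists d (rho : UU -> 'M[C]_d) p l v e,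
  is_V n1 n2 rho /\ hw_rep_data rho n1 n2 p l v e.
Proof.
have [d [rho hV]] := V_exists hq0 hq1 act h n1 n2.
have [p [l [v [e he]]]] := is_V_data hq0 hq1 hV.
by exists d, rho, p, l, v, e.
Qed.

Lemma haar_hw n1 n2 g : is_hw n1 n2 g -> (0 < n1 + n2)%N -> h g = 0.
Proof.
move=> [_ gK0] n0; apply: contrapT => hg.
have [e1 e2] : n1 = 0%N /\ n2 = 0%N.
  apply: (lw_inj hq0 hq1) => i.
  have := haar_act hq0 act h g (gK q i); rewrite gK0 haarZ epsUK => /mulIf ->; last exact/eqP.
  by rewrite /lw /nth_weight if_same qw0.
by rewrite e1 e2 in n0.
Qed.

(* The counit is separated from V(n1,n2), (n1,n2) != (0,0), by an element of the kernel of
   V(n1,n2); products of such elements project a given x onto the scalars. *)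
Lemma haar_projector x : exists2 e : UU, epsU e = 1 &
  forall y, x <<| (y * e) = (epsU y * h x) *: 1.
Proof.
apply: (hw_mon_ind (P := fun x => exists2 e : UU, epsU e = 1 &
  forall y, x <<| (y * e) = (epsU y * h x) *: 1)) => {x}.
- have h0 : h 0 = 0 by have [-> _ _ _ _] := linear_of_morph (haar_lin h).
  split; first by exists 1 => [|y]; rewrite ?epsU1 // act0l h0 mulr0 scale0r.
  move=> c x y [e ee he] [f ef hf]; exists (e * f) => [|z]; first by rewrite epsUM ee ef mulr1.
  rewrite actDl actZl mulrA hf epsUM ee mulr1 act_comp he actZl act1 ef scale1r.
  by rewrite haarD haarZ mulrDr scalerDl scalerA mulrCA.
- move=> r s k; set g := _ * _.
  have hg : is_hw (size r) (size s) g by apply: is_hw_mon.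
  case: (posnP (size r + size s)) => rs.
    exists 1 => [|y]; first exact: epsU1.
    have -> : g = 1.
      move/eqP: rs; rewrite addn_eq0 /g => /andP[/nilP -> /nilP ->].
      by rewrite wmn_nil zmn_nil mulr1.
    by rewrite mulr1 -act_comp !act1 haarZ haar1 mulr1 epsUM mulrC.
  have [d [rho [p [l [v [e [hV he]]]]]]] := V_data_exists (size r) (size s).
  have [x x0 ex] := ker_not_counit hq0 hq1 he rs.
  exists x => // y; rewrite (haar_act hq0) (haar_hw hg rs) !mulr0 scale0r.
  by rewrite -act_comp mulrA act_comp; apply: (hw_ker_rep_mid hq0 h he).
Qed.

Lemma pairing_null_haar x : (forall k, pairing act k x = 0) -> h x = 0.
Proof.
move=> hx; have [e ee he] := haar_projector x.
have := he 1; rewrite mul1r epsU1 mul1r => e1.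
have := hx e; rewrite /pairing e1 epsAZ epsA1 mulr1 //.
Qed.

(** By [pairingM] the null space of the pairing is stable under left multiplication, so with x it
    contains x^* x, whose Haar value must then be 0. *)
Lemma pairing_nondegenerate x : (forall k, pairing act k x = 0) -> x = 0.
Proof.
move=> hx; apply: (hform_eq0 (h := h)); apply: pairing_null_haar => k.
by rewrite pairingM big1 // => p _; rewrite hx mulr0.
Qed.

Lemma pairing_act k l a : pairing act k (a <<| l) = pairing act (l * k) a.
Proof. by rewrite /pairing act_comp. Qed.

Lemma block_act n1 n2 b k : block act n1 n2 b -> block act n1 n2 (b <<| k).
Proof.
move=> [d [rho [hV [T hT]]]]; exists d, rho; split=> //.
exists (T *m rho k) => x; rewrite pairing_act hT.
by have [hr _ _] := hV; rewrite (repM hr) mulmxA.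
Qed.

Lemma block_ker n1 n2 d (rho : UU -> 'M[C]_d) b : is_V n1 n2 rho ->
  (exists T : 'M[C]_d, forall k, pairing act k b = \tr (T *m rho k)) ->
  forall x, rho x = 0 -> b <<| x = 0.
Proof.
move=> [hr _ _] [T hT] x x0; apply: pairing_nondegenerate => k.
by rewrite pairing_act hT (repM hr) x0 mul0mx mulmx0 mxtrace0.
Qed.

(** The lifted unit matrix fixes b, so b is a sum of elements b <| (x p y); each b <| (x p) is a
    highest weight vector of weight (n1,n2), and [hw_orth] applies. *)
Lemma block_orth n1 n2 m1 m2 b f k : block act n1 n2 b -> is_hw m1 m2 f ->
  (n1, n2) != (m1, m2) -> hform b (f <<| k) = 0.
Proof.
move=> [d [rho [hV hT]]] hf nm.
have [p [l [v [e he]]]] := is_V_data hq0 hq1 hV.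
have bker := block_ker hV hT.
have [hr _ _] := hV.
have [r0 rD rZ rN rs] := linear_of_morph (rep_lin hr).
have eb : b = \sum_i b <<| e i i.
  have : b <<| (1 - \sum_i e i i) = 0.
    by apply: bker; rewrite rD rN (rep1 hr) (rep_unit_sum he) subrr.
  have [_ aD _ aN as'] := linear_of_morph (act_linr act b).
  by rewrite aD aN act_id as' => /eqP; rewrite subr_eq0 => /eqP.
rewrite eb; elim/big_ind: _ => [|x y hx hy|i _]; first exact: hform0l.
  by rewrite hformDl hx hy addr0.
have [x [y ->]] := hwd_unit_factor he i i.
rewrite act_comp; apply: (hw_orth hq0 hq1 h _ _ hf _ (m1 := n1) (m2 := n2)); last by rewrite eq_sym.
split=> j.
  rewrite -act_comp; apply: bker.
  by rewrite !(repM hr) (hwd_p he) -!mulmxA (hwd_F he) !mulmx0.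
apply/eqP; rewrite -subr_eq0 -act_comp -actZr -actNr -actDr; apply/eqP/bker.
rewrite rD rN rZ !(repM hr) (hwd_p he) -!mulmxA (hwd_K he).
by rewrite -!scalemxAr subrr.
Qed.

Section FixedModel.
Variables (n1 n2 d : nat) (rho : UU -> 'M[C]_d).
Variables (p : UU) (l : 'rV[C]_d) (v : 'cV[C]_d) (e : 'I_d -> 'I_d -> UU).
Hypotheses (hV : is_V n1 n2 rho) (he : hw_rep_data rho n1 n2 p l v e).

Lemma block_of_ker b : (forall k x, rho x = 0 -> b <<| k <<| x = 0) -> block act n1 n2 b.
Proof.
move=> hb; exists d, rho; split=> //; apply: (kernel_functional he (phi := fun k => pairing act k b)).
  by move=> c x y; rewrite /pairing actDr actZr epsA_lin.
by move=> k k0; rewrite /pairing -(act_id act b) hb // epsA0.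
Qed.

(** By linearity it is enough to project translates of highest weight words, and each of these is
    its own projection or has projection 0. *)
Lemma block_projE a : exists b, (forall k x, rho x = 0 -> b <<| k <<| x = 0) /\
  forall b', block act n1 n2 b' -> hform b' (a - b) = 0.
Proof.
apply: (hw_mon_ind (P := fun a => exists b, (forall k x, rho x = 0 -> b <<| k <<| x = 0) /\
  forall b', block act n1 n2 b' -> hform b' (a - b) = 0)) => {a}.
- split.
    by exists 0; split=> [k x _|b' _]; rewrite ?act0l // subrr hform0r.
  move=> c x y [bx [hx hx']] [b_y [hy hy']]; exists (c *: bx + b_y); split.
    by move=> k z z0; rewrite !actDl !actZl hx // hy // scaler0 addr0.
  move=> b' hb'; have -> : c *: x + y - (c *: bx + b_y) = c *: (x - bx) + (y - b_y).
    by rewrite scalerBr opprD addrACA.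
  by rewrite hformDr hformZr hx' // hy' // mulr0 addr0.
- move=> r s k; set g := _ * _.
  have hg : is_hw (size r) (size s) g by apply: is_hw_mon.
  have [e12|ne] := eqVneq (n1, n2) (size r, size s).
    exists (g <<| k); split; last by move=> b' _; rewrite subrr hform0r.
    move=> k' x x0; rewrite -[g <<| k <<| k']act_comp; apply: (hw_ker_rep_mid hq0 h he) => //.
    by case: e12 => -> ->.
  exists 0; split; first by move=> *; rewrite !act0l.
  by move=> b' hb'; rewrite subr0; apply: block_orth hb' hg ne.
Qed.

End FixedModel.

Lemma block_projection_exists n1 n2 a : exists b, block act n1 n2 b /\
  forall b', block act n1 n2 b' -> hform b' (a - b) = 0.
Proof.
have [d [rho [p [l [v [e [hV he]]]]]]] := V_data_exists n1 n2.
have [b [hb hb']] := block_projE he a.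
by exists b; split=> //; apply: (block_of_ker hV he).
Qed.

Lemma block_span_ind (P : A -> Prop) : lin_closed P ->
  (forall n1 n2 b, block act n1 n2 b -> P b) -> forall a, P a.
Proof.
move=> clP hP; apply: hw_mon_ind => // r s k.
have [d [rho [p [l [v [e [hV he]]]]]]] := V_data_exists (size r) (size s).
apply: (hP (size r) (size s)); apply: (block_of_ker hV he) => k' x x0.
by rewrite -[_ <<| k <<| k']act_comp; apply: (hw_ker_rep_mid hq0 h he) => //; apply: is_hw_mon.
Qed.

End Blocks.

(** * Partitions of unity *)

Section SimplexSum.
Variable V : nmodType.
Implicit Types F : nat -> nat -> nat -> V.

Definition simplex_sum m F : V := \sum_(j < m.+1) \sum_(k < (m - j).+1) F j k (m - j - k)%N.

Lemma simplex_sum_eq m F G : (forall j k l, (j + k + l)%N = m -> F j k l = G j k l) ->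
  simplex_sum m F = simplex_sum m G.
Proof.
move=> h; apply: eq_bigr => j _; apply: eq_bigr => k _; apply: h.
rewrite -addnA subnKC ?subnKC //; first by rewrite -ltnS ltn_ord.
by rewrite -ltnS ltn_ord.
Qed.

Lemma simplex_sumD m F G :
  simplex_sum m (fun j k l => F j k l + G j k l) = simplex_sum m F + simplex_sum m G.
Proof. by rewrite /simplex_sum -big_split; apply: eq_bigr => j _; rewrite -big_split. Qed.

Lemma simplex_sum_shift1 m F :
  simplex_sum m.+1 (fun j k l => if j is j'.+1 then F j' k l else 0) = simplex_sum m F.
Proof.
rewrite /simplex_sum big_ord_recl /= big1 // add0r.
by apply: eq_bigr => j _ /=; rewrite /bump /= add1n subSS.
Qed.

Lemma simplex_sum_shift2 m F :
  simplex_sum m.+1 (fun j k l => if k is k'.+1 then F j k' l else 0) = simplex_sum m F.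
Proof.
rewrite /simplex_sum big_ord_recr /= subnn [X in _ + X = _]big_ord_recl big_ord0 /= !addr0.
apply: eq_bigr => j _; rewrite big_ord_recl /= add0r subSn; last by rewrite -ltnS.
by apply: eq_bigr => k _; rewrite /bump /= add1n subSS.
Qed.

Lemma simplex_sum_shift3 m F :
  simplex_sum m.+1 (fun j k l => if l is l'.+1 then F j k l' else 0) = simplex_sum m F.
Proof.
rewrite /simplex_sum big_ord_recr /= subnn [X in _ + X = _]big_ord_recl big_ord0 /= !addr0.
apply: eq_bigr => j _; rewrite big_ord_recr /= subnn addr0 subSn; last by rewrite -ltnS.
by apply: eq_bigr => k _; rewrite subSn // -ltnS.
Qed.

Lemma simplex_sum_triple m F :
  \sum_(t : 'I_m.+1 * 'I_m.+1 * 'I_m.+1 | (t.1.1 + t.1.2 + t.2 == m)%N) F t.1.1 t.1.2 t.2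
  = simplex_sum m F.
Proof.
rewrite big_mkcond -(pair_bigA _ (fun (p : 'I_m.+1 * 'I_m.+1) (l : 'I_m.+1) =>
  if (p.1 + p.2 + l == m)%N then F p.1 p.2 l else 0)) /=.
rewrite -(pair_bigA _ (fun (j k : 'I_m.+1) => \sum_(l : 'I_m.+1)
  if (j + k + l == m)%N then F j k l else 0)) /=.
apply: eq_bigr => j _.
have jm : (j <= m)%N by rewrite -ltnS.
rewrite [RHS](big_ord_widen m.+1 (fun k => F j k (m - j - k)%N)) ?ltnS ?leq_subr //.
rewrite [RHS]big_mkcond; apply: eq_bigr => k _ /=.
rewrite ltnS; case: leqP => kj.
  have jk : (j + k <= m)%N by rewrite -leq_subRL.
  have lm : (m - (j + k) < m.+1)%N by rewrite ltnS leq_subr.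
  rewrite (bigD1 (Ordinal lm)) //= subnKC // eqxx big1 => [|l ne]; first by rewrite addr0 subnDA.
  case: eqP => // e; case/eqP: ne; apply: val_inj => /=.
  by rewrite -[X in (X - _)%N]e addKn.
rewrite big1 // => l _; case: eqP => // e; move: kj.
by rewrite -[X in (X - _)%N]e -addnA addKn ltnNge leq_addr.
Qed.

End SimplexSum.

Section QTrinomial.
Variables (R : realType) (q : R).
Hypotheses (hq0 : 0 < q) (hq1 : q < 1).

Let q_neq0 : q != 0. Proof. by rewrite gt_eqF. Qed.

Lemma qsub_lt0 : q - q^-1 < 0.
Proof. by rewrite subr_lt0 (lt_trans hq1) // invf_gt1. Qed.

Lemma qnum_gt0 n : (0 < n)%N -> 0 < qnum q n.
Proof.
move=> n0; rewrite /qnum nmulr_lgt0 ?invr_lt0 ?qsub_lt0 // subr_lt0.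
have h : q ^+ n < 1 by rewrite exprn_ilt1 ?ltW // -lt0n.
by rewrite (lt_trans h) // invf_gt1 // exprn_gt0.
Qed.

Lemma qfact_gt0 n : 0 < qfact q n.
Proof.
rewrite /qfact big_seq; elim/big_ind: _ => // [|i]; first by move=> x y; apply: mulr_gt0.
by rewrite mem_index_iota => /andP[i0 _]; apply: qnum_gt0.
Qed.

Lemma qfactS n : qfact q n.+1 = qfact q n * qnum q n.+1.
Proof. by rewrite /qfact big_nat_recr. Qed.

Lemma qtrinom_gt0 j k l : 0 < qtrinom q j k l.
Proof. by rewrite /qtrinom divr_gt0 ?mulr_gt0 ?invr_gt0 ?exprn_gt0 ?qfact_gt0. Qed.

Lemma qtrinomC j k l : qtrinom q j k l = qtrinom q k j l.
Proof.
rewrite /qtrinom; congr (_ ^- _ * qfact _ _ / _); ring.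
Qed.

Lemma qtrinomR j k l : qtrinom q j k l = qtrinom q k l j.
Proof.
rewrite /qtrinom; congr (_ ^- _ * qfact _ _ / _); ring.
Qed.

Lemma qtrinom_recl j k l : qnum q (j.+1 + k + l) * qtrinom q j k l =
  q ^+ (k + l) * qnum q j.+1 * qtrinom q j.+1 k l.
Proof.
have F n : qfact q n != 0 by rewrite gt_eqF ?qfact_gt0.
have Q n : q ^+ n != 0 by rewrite expf_neq0.
rewrite /qtrinom !addSn !qfactS.
have -> : (j.+1 * k + k * l + l * j.+1 = (j * k + k * l + l * j) + (k + l))%N.
  by rewrite -addn1; ring.
rewrite [q ^+ (_ + (k + l))]exprD.
by field; rewrite !F !Q ?gt_eqF ?qnum_gt0.
Qed.

(** Written out with x = q^j, y = q^k, w = q^l, the three terms telescope. *)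
Lemma qnum_simplex j k l : qnum q (j + k + l) =
  qnum q j * q ^+ (k + l) + q ^- (2 * j) * (qnum q k * q ^+ (j + l))
  + q ^- (2 * (j + k)) * (qnum q l * q ^+ (j + k)).
Proof.
have Q n : q ^+ n != 0 by rewrite expf_neq0.
have q0 : q - q^-1 != 0 by rewrite lt_eqF ?qsub_lt0.
rewrite /qnum !mul2n -!addnn !exprD.
move: (Q j) (Q k) (Q l) q0; move: (q ^+ j) (q ^+ k) (q ^+ l) (q - q^-1) => x y w dd x0 y0 w0 d0.
by field; rewrite x0 y0 w0 d0.
Qed.

Lemma qnum0 : qnum q 0 = 0.
Proof. by rewrite /qnum expr0 invr1 subrr mul0r. Qed.

Lemma qtrinom_pred1 j k l :
  qnum q (j + k + l) * (if j is j'.+1 then qtrinom q j' k l else 0)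
  = qnum q j * q ^+ (k + l) * qtrinom q j k l.
Proof.
case: j => [|j]; first by rewrite mulr0 qnum0 !mul0r.
by rewrite qtrinom_recl [q ^+ _ * _]mulrC.
Qed.

Lemma qtrinom_pred2 j k l :
  qnum q (j + k + l) * (if k is k'.+1 then qtrinom q j k' l else 0)
  = qnum q k * q ^+ (j + l) * qtrinom q j k l.
Proof.
rewrite [(j + k)%N]addnC [qtrinom q j k l]qtrinomC -qtrinom_pred1.
by case: k => // k; rewrite qtrinomC.
Qed.

Lemma qtrinom_pred3 j k l :
  qnum q (j + k + l) * (if l is l'.+1 then qtrinom q j k l' else 0)
  = qnum q l * q ^+ (j + k) * qtrinom q j k l.
Proof.
rewrite -[qtrinom q j k l]qtrinomR -qtrinom_pred1 [(j + k + l)%N]addnC addnA.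
by case: l => // l; rewrite [in RHS]qtrinomR.
Qed.

(** The powers of q are the squares of the factors in [z1_zmon] and [z2_zmon]; those of the reversed
    rule below come from [zmon_z1] and [zmon_z0]. *)
Lemma qtrinom_pascal m j k l : (j + k + l)%N = m.+1 -> qtrinom q j k l =
  (if j is j'.+1 then qtrinom q j' k l else 0)
  + q ^- (2 * j) * (if k is k'.+1 then qtrinom q j k' l else 0)
  + q ^- (2 * (j + k)) * (if l is l'.+1 then qtrinom q j k l' else 0).
Proof.
move=> jkl; have M0 : qnum q (j + k + l) != 0 by rewrite gt_eqF // qnum_gt0 // jkl.
apply: (mulfI M0); rewrite !mulrDr ![_ * (q ^- _ * _)]mulrCA.
rewrite qtrinom_pred1 qtrinom_pred2 qtrinom_pred3 {1}qnum_simplex.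
by rewrite !mulrDl -!mulrA.
Qed.

Lemma qtrinom_pascal_rev m j k l : (j + k + l)%N = m.+1 -> qtrinom q j k l =
  (if l is l'.+1 then qtrinom q j k l' else 0)
  + q ^- (2 * l) * (if k is k'.+1 then qtrinom q j k' l else 0)
  + q ^- (2 * (l + k)) * (if j is j'.+1 then qtrinom q j' k l else 0).
Proof.
have rev a b c : qtrinom q a b c = qtrinom q c b a by rewrite [LHS]qtrinomR [LHS]qtrinomC.
move=> jkl; rewrite rev (@qtrinom_pascal m) //; last by rewrite addnAC addnC addnA -jkl; ring.
by congr (_ + _ * _ + _ * _);
  [case: l {jkl} => // l|case: k {jkl} => // k|case: j {jkl} => // j]; rewrite rev.
Qed.

End QTrinomial.

Section PartitionsOfUnity.
Local Open Scope complex_scope.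
Variables (R : realType) (q : R).
Hypotheses (hq0 : 0 < q) (hq1 : q < 1).
Local Notation C := R[i].
Local Notation A := (SUq3 q).
Local Notation zz c := (u q o2 c).

Lemma ordmax_o2 : ord_max = o2 :> 'I_3.
Proof. by apply: val_inj; rewrite /= inordK. Qed.

Lemma zmonE j k l : zmon q j k l = zz o0 ^+ j * zz o1 ^+ k * zz o2 ^+ l.
Proof. by rewrite /zmon /z ordmax_o2. Qed.

Lemma qcomm_expr (x y : A) (c : C) n : x * y = c *: (y * x) -> x * y ^+ n = c ^+ n *: (y ^+ n * x).
Proof.
move=> h; elim: n => [|n ih]; first by rewrite !expr0 mulr1 mul1r scale1r.
by rewrite [y ^+ _]exprS mulrA h -scalerAl -[y * x * _]mulrA ih -scalerAr scalerA mulrA -[c * _]exprS.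
Qed.

Lemma qcomm_exprl (x y : A) (c : C) n : x * y = c *: (y * x) -> x ^+ n * y = c ^+ n *: (y * x ^+ n).
Proof.
move=> h; elim: n => [|n ih]; first by rewrite !expr0 mulr1 mul1r scale1r.
rewrite [x ^+ _]exprS -[LHS]mulrA ih -scalerAr [x * (y * _)]mulrA h -scalerAl scalerA -exprSr.
by rewrite -[y * x * _]mulrA.
Qed.

Lemma z_swap (i j : 'I_3) : (i < j)%N -> zz j * zz i = (q%:C)^-1 *: (zz i * zz j).
Proof. by move=> ij; rewrite (u_row _ _ ij) scalerA mulVf ?scale1r // qC_neq0. Qed.

Let lt01 : (o0 < o1)%N. Proof. by rewrite val_o0 val_o1. Qed.
Let lt02 : (o0 < o2)%N. Proof. by rewrite val_o0 val_o2. Qed.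
Let lt12 : (o1 < o2)%N. Proof. by rewrite val_o1 val_o2. Qed.

Lemma z0_zmon j k l : zz o0 * zmon q j k l = zmon q j.+1 k l.
Proof. by rewrite !zmonE !mulrA -exprS. Qed.
Lemma z1_zmon j k l : zz o1 * zmon q j k l = (q%:C)^-1 ^+ j *: zmon q j k.+1 l.
Proof.
rewrite !zmonE !mulrA (qcomm_expr _ (z_swap lt01)) -!scalerAl -[_ * _ * _ ^+ k]mulrA.
by rewrite -exprS.
Qed.
Lemma z2_zmon j k l : zz o2 * zmon q j k l = (q%:C)^-1 ^+ (j + k) *: zmon q j k l.+1.
Proof.
rewrite !zmonE !mulrA (qcomm_expr _ (z_swap lt02)) -!scalerAl.
rewrite -[_ * zz o2 * _ ^+ k]mulrA (qcomm_expr _ (z_swap lt12)) -scalerAr -scalerAl scalerA -exprD.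
by rewrite mulrA -[_ * zz o2 * _]mulrA -exprS.
Qed.

Lemma zmon_z2 j k l : zmon q j k l * zz o2 = zmon q j k l.+1.
Proof. by rewrite !zmonE -mulrA -exprSr. Qed.
Lemma zmon_z1 j k l : zmon q j k l * zz o1 = (q%:C)^-1 ^+ l *: zmon q j k.+1 l.
Proof.
rewrite !zmonE -mulrA (qcomm_exprl _ (z_swap lt12)) -scalerAr mulrA.
by rewrite -[_ * zz o1]mulrA -exprSr.
Qed.
Lemma zmon_z0 j k l : zmon q j k l * zz o0 = (q%:C)^-1 ^+ (l + k) *: zmon q j.+1 k l.
Proof.
rewrite !zmonE -mulrA (qcomm_exprl _ (z_swap lt02)) -scalerAr mulrA -[_ * zz o0]mulrA.
rewrite (qcomm_exprl _ (z_swap lt01)) -scalerAr -scalerAl scalerA -exprD.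
by rewrite !mulrA -exprSr.
Qed.

Let T j k l : C := (qtrinom q j k l)%:C.
Let G j k l : A := zmon q j k l * star (zmon q j k l).
Let G' j k l : A := star (zmon q j k l) * zmon q j k l.

Lemma star_scale_mul (c : R) (x : A) :
  (c%:C *: x) * star (c%:C *: x) = (c ^+ 2)%:C *: (x * star x).
Proof. by rewrite starZ conj_real mulr_scale expr2 rmorphM. Qed.

Lemma star_scale_mul' (c : R) (x : A) :
  star (c%:C *: x) * (c%:C *: x) = (c ^+ 2)%:C *: (star x * x).
Proof. by rewrite starZ conj_real mulr_scale expr2 rmorphM. Qed.

Lemma simplex_sum_mull (a b : A) m F :
  a * simplex_sum m F * b = simplex_sum m (fun j k l => a * F j k l * b).
Proof.
rewrite /simplex_sum mulr_sumr mulr_suml; apply: eq_bigr => j _.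
by rewrite mulr_sumr mulr_suml.
Qed.

Lemma simplex_sum_scale (c : C) m F :
  c *: simplex_sum m F = simplex_sum m (fun j k l => c *: F j k l : A).
Proof.
rewrite /simplex_sum scaler_sumr; apply: eq_bigr => j _.
by rewrite scaler_sumr.
Qed.

Lemma invq_sq n : ((q^-1 ^+ n) ^+ 2 : R) = q ^- (2 * n).
Proof. by rewrite -exprM mulnC exprVn. Qed.

Lemma invqC n : (q%:C)^-1 ^+ n = (q^-1 ^+ n)%:C :> C.
Proof. by rewrite -fmorphV -rmorphXn. Qed.

(** The sum for m is inserted between z_c and its star in the sphere relation; normal ordering and
    the Pascal rule give the sum for m + 1. *)
Lemma sum_psi_pos m : simplex_sum m (fun j k l => T j k l *: G j k l) = 1.
Proof.
elim: m => [|m ih].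
  rewrite /simplex_sum big_ord_recl big_ord0 addr0 big_ord_recl big_ord0 addr0 /=.
  rewrite /G zmonE !subn0 !expr0 !mulr1 star1 mulr1 /T /qtrinom /qfact.
  by rewrite !big_nil /= !mulr1 !muln0 !addn0 expr0 invr1 mulr1 rmorph1 scale1r.
rewrite (@simplex_sum_eq _ _ _ (fun j k l =>
   (if j is j'.+1 then T j' k l *: G j'.+1 k l else 0)
   + (if k is k'.+1 then ((q ^- (2 * j))%:C * T j k' l) *: G j k'.+1 l else 0)
   + (if l is l'.+1 then ((q ^- (2 * (j + k)))%:C * T j k l') *: G j k l'.+1 else 0))); last first.
  move=> j k l jkl; rewrite /T (qtrinom_pascal hq0 hq1 jkl) !rmorphD !scalerDl.
  congr (_ + _ + _).
  - by case: j {jkl} => [|n]; rewrite ?scale0r.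
  - by case: k {jkl} => [|n]; rewrite ?mulr0 ?scale0r // rmorphM.
  - by case: l {jkl} => [|n]; rewrite ?mulr0 ?scale0r // rmorphM.
rewrite 2!simplex_sumD.
rewrite (simplex_sum_shift1 m (fun j k l => T j k l *: G j.+1 k l)).
rewrite (simplex_sum_shift2 m (fun j k l => ((q ^- (2 * j))%:C * T j k l) *: G j k.+1 l)).
rewrite (simplex_sum_shift3 m (fun j k l => ((q ^- (2 * (j + k)))%:C * T j k l) *: G j k l.+1)).
have zG c (f : R) x j k l : zz c * zmon q j k l = f%:C *: x ->
    zz c * (T j k l *: G j k l) * star (zz c) = ((f ^+ 2)%:C * T j k l) *: (x * star x).
  move=> h.
  have -> : zz c * (T j k l *: G j k l) * star (zz c)
      = T j k l *: ((zz c * zmon q j k l) * star (zz c * zmon q j k l)).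
    by rewrite -scalerAr -scalerAl starM /G !mulrA.
  by rewrite h star_scale_mul scalerA mulrC.
rewrite -[RHS](sum_z_z_star hq0) -[X in X * _ + _ + _]mulr1 -[X in _ + X * _ + _]mulr1
  -[X in _ + _ + X * _]mulr1 -ih !simplex_sum_mull.
congr (_ + _ + _); apply: simplex_sum_eq => j k l _; apply/esym.
- by rewrite (zG _ 1 (zmon q j.+1 k l)) ?expr1n ?mul1r // z0_zmon scale1r.
- by rewrite (zG _ (q^-1 ^+ j) (zmon q j k.+1 l)) ?invq_sq // z1_zmon invqC.
- by rewrite (zG _ (q^-1 ^+ (j + k)) (zmon q j k l.+1)) ?invq_sq // z2_zmon invqC.
Qed.

(** Same induction with the stars on the left. The weight q^(4j+2k) is the square of the factor
    q^(-N+j-l) of psi^N, as -N = j + k + l. *)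
Lemma sum_psi_neg m :
  simplex_sum m (fun j k l => ((q ^+ (4 * j + 2 * k))%:C * T j k l) *: G' j k l) = 1.
Proof.
elim: m => [|m ih].
  rewrite /simplex_sum big_ord_recl big_ord0 addr0 big_ord_recl big_ord0 addr0 /=.
  rewrite /G' zmonE !subn0 !expr0 !mulr1 star1 ?mulr1 /T /qtrinom /qfact.
  by rewrite !big_nil /= ?muln0 ?addn0 ?mulr1 ?expr0 ?invr1 ?mulr1 ?rmorph1 ?mulr1 scale1r.
rewrite (@simplex_sum_eq _ _ _ (fun j k l =>
   (if j is j'.+1 then
      ((q ^+ 4)%:C * ((q ^- (2 * (l + k)))%:C * ((q ^+ (4 * j' + 2 * k))%:C * T j' k l)))
        *: G' j'.+1 k l else 0)
   + (if k is k'.+1 then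
      ((q ^+ 2)%:C * ((q ^- (2 * l))%:C * ((q ^+ (4 * j + 2 * k'))%:C * T j k' l))) *: G' j k'.+1 l else 0)
   + (if l is l'.+1 then ((q ^+ (4 * j + 2 * k))%:C * T j k l') *: G' j k l'.+1 else 0))); last first.
  move=> j k l jkl; rewrite /T (qtrinom_pascal_rev hq0 hq1 jkl) !rmorphD !mulrDr !scalerDl.
  have rev3 (x y z : A) : x + y + z = z + y + x by rewrite addrC [x + y]addrC addrA.
  rewrite rev3; congr (_ + _ + _).
  - case: j {jkl} => [|n]; rewrite ?mulr0 ?scale0r // rmorphM; congr (_ *: _).
    rewrite (_ : 4 * n.+1 + 2 * k = 4 + (4 * n + 2 * k))%N; last by rewrite mulnS addnA.
    rewrite [q ^+ (4 + _)]exprD rmorphM -mulrA; congr (_ * _); exact: mulrCA.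
  - case: k {jkl} => [|n]; rewrite ?mulr0 ?scale0r // rmorphM; congr (_ *: _).
    rewrite (_ : 4 * j + 2 * n.+1 = 2 + (4 * j + 2 * n))%N; last by rewrite mulnS addnCA.
    rewrite [q ^+ (2 + _)]exprD rmorphM -mulrA; congr (_ * _); exact: mulrCA.
  - by case: l {jkl} => [|n]; rewrite ?mulr0 ?scale0r.
rewrite 2!simplex_sumD.
rewrite (simplex_sum_shift1 m (fun j k l =>
  ((q ^+ 4)%:C * ((q ^- (2 * (l + k)))%:C * ((q ^+ (4 * j + 2 * k))%:C * T j k l))) *: G' j.+1 k l)).
rewrite (simplex_sum_shift2 m (fun j k l =>
  ((q ^+ 2)%:C * ((q ^- (2 * l))%:C * ((q ^+ (4 * j + 2 * k))%:C * T j k l))) *: G' j k.+1 l)).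
rewrite (simplex_sum_shift3 m (fun j k l => ((q ^+ (4 * j + 2 * k))%:C * T j k l) *: G' j k l.+1)).
have zG c (f t : R) x j k l : zmon q j k l * zz c = f%:C *: x ->
    star (zz c) * (t%:C *: G' j k l) * zz c = ((f ^+ 2)%:C * t%:C) *: (star x * x).
  move=> h.
  have -> : star (zz c) * (t%:C *: G' j k l) * zz c
      = t%:C *: (star (zmon q j k l * zz c) * (zmon q j k l * zz c)).
    by rewrite -scalerAr -scalerAl starM /G' !mulrA.
  by rewrite h star_scale_mul' scalerA mulrC.
rewrite -[RHS](sum_z_star_z hq0) -[X in _ *: (X * _) + _ + _]mulr1 -[X in _ + _ *: (X * _) + _]mulr1
  -[X in _ + _ + X * _]mulr1 -ih !simplex_sum_mull !simplex_sum_scale.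
congr (_ + _ + _); apply: simplex_sum_eq => j k l _; apply/esym; rewrite /T -rmorphM.
- rewrite (zG _ (q^-1 ^+ (l + k)) _ (zmon q j.+1 k l)) ?invq_sq //; last by rewrite zmon_z0 invqC.
  by rewrite scalerA rmorphXn.
- rewrite (zG _ (q^-1 ^+ l) _ (zmon q j k.+1 l)) ?invq_sq //; last by rewrite zmon_z1 invqC.
  by rewrite scalerA rmorphXn.
- by rewrite (zG _ 1 _ (zmon q j k l.+1)) ?expr1n ?mul1r // zmon_z2 scale1r.
Qed.

End PartitionsOfUnity.

(** * Linear independence of the monomials in the z_j *)

Section Independence.
Local Open Scope complex_scope.
Variables (R : realType) (q : R).
Hypotheses (hq0 : 0 < q).
Local Notation C := R[i].
Local Notation A := (SUq3 q).
Variables (U : Uq_hopf q) (act : right_action U).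
Local Notation "a <<| k" := (act a k) (at level 39, left associativity).

Let E1 (x : A) := x <<| gE q i1.
Let E2 (x : A) := x <<| gE q i2.

(** The functional x -> epsilon(x <| E_2^a E_1^b). Up to positive scalars these form a dual system
    to the monomials of a given degree. *)
Definition raise_eps (a b : nat) (x : A) : C := epsA (iter b E1 (iter a E2 x)).

Let iterE1_lin b : linear (iter b E1).
Proof. by elim: b => [|b ih] c x y //; rewrite !iterS ih /E1 actDl actZl. Qed.
Let iterE2_lin b : linear (iter b E2).
Proof. by elim: b => [|b ih] c x y //; rewrite !iterS ih /E2 actDl actZl. Qed.

Lemma raise_eps_lin a b : scalar (raise_eps a b).
Proof. by move=> c x y; rewrite /raise_eps iterE2_lin iterE1_lin epsA_lin. Qed.

Lemma raise_epsZ a b c x : raise_eps a b (c *: x) = c * raise_eps a b x.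
Proof. by have [_ _ e _ _] := linear_of_morph (raise_eps_lin a b); rewrite e. Qed.
Lemma raise_epsD a b x y : raise_eps a b (x + y) = raise_eps a b x + raise_eps a b y.
Proof. by have [_ e _ _ _] := linear_of_morph (raise_eps_lin a b); rewrite e. Qed.

Lemma raise_epsSl a b x : raise_eps a.+1 b x = raise_eps a b (E2 x).
Proof. by rewrite /raise_eps iterSr. Qed.
Lemma raise_eps0S b x : raise_eps 0 b.+1 x = raise_eps 0 b (E1 x).
Proof. by rewrite /raise_eps iterSr. Qed.

Lemma raise_eps1 a b : raise_eps a b 1 = ((a == 0%N) && (b == 0%N))%:R.
Proof.
have e0 i : (1 : A) <<| gE q i = 0 by rewrite act1 epsUE scale0r.
have z a' b' : raise_eps a' b' 0 = 0.
  by have [e _ _ _ _] := linear_of_morph (raise_eps_lin a' b'); rewrite e.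
case: a => [|a]; last by rewrite raise_epsSl /E2 e0 z.
case: b => [|b]; last by rewrite raise_eps0S /E1 e0 z.
by rewrite /raise_eps /= epsA1.
Qed.

Lemma E2_mul_u x j k : E2 (x * u q j k) = qw q (kw i2 j) *: (E2 x * u q j k)
  + (x <<| gKV q i2) * (if ihi i2 == j then u q (ilo i2) k else 0).
Proof. by rewrite /E2 act_mulE act_u_K act_u_E scalerAr. Qed.
Lemma E1_mul_u x j k : E1 (x * u q j k) = qw q (kw i1 j) *: (E1 x * u q j k)
  + (x <<| gKV q i1) * (if ihi i1 == j then u q (ilo i1) k else 0).
Proof. by rewrite /E1 act_mulE act_u_K act_u_E scalerAr. Qed.

Let qwr n : R := qhalf q n.
Let qwr_gt0 n : 0 < qwr n := qhalf_gt0 hq0 n.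

Lemma raise_u0 a b x k :
  raise_eps a b (x * u q o0 k) = (qwr (- b%:Z))%:C * raise_eps a b x * (o0 == k)%:R.
Proof.
elim: a x => [|a ih] x; last first.
  by rewrite !raise_epsSl E2_mul_u !ilohi o_neq mulr0 addr0 kwE qw0 scale1r ih.
elim: b x => [|b ih] x.
  by rewrite /raise_eps /= epsA_M epsA_u /qwr oppr0 -/(qw q 0) qw0 mul1r.
rewrite !raise_eps0S E1_mul_u !ilohi o_neq mulr0 addr0 kwE raise_epsZ ih !mulrA.
by rewrite -/(qw q _) -/(qw q (- b.+1%:Z)) -qwD // -opprD -intS.
Qed.

(* Under the raising operators the second index never changes, and [epsA] only sees
   [u j j], so [u j k] with [j < k] can be dropped. *)
Lemma raise_u_lt a b x (j k : 'I_3) : (j < k)%N -> raise_eps a b (x * u q j k) = 0.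
Proof.
have eps0 (y : A) (j' k' : 'I_3) : (j' < k')%N -> epsA (y * u q j' k') = 0.
  by move=> jk; rewrite epsA_M epsA_u -val_eqE /= ltn_eqF // mulr0.
have E1b b' : forall y (j' k' : 'I_3), (j' < k')%N -> raise_eps 0 b' (y * u q j' k') = 0.
  elim: b' => [|b' ih] y j' k' jk; first exact: eps0.
  rewrite raise_eps0S E1_mul_u raise_epsD raise_epsZ ih // mulr0 add0r !ilohi.
  case: eqP => [e|_]; last by rewrite mulr0 -(mul0r (u q j' k')) ih.
  by rewrite ih //; apply: ltn_trans jk; rewrite -e val_o0 val_o1.
elim: a x j k => [|a ih] x j k jk; first exact: E1b.
rewrite raise_epsSl E2_mul_u raise_epsD raise_epsZ ih // mulr0 add0r !ilohi.
case: eqP => [e|_]; last by rewrite mulr0 -(mul0r (u q j k)) ih.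
by rewrite ih //; apply: ltn_trans jk; rewrite -e val_o1 val_o2.
Qed.

Lemma raise_u11 a b x :
  raise_eps a b (x * u q o1 o1) = (qwr (- a%:Z) * qwr b)%:C * raise_eps a b x.
Proof.
elim: a x => [|a ih] x; last first.
  rewrite !raise_epsSl E2_mul_u !ilohi o_neq mulr0 addr0 kwE raise_epsZ ih mulrA.
  congr (_ * _); rewrite !rmorphM mulrA; congr (_ * _).
  by rewrite -[LHS](qwD hq0) -opprD -intS.
elim: b x => [|b ih] x.
  by rewrite /raise_eps /= epsA_M epsA_u eqxx mulr1 /qwr /qhalf oppr0 !expr0z mulr1 mul1r.
rewrite !raise_eps0S E1_mul_u !ilohi eqxx raise_epsD raise_u_lt ?val_o0 ?val_o1 //.
rewrite addr0 kwE raise_epsZ ih mulrA; congr (_ * _).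
have -> : qwr (- 0%:Z) = 1 by rewrite /qwr /qhalf oppr0 expr0z.
by rewrite !mul1r -[LHS](qwD hq0) -intS.
Qed.

Lemma raise_u22 a b x : raise_eps a b (x * u q o2 o2) = (qwr a)%:C * raise_eps a b x.
Proof.
elim: a x => [|a ih] x; last first.
  rewrite !raise_epsSl E2_mul_u !ilohi eqxx raise_epsD raise_u_lt ?val_o1 ?val_o2 //.
  rewrite addr0 kwE raise_epsZ ih mulrA; congr (_ * _).
  by rewrite -[LHS](qwD hq0) -intS.
elim: b x => [|b ih] x.
  by rewrite /raise_eps /= epsA_M epsA_u eqxx mulr1 /qwr /qhalf expr0z mul1r.
by rewrite !raise_eps0S E1_mul_u !ilohi o_neq mulr0 addr0 kwE raise_epsZ qw0 mul1r ih.
Qed.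

Definition kv_weight i (c : R) (x : A) := x <<| gKV q i = c%:C *: x.

Lemma kv_weight_E i j c x : kv_weight i c x ->
  kv_weight i (c * qwr (if i == j then 2 else -1)) (x <<| gE q j).
Proof.
rewrite /kv_weight -act_comp gE_gKV // actZr act_comp => ->.
rewrite actZl scalerA rmorphM mulrC; congr (_ * _ *: _).
by rewrite /KE_coef -qwN //; case: eqP.
Qed.

Lemma raise_u21_0 b x : raise_eps 0 b (x * u q o2 o1) = 0.
Proof.
elim: b x => [|b ih] x; first by rewrite /raise_eps /= epsA_M epsA_u o_neq mulr0.
by rewrite raise_eps0S E1_mul_u !ilohi o_neq mulr0 addr0 kwE raise_epsZ ih mulr0.
Qed.

(** One of the E_2 must be spent on lifting u^3_2 to the diagonal. The Leibniz rule sums over the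
    choices, and the positive weight of x keeps all summands positive. *)
Lemma raise_u21 a b c x : 0 < c -> kv_weight i2 c x -> exists2 d : R, 0 < d &
  raise_eps a.+1 b (x * u q o2 o1) = d%:C * raise_eps a b x.
Proof.
elim: a c x => [|a ih] c x c0 hx.
  exists (c * (qwr (- 0%:Z) * qwr b)); first by rewrite !mulr_gt0.
  rewrite raise_epsSl E2_mul_u raise_epsD raise_epsZ raise_u21_0 mulr0 add0r !ilohi eqxx.
  by rewrite hx -scalerAl raise_epsZ raise_u11 mulrA -rmorphM.
have [d d0 hd] := ih _ (E2 x) (mulr_gt0 c0 (qwr_gt0 _)) (kv_weight_E i2 hx).
exists (qwr 1 * d + c * (qwr (- a.+1%:Z) * qwr b)); first by rewrite addr_gt0 ?mulr_gt0.
rewrite raise_epsSl E2_mul_u raise_epsD raise_epsZ hd kwE !ilohi eqxx.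
rewrite hx -scalerAl raise_epsZ raise_u11 -raise_epsSl !mulrA -mulrDl -!rmorphM.
by rewrite -rmorphD !mulrA.
Qed.

Lemma raise_u10_0 a x : raise_eps a 0 (x * u q o1 o0) = 0.
Proof.
elim: a x => [|a ih] x; first by rewrite /raise_eps /= epsA_M epsA_u o_neq mulr0.
by rewrite raise_epsSl E2_mul_u !ilohi o_neq mulr0 addr0 kwE raise_epsZ ih mulr0.
Qed.

Lemma raise_u10_base b c x : 0 < c -> kv_weight i1 c x -> exists2 d : R, 0 < d &
  raise_eps 0 b.+1 (x * u q o1 o0) = d%:C * raise_eps 0 b x.
Proof.
elim: b c x => [|b ih] c x c0 hx.
  exists (c * qwr (- 0%:Z)); first by rewrite !mulr_gt0.
  rewrite raise_eps0S E1_mul_u raise_epsD raise_epsZ raise_u10_0 mulr0 add0r !ilohi eqxx.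
  by rewrite hx -scalerAl raise_epsZ raise_u0 eqxx mulr1 mulrA -rmorphM.
have [d d0 hd] := ih _ (E1 x) (mulr_gt0 c0 (qwr_gt0 _)) (kv_weight_E i1 hx).
exists (qwr 1 * d + c * qwr (- b.+1%:Z)); first by rewrite addr_gt0 ?mulr_gt0.
rewrite raise_eps0S E1_mul_u raise_epsD raise_epsZ hd kwE !ilohi eqxx.
rewrite hx -scalerAl raise_epsZ raise_u0 eqxx mulr1 -raise_eps0S !mulrA -mulrDl -!rmorphM.
by rewrite -rmorphD.
Qed.

Lemma raise_u10 a b c x : 0 < c -> kv_weight i1 c x -> exists2 d : R, 0 < d &
  raise_eps a b.+1 (x * u q o1 o0) = d%:C * raise_eps a b x.
Proof.
elim: a c x => [|a ih] c x c0 hx; first exact: raise_u10_base hx.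
have [d d0 hd] := ih _ (E2 x) (mulr_gt0 c0 (qwr_gt0 _)) (kv_weight_E i2 hx).
exists (qwr (-1) * d); first by rewrite mulr_gt0.
rewrite raise_epsSl E2_mul_u !ilohi o_neq mulr0 addr0 kwE raise_epsZ hd mulrA.
by rewrite -raise_epsSl -rmorphM.
Qed.

Lemma raise_u20_0 b x : raise_eps 0 b (x * u q o2 o0) = 0.
Proof.
elim: b x => [|b ih] x; first by rewrite /raise_eps /= epsA_M epsA_u o_neq mulr0.
by rewrite raise_eps0S E1_mul_u !ilohi o_neq mulr0 addr0 kwE raise_epsZ ih mulr0.
Qed.

Lemma raise_u20_0r a x : raise_eps a 0 (x * u q o2 o0) = 0.
Proof.
elim: a x => [|a ih] x; first exact: raise_u20_0.
rewrite raise_epsSl E2_mul_u raise_epsD raise_epsZ ih mulr0 add0r !ilohi eqxx.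
exact: raise_u10_0.
Qed.

Lemma raise_u20 a b c c' x : 0 < c -> 0 < c' -> kv_weight i1 c x -> kv_weight i2 c' x ->
  exists2 d : R, 0 < d & raise_eps a.+1 b.+1 (x * u q o2 o0) = d%:C * raise_eps a b x.
Proof.
elim: a c c' x => [|a ih] c c' x c0 c0' hx hx'.
  have [e e0 he] := raise_u10 0 b c0 hx.
  exists (c' * e); first by rewrite mulr_gt0.
  rewrite raise_epsSl E2_mul_u raise_epsD raise_epsZ raise_u20_0 mulr0 add0r !ilohi eqxx.
  by rewrite hx' -scalerAl raise_epsZ he mulrA -rmorphM.
have [e e0 he] := raise_u10 a.+1 b c0 hx.
have [d d0 hd] := ih _ _ (E2 x) (mulr_gt0 c0 (qwr_gt0 _)) (mulr_gt0 c0' (qwr_gt0 _))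
  (kv_weight_E i2 hx) (kv_weight_E i2 hx').
exists (qwr 1 * d + c' * e); first by rewrite addr_gt0 ?mulr_gt0.
rewrite raise_epsSl E2_mul_u raise_epsD raise_epsZ hd kwE !ilohi eqxx.
rewrite hx' -scalerAl raise_epsZ he -raise_epsSl !mulrA -mulrDl -!rmorphM.
by rewrite -rmorphD.
Qed.

Lemma zmon_zmn j k l : zmon q j k l = zmn q (nseq j o0 ++ nseq k o1 ++ nseq l o2).
Proof.
rewrite zmonE !zmn_cat mulrA.
have e n c : zmn q (nseq n c) = u q o2 c ^+ n.
  by elim: n => [|n ih]; rewrite ?zmn_nil // zmn_cons ih exprS.
by rewrite !e.
Qed.

Lemma zmon_kv1 j k l : kv_weight i1 1 (zmon q j k l).
Proof. by rewrite /kv_weight zmon_zmn zmn_KV1 // scale1r. Qed.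

Lemma zmon_kv2 j k l : exists2 c, 0 < c & kv_weight i2 c (zmon q j k l).
Proof.
pose s := nseq j o0 ++ nseq k o1 ++ nseq l o2.
exists (qwr (- (size s)%:Z)) => //.
by rewrite /kv_weight zmon_zmn zmn_KV2.
Qed.

(** The counit sees diagonal entries only: each u^3_1 needs one E_2 and one E_1, each u^3_2 one E_2,
    each u^3_3 none. *)
Lemma raise_zmon j k l a b : exists2 c : R, 0 < c &
  raise_eps a b (zmon q j k l) = c%:C * ((a == j + k)%N && (b == j))%:R.
Proof.
elim: l a b => [|l ih] a b; last first.
  have [c c0 hc] := ih a b; exists (qwr a * c); first by rewrite mulr_gt0.
  by rewrite -zmon_z2 raise_u22 hc mulrA -rmorphM.
elim: k a b => [|k ih] a b; last first.
  have -> : zmon q j k.+1 0 = zmon q j k 0 * u q o2 o1 by rewrite zmon_z1 // expr0 scale1r.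
  case: a => [|a]; first by exists 1; rewrite // raise_u21_0 addnS mulr0.
  have [w w0 hw] := zmon_kv2 j k 0.
  have [d d0 ->] := raise_u21 a b w0 hw; have [c c0 ->] := ih a b.
  by exists (d * c); rewrite ?mulr_gt0 // mulrA -rmorphM addnS eqSS.
rewrite addn0; elim: j a b => [|j ih] a b.
  by exists 1; rewrite // mul1r zmonE !expr0 !mulr1 raise_eps1.
have -> : zmon q j.+1 0 0 = zmon q j 0 0 * u q o2 o0 by rewrite zmon_z0 // expr0 scale1r.
case: a => [|a]; first by exists 1; rewrite // raise_u20_0 mulr0.
case: b => [|b]; first by exists 1; rewrite // raise_u20_0r andbF mulr0.
have [w w0 hw] := zmon_kv2 j 0 0.
have [d d0 ->] := raise_u20 a b ltr01 w0 (zmon_kv1 j 0 0) hw; have [c c0 ->] := ih a b.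
by exists (d * c); rewrite ?mulr_gt0 // mulrA -rmorphM !eqSS.
Qed.

Lemma zmon_independent (I : finType) (f : I -> nat * nat) m (c : I -> C) :
  injective f -> (forall i, ((f i).1 + (f i).2 <= m)%N) ->
  \sum_i c i *: zmon q (f i).1 (f i).2 (m - (f i).1 - (f i).2) = 0 -> forall i, c i = 0.
Proof.
move=> f_inj fm c0 i.
have [_ _ _ _ rs] := linear_of_morph (raise_eps_lin ((f i).1 + (f i).2) (f i).1).
have := congr1 (raise_eps ((f i).1 + (f i).2) (f i).1) c0.
have [-> _ _ _ _] := linear_of_morph (raise_eps_lin ((f i).1 + (f i).2) (f i).1).
rewrite rs (bigD1 i) //= big1 ?addr0 => [|j ji]; last first.
  rewrite raise_epsZ; have [d _ ->] := raise_zmon (f j).1 (f j).2 (m - (f j).1 - (f j).2)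
    ((f i).1 + (f i).2) (f i).1.
  case: andP => [[/eqP e1 /eqP e2]|_]; last by rewrite !mulr0.
  case/eqP: ji; apply: f_inj; move: e1; rewrite e2 => /addnI e3.
  by rewrite [f j]surjective_pairing [f i]surjective_pairing e2 e3.
rewrite raise_epsZ.
have [d d0 ->] := raise_zmon (f i).1 (f i).2 (m - (f i).1 - (f i).2) ((f i).1 + (f i).2) (f i).1.
rewrite !eqxx mulr1 => /eqP; rewrite mulf_eq0 => /orP[/eqP //|].
by rewrite (negbTE (real_neq0 d0)).
Qed.

End Independence.

(** * Sections of the line bundles *)

Section HilbertSpace.
Local Open Scope complex_scope.
Variables (R : realType) (q : R).
Hypotheses (hq0 : 0 < q) (hq1 : q < 1).
Local Notation C := R[i].
Local Notation A := (SUq3 q).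
Variables (U : Uq_hopf q) (act : right_action U).
Local Notation "a <<| k" := (act a k) (at level 39, left associativity).
Variables (D : SUq3_coproduct q) (h : haar_state D) (L : L2_space h).
Local Notation hform := (hform h).
Implicit Types x y : L.

Lemma dotDr x y y' : dot L x (y + y') = dot L x y + dot L x y'.
Proof. by have [_ e _ _ _] := linear_of_morph (dot_lin (l:=L) x); rewrite e. Qed.
Lemma dotZr c x y : dot L x (c *: y) = c * dot L x y.
Proof. by have [_ _ e _ _] := linear_of_morph (dot_lin (l:=L) x); rewrite e. Qed.
Lemma dotNr x y : dot L x (- y) = - dot L x y.
Proof. by have [_ _ _ e _] := linear_of_morph (dot_lin (l:=L) x); rewrite e. Qed.
Lemma dot0r x : dot L x 0 = 0.
Proof. by have [e _ _ _ _] := linear_of_morph (dot_lin (l:=L) x); rewrite e. Qed.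
Lemma dot_sumr x I (r : seq I) (P : pred I) F :
  dot L x (\sum_(i <- r | P i) F i) = \sum_(i <- r | P i) dot L x (F i).
Proof. by have [_ _ _ _ e] := linear_of_morph (dot_lin (l:=L) x); rewrite e. Qed.
Lemma dotDl x x' y : dot L (x + x') y = dot L x y + dot L x' y.
Proof. by rewrite dot_conj dotDr rmorphD /= -!(dot_conj (l := L)). Qed.
Lemma dotZl c x y : dot L (c *: x) y = Num.conj c * dot L x y.
Proof. by rewrite dot_conj dotZr rmorphM /= -(dot_conj (l := L)). Qed.
Lemma dot0l y : dot L 0 y = 0.
Proof. by rewrite dot_conj dot0r rmorph0. Qed.

Lemma dot_eq0 x : dot L x x = 0 -> x = 0.
Proof. by rewrite dot_norm => /eqP; rewrite expf_eq0 normr_eq0 /= => /eqP. Qed.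

Lemma emb0 : emb L 0 = 0.
Proof. by have [e _ _ _ _] := linear_of_morph (emb_lin L). Qed.
Lemma embD a b : emb L (a + b) = emb L a + emb L b.
Proof. by have [_ e _ _ _] := linear_of_morph (emb_lin L); rewrite e. Qed.
Lemma embZ c a : emb L (c *: a) = c *: emb L a.
Proof. by have [_ _ e _ _] := linear_of_morph (emb_lin L); rewrite e. Qed.
Lemma embN a : emb L (- a) = - emb L a.
Proof. by have [_ _ _ e _] := linear_of_morph (emb_lin L); rewrite e. Qed.
Lemma emb_sum I (r : seq I) (P : pred I) F :
  emb L (\sum_(i <- r | P i) F i) = \sum_(i <- r | P i) emb L (F i).
Proof. by have [_ _ _ _ e] := linear_of_morph (emb_lin L); rewrite e. Qed.

Lemma dot_emb a b : dot L (emb L a) (emb L b) = hform a b.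
Proof. exact: emb_dot. Qed.

Lemma emb_inj : injective (emb L).
Proof.
move=> a b e; apply/eqP; rewrite -subr_eq0; apply/eqP; apply: (hform_eq0 (h := h)).
by rewrite -dot_emb embD embN e subrr dot0r.
Qed.

Lemma dot_emb_closed x : lin_closed (fun a => dot L (emb L a) x = 0).
Proof.
by split=> [|c a b ha hb]; rewrite ?emb0 ?dot0l // embD embZ dotDl dotZl ha hb mulr0 addr0.
Qed.

Lemma cauchy_schwarz x y : `|dot L x y| <= `|x| * `|y|.
Proof.
have [->|x0] := eqVneq x 0; first by rewrite dot0l !normr0 mul0r.
have n0 : 0 < `|x| ^+ 2 by rewrite exprn_gt0 // normr_gt0.
set d := dot L x y; pose y' := y - (d / `|x| ^+ 2) *: x.
have e1 : dot L x y' = 0.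
  by rewrite dotDr dotNr dotZr dot_norm divfK ?gt_eqF // subrr.
have e2 : dot L y' y' = `|y| ^+ 2 - `|d| ^+ 2 / `|x| ^+ 2.
  rewrite {2}/y' dotDr dotNr dotZr [dot L y' x]dot_conj e1 conjC0 mulr0 subr0.
  rewrite [dot L y' y]dot_conj dotDr dotNr dotZr dot_norm [dot L y x]dot_conj -/d.
  have r1 : Num.conj (`|x| ^- 2) = `|x| ^- 2.
    by apply: CrealP; rewrite rpredV rpredX // normr_real.
  have r2 : Num.conj (`|y| ^+ 2) = `|y| ^+ 2.
    by apply: CrealP; rewrite rpredX // normr_real.
  by rewrite rmorphB /= r2 (rmorphM Num.conj (d / _)) /= conjCK (rmorphM Num.conj d) /=
    r1 normCK mulrAC [Num.conj d * d]mulrC.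
have : 0 <= dot L y' y' by rewrite dot_norm exprn_ge0 // normr_ge0.
rewrite e2 subr_ge0 ler_pdivrMr // -exprMn mulrC.
by rewrite ler_pXn2r // ?nnegrE ?mulr_ge0 ?normr_ge0.
Qed.

Lemma small_eq0 (z M : C) : 0 <= M -> (forall e, 0 < e -> `|z| <= M * e) -> z = 0.
Proof.
move=> M0 hz; apply/eqP/negPn/negP => z0.
have nz : 0 < `|z| by rewrite normr_gt0.
have M1 : 0 < M + 1 by apply: ltr_wpDl.
have := hz (`|z| / (M + 1)) (divr_gt0 nz M1).
rewrite mulrA ler_pdivlMr // mulrDr mulr1 mulrC gerDl => /(lt_le_trans nz).
by rewrite ltxx.
Qed.

Lemma closure_near (S : set L) x (V : set L) : closure S x -> nbhs x V ->
  exists y, S y /\ V y.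
Proof. by move=> cS /cS [y [Sy Vy]]; exists y. Qed.

Lemma norm_ball_nbhs x (e : C) : 0 < e -> nbhs x [set y | `|x - y| < e].
Proof. by move=> e0; apply/nbhs_normP; exists e. Qed.

Lemma closure_dot_eq0 (S : set L) y : (forall x, S x -> dot L y x = 0) ->
  forall x, closure S x -> dot L y x = 0.
Proof.
move=> hS x cx; apply: (@small_eq0 _ `|y|); first exact: normr_ge0.
move=> e e0; have [x' [Sx' /= xx']] := closure_near cx (norm_ball_nbhs x e0).
have -> : dot L y x = dot L y (x - x') by rewrite dotDr dotNr (hS _ Sx') subr0.
apply: (le_trans (cauchy_schwarz _ _)).
by rewrite ler_wpM2l ?normr_ge0 // ltW.
Qed.

Lemma dense_dot_eq0 x : (forall a, dot L (emb L a) x = 0) -> x = 0.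
Proof.
move=> hx; apply: dot_eq0; rewrite dot_conj.
have -> : dot L x x = 0; last exact: rmorph0.
apply: (@closure_dot_eq0 (range (emb L))); last by rewrite emb_dense.
by move=> _ [a _ <-]; rewrite dot_conj hx rmorph0.
Qed.

(** Clear on the dense image of [emb]; both sides are continuous in x. *)
Lemma lmul_adj a b x : dot L (emb L b) (lmul L a x) = dot L (emb L (star a * b)) x.
Proof.
pose g y := dot L (emb L b) (lmul L a y) - dot L (emb L (star a * b)) y.
have [_ lD _ lN _] := linear_of_morph (lmul_lin (l:=L) a).
have gB y z : g (y - z) = g y - g z.
  by rewrite /g lD lN !dotDr !dotNr !opprD !opprK addrACA.
have gemb c : g (emb L c) = 0.
  by rewrite /g lmul_emb !dot_emb /hform starM starK mulrA subrr.
apply/eqP; rewrite -subr_eq0 -/(g x); apply/eqP.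
apply: (@small_eq0 _ (`|emb L b| + `|emb L (star a * b)|)).
  by rewrite addr_ge0 ?normr_ge0.
move=> e e0.
have n1 := norm_ball_nbhs x e0.
have n2 : nbhs x (lmul L a @^-1` [set y | `|lmul L a x - y| < e]).
  by apply: lmul_cont; apply: norm_ball_nbhs.
have cx : closure (range (emb L)) x by rewrite emb_dense.
have [_ [[c _ <-] [/= h1 h2]]] := closure_near cx (filterI n1 n2).
have -> : g x = g (x - emb L c) by rewrite gB gemb subr0.
rewrite /g mulrDl; apply: (le_trans (ler_normB _ _)); apply: lerD.
  apply: (le_trans (cauchy_schwarz _ _)); rewrite lD lN.
  by rewrite ler_wpM2l ?normr_ge0 // ltW.
by apply: (le_trans (cauchy_schwarz _ _)); rewrite ler_wpM2l ?normr_ge0 // ltW.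
Qed.

(** Against an element of one block the formal sum reduces to the algebraic adjoint on the block
    projections, and blocks span. From here on the action on L^2 is used only in this weak form. *)
Lemma L2_act_adj k k' x y : adjoint act h k' k -> L2_act act x k y ->
  forall b, dot L (emb L b) y = dot L (emb L (b <<| k')) x.
Proof.
move=> adj hxy b; apply/eqP; rewrite -subr_eq0; apply/eqP; move: b.
apply: (block_span_ind hq0 hq1 (act := act) h
  (P := fun b => dot L (emb L b) y - dot L (emb L (b <<| k')) x = 0)).
  split=> [|c a b]; first by rewrite act0l emb0 !dot0l subrr.
  move=> ha hb; rewrite actDl actZl !embD !embZ !dotDl !dotZl opprD addrACA.
  by rewrite -mulrBr ha hb mulr0 addr0.
move=> n1 n2 b hb; have [a [_ ax] [_ ay]] := hxy n1 n2.
have := ay b hb; rewrite dotDr dotNr => /eqP; rewrite subr_eq0 => /eqP ->.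
have := ax _ (block_act k' hb); rewrite dotDr dotNr => /eqP; rewrite subr_eq0 => /eqP ->.
by rewrite !dot_emb adj subrr.
Qed.

Lemma L2_act_emb a k : L2_act act (emb L a) k (emb L (a <<| k)).
Proof.
move=> n1 n2; have [b [hb hb']] := block_projection_exists hq0 hq1 act h n1 n2 a.
have emb_diff c c' d : dot L (emb L d) (emb L c - emb L c') = hform d (c - c').
  by rewrite -embN -embD dot_emb.
exists b; split=> //; first by move=> b' h'; rewrite emb_diff hb'.
  exact: block_act.
move=> b' h'; rewrite emb_diff -actNl -actDl.
have [k' hk'] := adjoint_exists' hq0 act h k.
by rewrite -hk' hb' //; apply: block_act.
Qed.

End HilbertSpace.

(** * Conjugation by Psi *)

Section Potential.
Local Open Scope complex_scope.
Variables (R : realType) (q : R).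
Hypotheses (hq0 : 0 < q) (hq1 : q < 1).
Local Notation C := R[i].
Local Notation A := (SUq3 q).
Variables (U : Uq_hopf q) (act : right_action U).
Local Notation "a <<| k" := (act a k) (at level 39, left associativity).

Lemma qw_double M : (q ^ M)%:C = qw q M * qw q M.
Proof.
rewrite /qw -rmorphM /qhalf -exprzMl ?unitfE ?(sqrt_q_neq0 hq0) //.
by rewrite -expr2 sqr_sqrtr // ltW.
Qed.

Definition psi_star_of (M : int) (t : idx M) : A := psi_star q M t.1.1 t.1.2 t.2.
Definition psi_of (M : int) (t : idx M) : A := psi q M t.1.1 t.1.2 t.2.

Lemma star_psi_of M (t : idx M) : star (psi_of t) = psi_star_of t.
Proof. exact: starK. Qed.

Lemma psi_sum M : \sum_(t : idx M | idx_ok t) psi_star_of t * psi_of t = 1.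
Proof.
rewrite (simplex_sum_triple _ (fun j k l => psi_star q M j k l * psi q M j k l)).
have sqrtT j k l : Num.sqrt (qtrinom q j k l) ^+ 2 = qtrinom q j k l.
  by rewrite sqr_sqrtr // ltW // qtrinom_gt0.
have [M0|M0] := leP 0 M.
  rewrite -[RHS](sum_psi_pos hq0 hq1 `|M|); apply: simplex_sum_eq => j k l _.
  by rewrite /psi /psi_star M0 star_scale_mul sqrtT.
rewrite -[RHS](sum_psi_neg hq0 hq1 `|M|); apply: simplex_sum_eq => j k l e.
rewrite /psi /psi_star leNgt M0 /= star_scale_mul starK exprMn sqrtT -rmorphM.
congr ((_ * _)%:C *: _).
(* On the index set -M = j + k + l. *)
have -> : - M + j%:Z - l%:Z = (2 * j + k)%N%:Z.
  rewrite -(ltz0_abs M0) -e; lia.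
by rewrite -exprnP -exprM; congr (_ ^+ _); lia.
Qed.

(* Highest weight vectors of weight (0, m) for the right action, such as the monomials of
   degree m in the z_j. *)
Definition holomorphic (m : nat) (a : A) : Prop :=
  [/\ a <<| gK q i1 = a, a <<| gKV q i1 = a, a <<| gK q i2 = qw q m *: a,
      a <<| gKV q i2 = qw q (- m%:Z) *: a & a <<| gE q i1 = 0 /\ forall i, a <<| gF q i = 0].

Lemma holomorphic_closed m : lin_closed (holomorphic m).
Proof.
split=> [|c x y [x1 x2 x3 x4 [x5 x6]] [y1 y2 y3 y4 [y5 y6]]].
  by split; rewrite ?act0l ?scaler0 //; split=> // *; rewrite act0l.
split; rewrite ?actDl ?actZl ?x1 ?x2 ?x3 ?x4 ?x5 ?y1 ?y2 ?y3 ?y4 ?y5 //.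
- by rewrite scalerDr !scalerA mulrC.
- by rewrite scalerDr !scalerA mulrC.
- by split=> [|i]; rewrite ?actDl ?actZl ?x6 ?y6 scaler0 addr0.
Qed.

Lemma zmn_holomorphic s : holomorphic (size s) (zmn q s).
Proof.
split; [exact: zmn_K1|exact: zmn_KV1|exact: zmn_K2|exact: zmn_KV2|].
by split=> [|i]; [exact: zmn_E1|exact: zmn_F].
Qed.

Lemma zmon_holomorphic j k l : holomorphic (j + k + l) (zmon q j k l).
Proof.
have := zmn_holomorphic (nseq j o0 ++ nseq k o1 ++ nseq l o2).
by rewrite -zmon_zmn !size_cat !size_nseq addnA.
Qed.

Lemma psi_star_holomorphic M (t : idx M) : 0 <= M -> idx_ok t ->
  holomorphic `|M| (psi_star_of t).
Proof.
move=> M0 /eqP <-; rewrite /psi_star_of /psi_star M0.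
by apply: lin_closedZ (holomorphic_closed _) _ _ _; apply: zmon_holomorphic.
Qed.

Lemma psi_holomorphic M (t : idx M) : M < 0 -> idx_ok t -> holomorphic `|M| (psi_of t).
Proof.
move=> M0 /eqP <-; rewrite /psi_of /psi /psi_star leNgt M0 /= starZ starK.
by apply: lin_closedZ (holomorphic_closed _) _ _ _; apply: zmon_holomorphic.
Qed.

Lemma psi_KV2 M (t : idx M) : idx_ok t -> psi_of t <<| gKV q i2 = qw q M *: psi_of t.
Proof.
move=> ok; have [M0|M0] := leP 0 M.
  have [_ _ e _ _] := psi_star_holomorphic M0 ok.
  by rewrite act_star_KV e starZ conj_qw gez0_abs.
have [_ _ _ e _] := psi_holomorphic M0 ok.
by rewrite e ltz0_abs // opprK.
Qed.

Lemma psi_star_E2 M (t : idx M) : M < 0 -> idx_ok t -> psi_star_of t <<| gE q i2 = 0.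
Proof.
move=> M0 ok; have [_ _ _ _ [_ e]] := psi_holomorphic M0 ok.
by rewrite -star_psi_of (act_star_E hq0) e star0 scaler0.
Qed.

Lemma psi_star_KV2 M (t : idx M) : idx_ok t ->
  psi_star_of t <<| gKV q i2 = qw q (- M) *: psi_star_of t.
Proof.
move=> ok; rewrite -star_psi_of act_star_KV.
have -> : psi_of t <<| gK q i2 = qw q (- M) *: psi_of t.
  rewrite -[psi_of t in RHS](act_KVK act _ i2) psi_KV2 // actZl scalerA -qwD //.
  by rewrite addNr qw0 scale1r.
by rewrite starZ conj_qw.
Qed.

(** For M >= 0 each entry of Psi is killed by E_2. For M < 0 each entry of its adjoint is, and the
    sum is, up to a nonzero scalar, E_2 applied to Psi^dagger Psi = 1. *)
Lemma sum_psi_E2 M : \sum_(t : idx M | idx_ok t) psi_star_of t * (psi_of t <<| gE q i2) = 0.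
Proof.
have [M0|M0] := leP 0 M.
  rewrite big1 // => t ok; have [_ _ _ _ [_ e]] := psi_star_holomorphic M0 ok.
  by rewrite (act_star_E hq0) e star0 scaler0 mulr0.
have := congr1 (fun a => a <<| gE q i2) (psi_sum M).
rewrite act1 epsUE scale0r act_suml.
under eq_bigr => t ok do
  rewrite act_mulE psi_star_E2 // mul0r add0r psi_star_KV2 // -scalerAl.
by move/eqP; rewrite -scaler_sumr scaler_eq0 (negbTE (qw_neq0 hq0 _)) => /eqP.
Qed.

Lemma psi_conj_E2 M b :
  \sum_(t : idx M | idx_ok t) psi_star_of t * ((psi_of t * b) <<| gE q i2)
  = qw q M *: (b <<| gE q i2).
Proof.
under eq_bigr => t ok do rewrite act_mulE psi_KV2 // mulrDr mulrA -scalerAl -scalerAr mulrA.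
by rewrite big_split /= -mulr_suml sum_psi_E2 mul0r add0r -scaler_sumr -mulr_suml psi_sum mul1r.
Qed.

(** F_2 kills both a and the entries of Psi^dagger, so only Psi is differentiated, and Psi^dagger
    (Psi <| F_2) vanishes by applying F_2 to Psi^dagger Psi = 1. *)
Lemma psi_conj_F2 M m a : 0 <= M -> holomorphic m a ->
  \sum_(t : idx M | idx_ok t) psi_star_of t * ((psi_of t * a) <<| gF q i2) = 0.
Proof.
move=> M0 [_ _ aK _ [_ aF]].
have := congr1 (fun a => a <<| gF q i2) (psi_sum M).
rewrite act1 epsUF scale0r act_suml.
under eq_bigr => t ok.
  have [_ _ _ _ [_ e]] := psi_star_holomorphic M0 ok.
  rewrite act_mulF e mul0r add0r psi_star_KV2 // -scalerAl; over.
move/eqP; rewrite -scaler_sumr scaler_eq0 (negbTE (qw_neq0 hq0 _)) => /eqP e0.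
under eq_bigr => t _ do rewrite act_mulF (aF i2) mulr0 addr0 mulrA.
by rewrite -mulr_suml e0 mul0r.
Qed.

(** The entries of Psi^dagger are killed by F_1 and fixed by K_1^-1, so F_1 applied to the preceding
    identity acts on the right factors alone. *)
Lemma psi_conj_F2F1 M m a : 0 <= M -> holomorphic m a ->
  \sum_(t : idx M | idx_ok t) psi_star_of t * ((psi_of t * a) <<| (gF q i2 * gF q i1)) = 0.
Proof.
move=> M0 ha; have := congr1 (fun b => b <<| gF q i1) (psi_conj_F2 M0 ha).
rewrite act_suml act0l => {2}<-.
apply: eq_bigr => t ok; have [_ eK _ _ [_ e]] := psi_star_holomorphic M0 ok.
by rewrite act_mulF e mul0r add0r eK act_comp.
Qed.

Lemma zmn_zmon s : exists (c : C) j k l, (j + k + l)%N = size s /\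
  zmn q s = c *: zmon q j k l.
Proof.
elim: s => [|a s [c [j [k [l [e es]]]]]].
  by exists 1, 0, 0, 0; rewrite zmn_nil scale1r /zmon !expr0 !mulr1.
rewrite zmn_cons es -scalerAr /= -e; case: (ord3_case a) => ->.
- by exists c, j.+1, k, l; rewrite z0_zmon.
- exists (c * (q%:C)^-1 ^+ j), j, k.+1, l; rewrite z1_zmon // scalerA.
  by rewrite addnS addSn.
- exists (c * (q%:C)^-1 ^+ (j + k)), j, k, l.+1; rewrite z2_zmon // scalerA.
  by rewrite addnS.
Qed.

End Potential.

(** * The kernel of the connection *)

Section Kernel.
Local Open Scope complex_scope.
Variables (R : realType) (q : R).
Hypotheses (hq0 : 0 < q) (hq1 : q < 1).
Local Notation C := R[i].
Local Notation A := (SUq3 q).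
Variables (U : Uq_hopf q) (act : right_action U).
Local Notation "a <<| k" := (act a k) (at level 39, left associativity).
Variables (D : SUq3_coproduct q) (h : haar_state D) (L : L2_space h).
Local Notation hform := (hform h).
Local Notation holomorphic := (holomorphic act).
Implicit Types x y : L.

(** Weak form of the connection: multiplication by Psi and Psi^dagger and the action are all moved
    to the test element b, where they are algebraic. *)
Lemma lmul_sum_conj I (r : seq I) (P : pred I) (s p : I -> A) (y : I -> L) x k k' b :
  (forall t, star (s t) = p t) -> adjoint act h k' k ->
  (forall t, P t -> L2_act act (lmul L (p t) x) k (y t)) ->
  dot L (emb L b) (\sum_(t <- r | P t) lmul L (s t) (y t)) =
  dot L (emb L (\sum_(t <- r | P t) s t * ((p t * b) <<| k'))) x.
Proof.
move=> sp adj hy; rewrite dot_sumr emb_sum.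
have dot_suml F : dot L (\sum_(t <- r | P t) F t) x = \sum_(t <- r | P t) dot L (F t) x.
  by rewrite dot_conj dot_sumr rmorph_sum; apply: eq_bigr => t _ /=; rewrite -dot_conj.
rewrite dot_suml; apply: eq_bigr => t Pt.
by rewrite lmul_adj (L2_act_adj hq0 hq1 adj (hy t Pt)) lmul_adj sp -sp starK.
Qed.

(* [x] is orthogonal to everything [E_1] and [E_2] produce, and to all highest weight
   vectors but those of weight (0, M). *)
Definition cohighest (M : int) x : Prop :=
  (forall b i, dot L (emb L (b <<| gE q i)) x = 0) /\
  (forall r s, size r != 0%N \/ (size s)%:Z != M -> dot L (emb L (wmn q r * zmn q s)) x = 0).

(* [E_1]: sections are invariant under [F_1].  [E_2]: the connection is F_2, conjugated by
   [Psi] into a scalar multiple of F_2, and its adjoint is a multiple of E_2. *)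
Lemma H0_cohighest M x : H0 act L M x -> cohighest M x.
Proof.
move=> [clx [w [hw e]]]; split=> [b i|r s rs].
  case: (ord2_case i) => ->.
    move: x clx {hw e}; apply: closure_dot_eq0 => _ [a [aS _] <-].
    rewrite dot_emb (adjointE hq0) actZr (aS _ (subalg_KEF1_F q)) epsUF scale0r.
    by rewrite scaler0 hform0r.
  have adj : adjoint act h ((q ^- 2)%:C *: gE q i2) (gF q i2).
    move=> a c; rewrite actZr hformZl (adjointE hq0) actZr hformZr conj_real mulrA.
    by rewrite -rmorphM mulVf ?mul1r // expf_eq0 gt_eqF.
  have [_ /esym/eqP] := e; rewrite scaler_eq0 => /orP[/eqP q0|/eqP e0].
    have : (q ^ (- M)) != 0 by rewrite expfz_neq0 // gt_eqF.
    by move: q0 => [->]; rewrite eqxx.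
  have := congr1 (dot L (emb L b)) e0; rewrite dot0r.
  rewrite (lmul_sum_conj (x := x) _ b (p := @psi_of _ q M) (k := gF q i2) _ adj).
  - under eq_bigr => t _ do rewrite actZr -scalerAr.
    rewrite -scaler_sumr (psi_conj_E2 hq0 hq1) scalerA embZ dotZl => /eqP.
    rewrite mulf_eq0 conjC_eq0 mulf_eq0 (negbTE (qw_neq0 hq0 _)) orbF.
    case/orP=> /eqP // [q0]; have : q ^- 2 != 0 by rewrite invr_neq0 // expf_neq0 // gt_eqF.
    by rewrite q0 eqxx.
  - by [].
  - by move=> t ok; have [_] := hw t ok.
move: x clx {hw e}; apply: closure_dot_eq0 => _ [a [aS /= aK] <-].
rewrite dot_emb; have [gF' gK'] := is_hw_mon hq0 act r s; set g := wmn q r * zmn q s in gF' gK' *.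
have aK1 : a <<| gK q i1 = a by rewrite (aS _ (subalg_KEF1_K q)) epsUK scale1r.
(* Since K_1 acts trivially on sections, the degree prescribes K_2^2 only; the weights are therefore
   compared after doubling. *)
have aK2 : a <<| gK q i2 <<| gK q i2 = (q ^ M)%:C *: a.
  by rewrite -aK act_comp aK1 expr2 act_comp.
apply/eqP/negPn/negP => g0; have cancel c d : c * hform g a = d * hform g a -> c = d.
  exact: (mulIf g0).
have r0 : size r = 0%N.
  have : qw q (size r)%:Z = qw q 0.
    apply: cancel; rewrite qw0 mul1r -{2}aK1 -(adjointK hq0) (gK' i1).
    by rewrite hformZl conj_lw.
  by move/(qw_inj hq0 hq1) => [].
case: rs => [/eqP //|/eqP]; apply; suff : qw q ((size s)%:Z + (size s)%:Z) = qw q (M + M).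
  by move/(qw_inj hq0 hq1); lia.
apply: cancel; rewrite !qwD // -(qw_double hq0 M) -[RHS]hformZr -aK2 -!(adjointK hq0).
by rewrite (gK' i2) actZl (gK' i2) !hformZl conj_lw mulrA.
Qed.

Lemma holomorphic_H0 (N : nat) a : holomorphic N a -> H0 act L N%:Z (emb L a).
Proof.
move=> ha; have [K1 KV1 K2 _ [E1 F]] := ha.
have ln : line_bundle act N%:Z a.
  split=> [k|/=]; last first.
    rewrite act_comp -/i1 K1 expr2 act_comp -/i2 K2 actZl K2 scalerA -qw_double //.
  elim=> {k} [|||||c k l _ IHk _ IHl|k l _ IHk _ IHl].
  - by rewrite epsUK scale1r.
  - by rewrite epsUKV scale1r.
  - by rewrite epsUE scale0r.
  - by rewrite epsUF scale0r F.
  - by rewrite epsU1 scale1r act_id.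
  - by rewrite actDr actZr IHk IHl epsU_lin scalerDl scalerA.
  - by rewrite act_comp IHk actZl IHl epsUM scalerA.
split; first by apply: subset_closure; exists a.
exists (fun t => (emb L ((psi_of q t * a) <<| (gF q i2 * gF q i1)),
                  emb L ((psi_of q t * a) <<| gF q i2))); split=> [t _|].
  by rewrite lmul_emb; split; apply: L2_act_emb.
congr (_, _); apply/esym; under eq_bigr => t _ do rewrite lmul_emb.
  by rewrite -emb_sum (psi_conj_F2F1 hq0 hq1 _ ha) // emb0 scaler0.
by rewrite -emb_sum (psi_conj_F2 hq0 hq1 _ ha) // emb0 scaler0.
Qed.

Lemma cohighest_eq0 M x : cohighest M x ->
  (forall s, (size s)%:Z = M -> dot L (emb L (zmn q s)) x = 0) -> x = 0.
Proof.
move=> [xE xM] xz; apply: dense_dot_eq0.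
apply: (hw_mon_ind hq0 (act := act) (P := fun a => dot L (emb L a) x = 0)).
  exact: dot_emb_closed.
move=> r s; apply: (hw_elim hq0 (is_hw_mon hq0 act r s) (dot_emb_closed x)) => //.
have [r0|r0] := eqVneq (size r) 0%N; last by apply: xM; left.
have [sM|sM] := eqVneq (size s)%:Z M; last by apply: xM; right.
by rewrite (size0nil r0) wmn_nil mul1r; apply: xz.
Qed.

(** Orthogonal projection onto a finite span. A row in the kernel of the Gram matrix would give an
    element of the span orthogonal to itself. *)
Lemma gram_projection n (e : 'I_n -> A) x : lindep e ->
  exists c, forall i, dot L (emb L (e i)) (x - emb L (lcomb e c)) = 0.
Proof.
move=> ie; pose G := \matrix_(i, j) hform (e j) (e i).
have GE c i : (c *m G) 0 i = hform (e i) (lcomb e c).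
  have [_ _ _ _ hs] := linear_of_morph (hform_lin h (e i)).
  by rewrite mxE /lcomb hs; apply: eq_bigr => j _; rewrite mxE hformZr.
have uG : G \in unitmx.
  rewrite -row_free_unit -kermx_eq0; apply/eqP/row_matrixP => i.
  rewrite row0; apply: ie; apply: (hform_eq0 (h := h)).
  have ker j : hform (e j) (lcomb e (row i (kermx G))) = 0.
    by rewrite -GE -row_mul mulmx_ker row0 mxE.
  apply: (lin_closed_lcomb (P := fun a => hform a (lcomb e (row i (kermx G))) = 0)) => //.
  split=> [|c a b ha hb]; first exact: hform0l.
  by rewrite hformDl hformZl ha hb mulr0 addr0.
exists ((\row_i dot L (emb L (e i)) x) *m invmx G) => i.
by rewrite dotDr dotNr dot_emb -GE mulmxKV // mxE subrr.
Qed.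

End Kernel.

(** * Holomorphic sections and their dimension *)

Lemma card_simplex2 N :
  #|[pred t : 'I_N.+1 * 'I_N.+1 | (t.1 + t.2 <= N)%N]| = ((N + 1) * (N + 2) %/ 2)%N.
Proof.
have -> : ((N + 1) * (N + 2) %/ 2)%N = (\sum_(i < N.+1) (N.+1 - i))%N.
  suff e : ((\sum_(i < N.+1) (N.+1 - i)) * 2 = (N + 1) * (N + 2))%N by rewrite -e mulnK.
  elim: N => [|N IH]; first by rewrite big_ord1.
  by rewrite big_ord_recl mulnDl IH /=; lia.
rewrite -sum1_card (eq_bigl (fun t : 'I_N.+1 * 'I_N.+1 => true && (t.2 < N.+1 - t.1)%N)).
  rewrite -(pair_big_dep predT (fun i j : 'I_N.+1 => (j < N.+1 - i)%N) (fun _ _ => 1%N)) /=.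
  apply: eq_bigr => i _; rewrite (big_ord_narrow (leq_subr i N.+1)).
  by rewrite sum1_card card_ord.
by move=> t; rewrite !inE /=; lia.
Qed.

Section HolomorphicSections.
Local Open Scope complex_scope.
Variables (R : realType) (q : R).
Hypotheses (hq0 : 0 < q) (hq1 : q < 1).
Local Notation C := R[i].
Local Notation A := (SUq3 q).
Variables (U : Uq_hopf q) (act : right_action U).
Variables (D : SUq3_coproduct q) (h : haar_state D) (L : L2_space h).

Lemma H0_negative M : M < 0 -> H0 act L M = [set 0].
Proof.
move=> M0; apply/seteqP; split=> [x hx|_ ->] /=.
  apply: (cohighest_eq0 hq0 (H0_cohighest hq0 hq1 hx)) => s e.
  by move: M0; rewrite -e.
(* Conversely, 0 has to be exhibited in the graph of the connection. *)
have ln : line_bundle act M 0 by split=> [k _|/=]; rewrite act0l scaler0.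
have lmul0 a : lmul L a 0 = 0.
  by have [e _ _ _ _] := linear_of_morph (lmul_lin (l := L) a).
split; first by apply: subset_closure; exists 0 => //; exact: emb0.
exists (fun=> (0, 0)); split=> [t _|].
  have act0 k : L2_act act (0 : L) k 0.
    by have := @L2_act_emb _ _ hq0 hq1 _ act _ _ L 0 k; rewrite act0l emb0.
  by rewrite lmul0; split; apply: act0.
by under eq_bigr => t _ do rewrite lmul0; rewrite big1 // scaler0.
Qed.

Variable N : nat.
Let n := #|[pred t : 'I_N.+1 * 'I_N.+1 | (t.1 + t.2 <= N)%N]|.
Definition zexp (i : 'I_n) : nat * nat := ((enum_val i).1 : nat, (enum_val i).2 : nat).
Definition zbasis (i : 'I_n) : A :=
  zmon q (zexp i).1 (zexp i).2 (N - (zexp i).1 - (zexp i).2).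

Lemma zexp_le i : ((zexp i).1 + (zexp i).2 <= N)%N.
Proof. exact: (enum_valP i). Qed.

Lemma zbasis_lindep : lindep zbasis.
Proof.
have zexp_inj : injective zexp.
  move=> i j [e1 e2]; apply: enum_val_inj; apply/eqP.
  by rewrite -pair_eqE; apply/andP; split; apply/eqP; apply: val_inj.
move=> c hc; apply/rowP => i; rewrite mxE.
exact: (zmon_independent hq0 act (c := fun i => c 0 i) zexp_inj zexp_le hc).
Qed.

Lemma zbasis_all j k l : (j + k + l)%N = N -> exists i, zmon q j k l = zbasis i.
Proof.
move=> e; have jN : (j < N.+1)%N by lia.
have kN : (k < N.+1)%N by lia.
have ok : (Ordinal jN, Ordinal kN) \in [pred t : 'I_N.+1 * 'I_N.+1 | (t.1 + t.2 <= N)%N].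
  by rewrite inE /=; lia.
exists (enum_rank_in ok (Ordinal jN, Ordinal kN)).
by rewrite /zbasis /zexp enum_rankK_in //=; congr zmon; lia.
Qed.

Lemma zbasis_holomorphic i : holomorphic act N (zbasis i).
Proof.
have := zmon_holomorphic hq0 act (zexp i).1 (zexp i).2 (N - (zexp i).1 - (zexp i).2).
by congr holomorphic; have := zexp_le i; lia.
Qed.

(** Subtracting from x its orthogonal projection onto the monomials leaves a [cohighest] vector that
    is also orthogonal to all words of length N in z, hence 0. *)
Lemma H0_positive x : H0 act L N%:Z x <-> exists c, x = emb L (lcomb zbasis c).
Proof.
have hol c : holomorphic act N (lcomb zbasis c).
  by apply: lin_closed_lcomb (holomorphic_closed _ _) zbasis_holomorphic _.
split=> [hx|[c ->]]; last exact: holomorphic_H0.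
have [c hc] := gram_projection x zbasis_lindep; exists c.
have [xE xz] := H0_cohighest hq0 hq1 hx.
have [aE az] := H0_cohighest hq0 hq1 (holomorphic_H0 hq0 hq1 L (hol c)).
apply/eqP; rewrite -subr_eq0; apply/eqP; apply: (@cohighest_eq0 _ _ hq0 _ act _ _ _ N%:Z).
  split=> [b i|r s rs]; first by rewrite dotDr dotNr xE aE subrr.
  by rewrite dotDr dotNr xz // az // subrr.
move=> s [sN]; have [d [j [k [l [e ->]]]]] := zmn_zmon hq0 s.
have [i ->] := zbasis_all (etrans e sN).
by rewrite embZ dotZl hc mulr0.
Qed.

Definition zsection (c : 'rV[C]_n) : L := emb L (lcomb zbasis c).

Lemma zsection_linear : linear zsection.
Proof. by move=> x c d; rewrite /zsection lcomb_lin emb_lin. Qed.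

HB.instance Definition _ := GRing.isLinear.Build C 'rV[C]_n L *:%R zsection zsection_linear.

Lemma H0_positive_iso :
  exists f : {linear 'rV[C]_n -> L}, injective f /\ range f = H0 act L N%:Z.
Proof.
exists zsection; split=> [c d /emb_inj e|].
  apply/eqP; rewrite -subr_eq0; apply/eqP; apply: zbasis_lindep.
  have [_ eD _ eN _] := linear_of_morph (lcomb_lin zbasis).
  by rewrite eD eN e subrr.
apply/seteqP; split=> [_ [c _ <-]|x /H0_positive [c ->]]; last by exists c.
by apply/H0_positive; exists c.
Qed.

End HolomorphicSections.

Theorem theorem5p1 (R : realType) (q : R) (hq0 : 0 < q) (hq1 : q < 1)
    (U : Uq_hopf q) (act : right_action U)
    (D : SUq3_coproduct q) (h : haar_state D) (L : L2_space h)
    (N : nat) (hN : (0 < N)%N) :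
  (exists f : {linear 'rV[R[i]]_((N + 1) * (N + 2) %/ 2) -> L},
      injective f /\ range f = H0 act L N%:Z) /\
  H0 act L (- N%:Z) = [set 0].
Proof.
split; last by apply: H0_negative; rewrite // oppr_lt0 ltz_nat.
by rewrite -card_simplex2; apply: H0_positive_iso.
Qed.
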